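(* Let $\varphi_1(x)=\sqrt2\sin2\pi x$, $\varphi_2(x)=\sqrt2\sin4\pi x$, $\Phi_k(x)=\int_0^x\varphi_k(s)\,ds$, let $\mu_1,\mu_2\in\mathbb{R}$ satisfy $2|\mu_1|+2|\mu_2|\le1$, and let $C$ be the copula $$C(u,v)=uv+\mu_1\Phi_1(u)\Phi_1(v)+\mu_2\Phi_2(u)\Phi_2(v).$$ Let $U_1,\dots,U_n$ be a realization of the stationary Markov chain generated by $C$ and the uniform marginal distribution on $(0,1)$. Then, as $n\to\infty$, with convergence in distribution: (1) with $\hat\mu_k=\frac{1}{n-1}\sum_{i=1}^{n-1}\varphi_k(U_i)\varphi_k(U_{i+1})$, $k=1,2$, $$\sqrt{n-1}\left(\begin{pmatrix}\hat\mu_1\\ \hat\mu_2\end{pmatrix}-\begin{pmatrix}\mu_1\\ \mu_2\end{pmatrix}\right)\to N\left(\begin{pmatrix}0\\0\end{pmatrix},\begin{pmatrix}1&-\mu_1\mu_2\\-\mu_1\mu_2&1\end{pmatrix}\right);$$ (2) for every $f$ with $\int_0^1f^2(x)\,dx<\infty$, with $\mu=\int_0^1f(x)\,dx$ and $S_n(f)=\sum_{i=1}^nf(U_i)$, $$\sqrt n\left(\frac{S_n(f)}{n}-\mu\right)\to N(0,\sigma_f^2),\qquad \sigma_f^2=\sigma^2+2\left(\frac{\mu_1A_1^2}{1-\mu_1}+\frac{\mu_2A_2^2}{1-\mu_2}\right),$$ where $\sigma^2=\mathrm{var}(f(U_1))$ and $A_i^2=2\left(\int_0^1\sin(2i\pi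 u)f(u)\,du\right)^2$.
   Context: The stationary Markov chain generated by a copula $C$ and the uniform marginal distribution is the stationary Markov chain with each $U_i$ uniform on $(0,1)$ such that $(U_i,U_{i+1})$ has joint distribution function $C$. $N(m,\Sigma)$ denotes the normal distribution with mean $m$ and (co)variance $\Sigma$ (a point mass when the variance is $0$). *)

(* Defs.v *)
From HB Require Import structures.
From mathcomp Require Import all_boot all_order all_algebra.
From mathcomp Require Import all_classical all_reals all_analysis.
From mathcomp Require Import ring lra.

Set Implicit Arguments.
Unset Strict Implicit.
Unset Printing Implicit Defensive.

Import Order.TTheory GRing.Theory Num.Theory.
Import numFieldNormedType.Exports.

Local Open Scope classical_set_scope.
Local Open Scope ring_scope.

Section stationary_chains.
Context d (T : measurableType d) (R : realType) (P : probability T R).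

(* [Z] is a version of the conditional probability of the event [B] given the
   sub-sigma-algebra [G]. *)
Definition is_cond_prob (G : set (set T)) (B : set T) (Z : T -> R) : Prop :=
  [/\ forall A : set R, measurable A -> G (Z @^-1` A),
      P.-integrable [set: T] (EFin \o Z) &
      forall A, G A -> (\int[P]_(w in A) (Z w)%:E)%E = P (A `&` B)].

(* P(U_{n+1} \in B | U_0, ..., U_n) = P(U_{n+1} \in B | U_n) a.s.; conditional
   probabilities being a.s. unique, this says that they share a version. *)
Definition markov_chain (U : nat -> {RV P >-> R}) : Prop :=
  forall (n : nat) (B : set R), measurable B ->
    exists Z : T -> R,
      is_cond_prob (g_sigma_algebra_preimage (U n)) (U n.+1 @^-1` B) Z /\
      is_cond_prob (g_sigma_preimage (fun i : 'I_n.+1 => U i : T -> R))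
        (U n.+1 @^-1` B) Z.

Definition stationary (U : nat -> {RV P >-> R}) : Prop :=
  forall (n k : nat) (A : set (n.-tuple R)), measurable A ->
    P [set w | A [tuple U (k + i)%N w | i < n]] =
    P [set w | A [tuple U i w | i < n]].

Definition uniform01_marginals (U : nat -> {RV P >-> R}) : Prop :=
  forall (i : nat) (A : set R), measurable A ->
    distribution P (U i) A = uniform_prob (@ltr01 R) A.

Definition has_copula (C : R -> R -> R) (U : nat -> {RV P >-> R}) : Prop :=
  forall (i : nat) (u v : R), 0 <= u <= 1 -> 0 <= v <= 1 ->
    P [set w | U i w <= u /\ U i.+1 w <= v] = (C u v)%:E.

(* The sequence is indexed from 0: [U i] is the variable usually written
   U_{i+1}. *)
Definition stationary_copula_chain (C : R -> R -> R)
    (U : nat -> {RV P >-> R}) : Prop :=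
  [/\ markov_chain U, stationary U, uniform01_marginals U & has_copula C U].

End stationary_chains.

(* Convergence in distribution of [X n] to a random element [Y], possibly living
   on another probability space; [Y := idfun] expresses convergence to the
   probability [Q] itself. *)
Definition cvg_in_distribution (R : realType) (E : topologicalType)
    d (T : measurableType d) (P : probability T R) (X : nat -> T -> E)
    d' (T' : measurableType d') (Q : probability T' R) (Y : T' -> E) : Prop :=
  forall g : E -> R, continuous g -> (exists M : R, forall x, `|g x| <= M) ->
    'E_P[g \o X n]%E @[n --> \oo] --> 'E_Q[g \o Y]%E.

Section normal_laws.
Context (R : realType).

(* [normal_prob m s] takes the standard deviation [s], and is not a point mass
   at [s = 0]. *)
Definition normal_law (m v : R) : probability (measurableTypeR R) R :=
  if v == 0 then (\d_(m : measurableTypeR R) : probability (measurableTypeR R) R)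
  else (normal_prob m (Num.sqrt v) : probability (measurableTypeR R) R).

Definition col2 (x y : R) : 'cV[R]_2 := \col_(i < 2) [:: x; y]`_i.

Definition mx2 (a b c d : R) : 'M[R]_2 :=
  \matrix_(i < 2, j < 2) (nth [::] [:: [:: a; b]; [:: c; d]] i)`_j.

(* Lower triangular square root; as [x / 0 = 0], it is also correct for singular
   covariance matrices. *)
Definition cholesky2 (S : 'M[R]_2) : 'M[R]_2 :=
  let a := Num.sqrt (S 0 0) in
  let b := S 1 0 / a in
  mx2 a 0 b (Num.sqrt (S 1 1 - b ^+ 2)).

Lemma cholesky2P (S : 'M[R]_2) :
  S^T = S -> (forall x : 'cV[R]_2, 0 <= (x^T *m S *m x) 0 0) ->
  cholesky2 S *m (cholesky2 S)^T = S.
Proof.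
move=> symS psdS.
have lift1 : lift ord0 ord0 = 1 :> 'I_2 by apply/val_inj.
have S01 : S 0 1 = S 1 0 by rewrite -[in LHS]symS mxE.
have qE x y : 0 <= S 0 0 * x ^+ 2 + 2 * S 1 0 * x * y + S 1 1 * y ^+ 2.
  have := psdS (col2 x y).
  rewrite !(mxE, big_ord_recl, big_ord0) /= lift1 S01.
  by congr (0 <= _); ring.
have S00_ge0 : 0 <= S 0 0 by have := qE 1 0; lra.
have S11_ge0 : 0 <= S 1 1 by have := qE 0 1; lra.
set a := Num.sqrt (S 0 0); set b := S 1 0 / a.
have aa : a * a = S 0 0 by rewrite -expr2 sqr_sqrtr.
have ab : a * b = S 1 0.
  have [a0|a_neq0] := eqVneq a 0; last by rewrite /b mulrC divfK.
  rewrite a0 mul0r.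
  have S000 : S 0 0 = 0 by rewrite -aa a0 mulr0.
  apply/esym/eqP; rewrite -sqrf_eq0 eq_le sqr_ge0 andbT.
  have := qE (- (S 1 1 + 1)) (2 * S 1 0).
  rewrite S000; nra.
have cc : 0 <= S 1 1 - b ^+ 2.
  have [a0|a_neq0] := eqVneq a 0.
    by rewrite /b a0 invr0 mulr0 expr0n subr0.
  have a2_gt0 : 0 < a ^+ 2 by rewrite exprn_even_gt0.
  rewrite -(pmulr_rge0 _ a2_gt0) -(pmulr_rge0 _ a2_gt0).
  have := qE (- S 1 0) (S 0 0); rewrite -aa -ab.
  by congr (0 <= _); ring.
have sc := sqr_sqrtr cc.
apply/matrixP => i j.
rewrite !(mxE, big_ord_recl, big_ord0) /= -/a -/b.
case: i j => [[|[|//]] i2] [[|[|//]] j2] /=;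
  rewrite ?(mulr0, mul0r, addr0) ?aa ?ab.
- by congr (S _ _); exact/val_inj.
- by rewrite -S01; congr (S _ _); exact/val_inj.
- by rewrite mulrC ab; congr (S _ _); exact/val_inj.
- by rewrite -!expr2 sc addrC subrK; congr (S _ _); exact/val_inj.
Qed.

Definition std_normal2 :
    probability (measurableTypeR R * measurableTypeR R)%type R :=
  (normal_prob 0 1 \x normal_prob 0 1)%E.

(* The random vector [m + L Z] with [L L^T = S] and [Z] standard normal: under
   [std_normal2] its law is N(m, S). *)
Definition normal_vector2 (m : 'cV[R]_2) (S : 'M[R]_2) (z : R * R) : 'cV[R]_2 :=
  m + cholesky2 S *m col2 z.1 z.2.

End normal_laws.

Section perturbation.
Context (R : realType).
Implicit Types (x u v : R) (k : nat).

Definition phi k x : R := Num.sqrt 2 * sin (2 * k%:R * pi * x).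

Definition Phi k x : R := \int[lebesgue_measure]_(s in `[0, x]) phi k s.

Definition sine_copula (mu1 mu2 u v : R) : R :=
  u * v + mu1 * Phi 1 u * Phi 1 v + mu2 * Phi 2 u * Phi 2 v.

Definition mu_hat (T : Type) (U : nat -> T -> R) k (n : nat) (w : T) : R :=
  (n.-1%:R)^-1 * \sum_(i < n.-1) phi k (U i w) * phi k (U i.+1 w).

Definition fsum (T : Type) (U : nat -> T -> R) (f : R -> R) (n : nat) (w : T) : R :=
  \sum_(i < n) f (U i w).

Definition sin_coef_sqr (f : R -> R) k : R :=
  2 * (\int[lebesgue_measure]_(u in `[0, 1]) (sin (2 * k%:R * pi * u) * f u)) ^+ 2.

End perturbation.

(* Main.v *)
(* The density of the copula is [1 + sum_k mu_k phi_k(x) phi_k(y)], so the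
   transition operator is [Q b = int b + sum_k mu_k <b, phi_k> phi_k], and the
   Poisson equation [g - Q g = b - int b] has the explicit solution
   [g = b + sum_k mu_k / (1 - mu_k) <b, phi_k> phi_k].  Hence each of the sums in the
   theorem is, up to a boundary term bounded in L^1, a sum [S_n] of martingale
   differences [D (U_k, U_{k+1})], whose conditional variances [v (U_k)] are bounded
   even if [f] is only square integrable.

   In the Taylor expansion of [E cos (h S_k + theta)], a second use of the Poisson
   equation replaces [v (U_k)] by its mean [s], so that each step multiplies by
   [exp (- s h^2 / 2)] up to [o(h^2)].  With [h = t / sqrt n] this gives convergence of
   all transforms [E cos (t S_n / sqrt n + theta)] to those of the normal law, which
   are found by solving the differential equation that integration by parts gives.

   Convergence extends from cosines to bounded continuous functions because
   [E sqrt (1 + (S_n / sqrt n)^2)] is bounded and continuous functions are approximated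
   on squares by trigonometric polynomials: a Bernstein polynomial in
   [(1 + sin (x / 2K)) / 2] is one. *)

Require Import Defs.
From HB Require Import structures.
From mathcomp Require Import all_boot all_order all_algebra.
From mathcomp Require Import all_classical all_reals all_analysis.
From mathcomp Require Import measurable_realfun.
From mathcomp Require Import ring lra.

Set Implicit Arguments.
Unset Strict Implicit.
Unset Printing Implicit Defensive.

Import Order.TTheory GRing.Theory Num.Theory.
Import numFieldNormedType.Exports.

Local Open Scope classical_set_scope.
Local Open Scope ring_scope.

(** * Bounded measurable functions and expectations *)

(** The hypotheses give only the joint distribution function of two consecutive variables and a
    common version of two conditional probabilities. Conditional expectations are never formed: what
    is known about the chain is expressed by integrals against a bounded weight [W] measurable with
    respect to the past, and the formula for Q is read off the copula on rays, then extended.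

    Cosines with an arbitrary phase replace complex characteristic functions: with all phases
    allowed they carry the same information, and their linear span is closed under products. Only
    two moments of [D] are available, so the Taylor remainder is the smaller of a square and a cube:
    the square is integrable, the cube gives smallness, and dominated convergence takes the place of
    a Lindeberg condition.

    The function sqrt (1 + x^2) measures tightness because its derivative is bounded, hence an
    admissible weight [W] against which martingale differences integrate to zero, and because it is
    Lipschitz, hence insensitive to a remainder that is bounded only in L^1. *)

Definition bmeas d (T : measurableType d) (R : realType) (f : T -> R) : Prop :=
  measurable_fun [set: T] f /\ exists M : R, forall x, `|f x| <= M.

Section bounded_measurable.
Context d (T : measurableType d) (R : realType).
Implicit Types f g : T -> R.

Lemma bmeas_cst (c : R) : bmeas (fun _ : T => c).
Proof. by split=> //; exists `|c|. Qed.

Lemma bmeasD f g : bmeas f -> bmeas g -> bmeas (fun x => f x + g x).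
Proof.
move=> [mf [M fM]] [mg [N gN]]; split; first exact: measurable_funD.
by exists (M + N) => x; rewrite (le_trans (ler_normD _ _))// lerD.
Qed.

Lemma bmeasM f g : bmeas f -> bmeas g -> bmeas (fun x => f x * g x).
Proof.
move=> [mf [M fM]] [mg [N gN]]; split; first exact: measurable_funM.
by exists (M * N) => x; rewrite normrM ler_pM.
Qed.

Lemma bmeasN f : bmeas f -> bmeas (fun x => - f x).
Proof.
move=> [mf [M fM]]; split; first exact: measurableT_comp.
by exists M => x; rewrite normrN.
Qed.

Lemma bmeasB f g : bmeas f -> bmeas g -> bmeas (fun x => f x - g x).
Proof. by move=> bf bg; apply: bmeasD => //; exact: bmeasN. Qed.

Lemma bmeasX f n : bmeas f -> bmeas (fun x => f x ^+ n).
Proof.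
move=> [mf [M fM]]; split; first exact: measurable_funX.
by exists (M ^+ n) => x; rewrite normrX lerXn2r// nnegrE// (le_trans _ (fM x)).
Qed.

Lemma bmeas_sin f : measurable_fun [set: T] f -> bmeas (fun x => sin (f x)).
Proof.
move=> mf; split.
  exact: (measurableT_comp (continuous_measurable_fun (@continuous_sin R)) mf).
by exists 1 => x; rewrite ler_norml sin_geN1 sin_le1.
Qed.

Lemma bmeas_cos f : measurable_fun [set: T] f -> bmeas (fun x => cos (f x)).
Proof.
move=> mf; split.
  exact: (measurableT_comp (continuous_measurable_fun (@continuous_cos R)) mf).
by exists 1 => x; rewrite ler_norml cos_geN1 cos_le1.
Qed.

Lemma bmeas_indic (A : set T) : measurable A -> bmeas (\1_A : T -> R).
Proof.
move=> mA; split=> //; exists 1 => x.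
by rewrite indicE; case: (x \in A); rewrite ?normr1 ?normr0.
Qed.

End bounded_measurable.

Lemma bmeas_comp d (T : measurableType d) d' (T' : measurableType d')
    (R : realType) (f : T' -> R) (h : T -> T') :
  measurable_fun [set: T] h -> bmeas f -> bmeas (fun x => f (h x)).
Proof.
move=> mh [mf [M fM]]; split; first exact: measurableT_comp.
by exists M.
Qed.

Section approximation.
Import HBNNSimple.

(** The sequence is returned instead of the conclusion [Pr f], because [f] may be unbounded and each
    use has its own dominating function for the passage to the limit. The approximants are
    differences of simple functions below the positive and the negative part. *)
Lemma measurable_approx d (T : measurableType d) (R : realType)
    (Pr : (T -> R) -> Prop) :
  (forall A, measurable A -> Pr (\1_A)) ->
  (forall (c : R) (f g : T -> R), bmeas f -> bmeas g -> Pr f -> Pr g ->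
    Pr (fun x => c * f x + g x)) ->
  forall f : T -> R, measurable_fun [set: T] f ->
  exists f_ : nat -> T -> R,
    [/\ forall n, bmeas (f_ n), forall n, Pr (f_ n),
        forall n x, `|f_ n x| <= `|f x| &
        forall x, f_ ^~ x @ \oo --> f x].
Proof.
move=> Pr1 PrL f mf.
have Pr0 : Pr (fun _ => 0).
  have -> : (fun _ : T => 0 : R) = \1_set0 by apply/funext => x; rewrite indic0.
  exact: Pr1.
have PrZ c A : measurable A -> bmeas (fun x => c * \1_A x : R) /\ Pr (fun x => c * \1_A x).
  move=> mA; split; first by apply: bmeasM; [exact: bmeas_cst|exact: bmeas_indic].
  have := PrL c _ _ (bmeas_indic R mA) (bmeas_cst _ 0) (Pr1 _ mA) Pr0.
  by under eq_fun do rewrite addr0.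
have Prsum (I : Type) (s : seq I) (c : I -> R) (A : I -> set T) :
    (forall i, measurable (A i)) ->
    bmeas (fun x => \sum_(i <- s) c i * \1_(A i) x : R) /\
    Pr (fun x => \sum_(i <- s) c i * \1_(A i) x).
  move=> mA; elim: s => [|i s [bs Ps]].
    by under eq_fun do rewrite big_nil; split=> //; exact: bmeas_cst.
  under eq_fun do rewrite big_cons.
  split; first by apply: bmeasD => //; have [] := PrZ (c i) _ (mA i).
  exact: PrL (bmeas_indic R (mA i)) bs (Pr1 _ (mA i)) Ps.
have Prn (g : {nnsfun T >-> R}) : bmeas g /\ Pr g.
  have -> : (g : T -> R) = fun x => \sum_(y <- finmap.enum_fset (fset_set (range g)))
      y * \1_(g @^-1` [set y]) x.
    by apply/funext => x; rewrite {1}fimfunE fsbig_finite.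
  exact: Prsum.
have mfE : measurable_fun [set: T] (EFin \o f) by exact/measurable_EFinP.
pose p := nnsfun_approx measurableT (measurable_funepos mfE).
pose q := nnsfun_approx measurableT (measurable_funeneg mfE).
have pE n x : ((p n x)%:E <= (EFin \o f)^\+ x)%E.
  rewrite /p nnsfun_approxE; apply: le_approx => //.
have qE n x : ((q n x)%:E <= (EFin \o f)^\- x)%E.
  rewrite /q nnsfun_approxE; apply: le_approx => //.
exists (fun n x => -1 * q n x + p n x); split.
- move=> n; apply: bmeasD; last by have [] := Prn (p n).
  by apply: bmeasM; [exact: bmeas_cst|have [] := Prn (q n)].
- by move=> n; have [bp Pp] := Prn (p n); have [bq Pq] := Prn (q n); exact: PrL.
(* At each point one of the two parts of [f] vanishes, and with it its approximant; hence the
   difference stays below |f|. *)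
- move=> n x; have := pE n x; have := qE n x.
  rewrite funeposE funenegE /= -!EFin_max !lee_fin.
  have p0 : 0 <= p n x by [].
  have q0 : 0 <= q n x by [].
  rewrite !le_max => /orP q1 /orP p1; rewrite ler_norml.
  have [f0|f0] := leP 0 (f x).
    by rewrite ger0_norm//; apply/andP; split; case: q1; case: p1; lra.
  by rewrite ltr0_norm//; apply/andP; split; case: q1; case: p1; lra.
move=> x.
have hp : (p n x) @[n --> \oo] --> Num.max (f x) 0.
  have := @cvg_nnsfun_approx _ _ _ _ measurableT _ (measurable_funepos mfE)
    (fun _ _ => funepos_ge0 _ _) x I.
  by rewrite funeposE /= -EFin_max => /fine_cvgP[].
have hq : (q n x) @[n --> \oo] --> Num.max (- f x) 0.
  have := @cvg_nnsfun_approx _ _ _ _ measurableT _ (measurable_funeneg mfE)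
    (fun _ _ => funeneg_ge0 _ _) x I.
  by rewrite funenegE /= -EFin_max => /fine_cvgP[].
have -> : f x = -1 * Num.max (- f x) 0 + Num.max (f x) 0.
  by rewrite !maxEle; case: ifP; case: ifP => ? ?; lra.
by apply: cvgD => //; apply: cvgM => //; exact: cvg_cst.
Qed.

End approximation.

Section expectation.
Context d (T : measurableType d) (R : realType) (P : probability T R).
Implicit Types (f g h : T -> R) (c : R).

Definition integr f : Prop := P.-integrable [set: T] (EFin \o f).

Lemma integr_measurable f : integr f -> measurable_fun [set: T] f.
Proof. by move=> /measurable_int/measurable_EFinP. Qed.

Lemma integr_bmeas f : bmeas f -> integr f.
Proof.
move=> [mf [M fM]]; apply: measurable_bounded_integrable => //.
  by have /= -> := @probability_setT _ _ _ P; rewrite ltry.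
exists M; split; first exact: num_real.
by move=> N MN x _; exact: le_trans (fM x) (ltW MN).
Qed.

Lemma integr_cst c : integr (fun _ => c).
Proof. exact/integr_bmeas/bmeas_cst. Qed.

Lemma integrD f g : integr f -> integr g -> integr (fun x => f x + g x).
Proof.
by move=> /(integrableD measurableT) if_ /if_; apply: eq_integrable.
Qed.

Lemma integrN f : integr f -> integr (fun x => - f x).
Proof. by move=> /(integrableN); apply: eq_integrable. Qed.

Lemma integrB f g : integr f -> integr g -> integr (fun x => f x - g x).
Proof. by move=> intf intg; apply: integrD => //; exact: integrN. Qed.

Lemma le_integr f g : measurable_fun [set: T] f ->
  (forall x, `|f x| <= g x) -> integr g -> integr f.
Proof.
move=> mf fg; apply: le_integrable => //; first exact/measurable_EFinP.
by move=> x _; rewrite /= lee_fin (le_trans (fg x))// ler_norm.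
Qed.

Lemma integr_norm f : integr f -> integr (fun x => `|f x|).
Proof. by move=> /integrable_norm. Qed.

Lemma integrM h f : bmeas h -> integr f -> integr (fun x => h x * f x).
Proof.
move=> [mh [M hM]] intf.
have /(le_integr _ _) : integr (fun x => M * `|f x|).
  have /(integrableZl measurableT M) := integr_norm intf.
  by apply: eq_integrable.
apply.
  exact: (measurable_funM mh (integr_measurable intf)).
by move=> x; rewrite normrM ler_wpM2r.
Qed.

Lemma integrZ c f : integr f -> integr (fun x => c * f x).
Proof. by apply: integrM; exact: bmeas_cst. Qed.

Lemma integr_sum (I : Type) (s : seq I) (F : I -> T -> R) :
  (forall i, integr (F i)) -> integr (fun x => \sum_(i <- s) F i x).
Proof.
move=> iF; elim: s => [|i s ih].
  by under eq_fun do rewrite big_nil; exact: integr_cst.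
by under eq_fun do rewrite big_cons; exact: integrD.
Qed.

Lemma expectD f g : integr f -> integr g ->
  \int[P]_x (f x + g x) = \int[P]_x f x + \int[P]_x g x.
Proof. exact: RintegralD. Qed.

Lemma expectB f g : integr f -> integr g ->
  \int[P]_x (f x - g x) = \int[P]_x f x - \int[P]_x g x.
Proof. exact: RintegralB. Qed.

Lemma expectZ c f : integr f -> \int[P]_x (c * f x) = c * \int[P]_x f x.
Proof. exact: RintegralZl. Qed.

Lemma expect_cst c : \int[P]_x c = c :> R.
Proof.
rewrite Rintegral_cst//.
have /= -> := @probability_setT _ _ _ P.
by rewrite mulr1.
Qed.

Lemma le_expect f g : integr f -> integr g -> (forall x, f x <= g x) ->
  \int[P]_x f x <= \int[P]_x g x.
Proof. by move=> intf intg fg; apply: le_Rintegral. Qed.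

Lemma expect_ge0 f : (forall x, 0 <= f x) -> 0 <= \int[P]_x f x.
Proof. by move=> f0; apply: Rintegral_ge0. Qed.

Lemma le_norm_expect f g : integr f -> integr g -> (forall x, `|f x| <= g x) ->
  `|\int[P]_x f x| <= \int[P]_x g x.
Proof.
move=> intf intg fg; apply: le_trans (le_normr_Rintegral _ intf) _ => //.
by apply: le_expect => //; exact: integr_norm.
Qed.

Lemma norm_expect_le f (M : R) : measurable_fun [set: T] f ->
  (forall x, `|f x| <= M) -> `|\int[P]_x f x| <= M.
Proof.
move=> mf fM; rewrite -(expect_cst M); apply: le_norm_expect => //.
- by apply: integr_bmeas; split=> //; exists M.
- exact: integr_cst.
Qed.

Lemma dominated_expect (f_ : nat -> T -> R) f g :
  (forall n, measurable_fun [set: T] (f_ n)) -> measurable_fun [set: T] f ->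
  integr g -> (forall n x, `|f_ n x| <= g x) ->
  (forall x, f_ ^~ x @ \oo --> f x) ->
  \int[P]_x f_ n x @[n --> \oo] --> \int[P]_x f x.
Proof.
move=> mf_ mf intg fg f_f.
have := @dominated_convergence _ _ _ P _ measurableT
  (fun n => EFin \o f_ n) (EFin \o f) (EFin \o g).
case=> //.
- by move=> n; exact/measurable_EFinP.
- exact/measurable_EFinP.
- by apply: aeW => x _; apply: cvg_EFin; [exact: nearW|exact: f_f].
- by apply: aeW => x n _; rewrite /= lee_fin.
move=> /integrable_fin_num intf _.
by rewrite -(fineK (intf measurableT)) => /fine_cvgP[].
Qed.

Lemma expect_indic (A : set T) : measurable A -> \int[P]_x \1_A x = fine (P A).
Proof. by move=> mA; rewrite /Rintegral integral_indic// setIT. Qed.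

Lemma expect_indicM (A : set T) f : measurable A ->
  \int[P]_x (\1_A x * f x) = \int[P]_(x in A) f x.
Proof.
move=> mA; rewrite [RHS]Rintegral_mkcond; apply: eq_Rintegral => x _.
by rewrite patchE indicE; case: (x \in A); rewrite ?mul1r ?mul0r.
Qed.

Lemma integr_of_sqr f : measurable_fun [set: T] f ->
  integr (fun x => f x ^+ 2) -> integr f.
Proof.
move=> mf if2; apply: (@le_integr f (fun x => 1 + f x ^+ 2) mf).
  move=> x; have : 0 <= (`|f x| - 1) ^+ 2 by exact: sqr_ge0.
  have : `|f x| ^+ 2 = f x ^+ 2 by rewrite real_normK ?num_real.
  by have := normr_ge0 (f x); nra.
by apply: integrD => //; exact: integr_cst.
Qed.

End expectation.

(** * The transition operator *)

Section monotone_class.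
Context d (T : measurableType d) (R : realType).

(** Dynkin's theorem settles indicators: complements and finite disjoint unions are linear
    combinations, countable unions are bounded pointwise limits. Simple functions then reach every
    bounded measurable function. *)
Lemma functional_monotone_class (G : set (set T)) (Pr : (T -> R) -> Prop) :
  @measurable _ T = <<s G >> -> setI_closed G ->
  Pr (fun _ => 1) -> (forall A, G A -> Pr (\1_A)) ->
  (forall (c : R) (f g : T -> R), bmeas f -> bmeas g -> Pr f -> Pr g ->
    Pr (fun x => c * f x + g x)) ->
  (forall (f_ : nat -> T -> R) (f : T -> R) (M : R), (forall n, bmeas (f_ n)) ->
    bmeas f -> (forall n x, `|f_ n x| <= M) -> (forall n, Pr (f_ n)) ->
    (forall x, f_ ^~ x @ \oo --> f x) -> Pr f) ->
  forall f : T -> R, bmeas f -> Pr f.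
Proof.
move=> GE GI Pr1 PrG PrL PrC.
suff PrA A : measurable A -> Pr (\1_A).
  move=> f [mf [M fM]].
  have [f_ [bf_ Pf_ f_f cf_]] := measurable_approx PrA PrL mf.
  apply: (PrC f_ f M) => //; first by split=> //; exists M.
  by move=> n x; rewrite (le_trans (f_f _ _)).
have m1 B : measurable B -> bmeas (\1_B : T -> R) by exact: bmeas_indic.
move=> mA; rewrite GE in mA.
apply: (@dynkin_induction _ _ G (fun A => Pr (\1_A)) GE GI) => //.
- by rewrite indicT.
- move=> S mS PS.
  have -> : \1_(~` S) = (fun x => -1 * \1_S x + 1) :> (T -> R).
    apply/funext => x; rewrite !indicE in_setC.
    by case: (x \in S); rewrite ?mulr1 ?mulr0 ?addNr ?add0r.
  by apply: PrL => //; [exact: m1|exact: bmeas_cst].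
move=> F mF tF PF.
have mU n : measurable (\big[setU/set0]_(k < n) F k).
  by apply: bigsetU_measurable => k _; exact: mF.
have PU n : Pr (\1_(\big[setU/set0]_(k < n) F k)).
  elim: n => [|n ih].
    rewrite big_ord0.
    have -> : \1_set0 = (fun x => -1 * 1 + 1) :> (T -> R).
      by apply/funext => x; rewrite indic0 mulr1 addNr.
    by apply: PrL => //; exact: bmeas_cst.
  rewrite big_ord_recr/=.
  have -> : \1_(\big[setU/set0]_(k < n) F k `|` F n) =
      (fun x => 1 * \1_(\big[setU/set0]_(k < n) F k) x + \1_(F n) x) :> (T -> R).
    apply/funext => x; rewrite mul1r !indicE in_setU.
    case: (boolP (x \in F n)) => [|_]; last by rewrite orbF addr0.
    rewrite inE => Fnx; rewrite orbT (_ : (x \in _) = false) ?add0r//.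
    apply/negbTE; rewrite notin_setE -bigcup_mkord => -[k /= kn Fkx].
    have /trivIsetP/(_ k n I I) := tF.
    by rewrite neq_ltn kn => /(_ isT) /seteqP[+ _] => /(_ x); apply.
  by apply: PrL => //; exact: m1.
have mUF : measurable (\bigcup_k F k) by apply: bigcup_measurable => k _.
apply: (PrC (fun n => \1_(\big[setU/set0]_(k < n) F k)) _ 1) => //.
- by move=> n; exact: m1.
- exact: m1.
- by move=> n x; rewrite indicE; case: (x \in _); rewrite ?normr1 ?normr0.
move=> x; rewrite !indicE; case: (boolP (x \in \bigcup_k F k)).
  rewrite inE => -[k _ Fkx]; apply: cvg_near_cst; near=> n.
  rewrite indicE (_ : _ \in _ = true)//.
  apply/mem_set; rewrite -bigcup_mkord; exists k => //=.
  by near: n; exact: nbhs_infty_gt.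
rewrite notin_setE => nx; apply: cvg_near_cst; apply: nearW => n.
rewrite indicE (_ : _ \in _ = false)//; apply/negbTE; rewrite notin_setE.
by rewrite -bigcup_mkord => -[k _ Fkx]; apply: nx; exists k.
Unshelve. all: by end_near. Qed.

End monotone_class.

Section uniform_law.
Context (R : realType).

Definition unif : probability (measurableTypeR R) R := uniform_prob (@ltr01 R).

(** Integrability is not assumed: both integrals are split into positive and negative parts, for
    which the formula holds with infinite values allowed. *)
Lemma unif_lebesgue (f : R -> R) : measurable_fun [set: R] f ->
  \int[unif]_x f x = \int[lebesgue_measure]_(x in `[0, 1]) f x.
Proof.
move=> mf; rewrite /Rintegral; congr fine; rewrite integralE [RHS]integralE.
have mfE : measurable_fun [set: R] (EFin \o f) by exact/measurable_EFinP.
congr (_ - _)%E; rewrite integral_uniform.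
- by rewrite subr0 invr1 mul1e.
- exact: measurable_funepos.
- by move=> x; exact: funepos_ge0.
- by rewrite subr0 invr1 mul1e.
- exact: measurable_funeneg.
- by move=> x; exact: funeneg_ge0.
Qed.

Lemma integr_unif_sqr (f : R -> R) : measurable_fun [set: R] f ->
  (\int[lebesgue_measure]_(x in `[0%R, 1%R]) ((f x) ^+ 2)%:E < +oo)%E ->
  integr unif (fun x => f x ^+ 2).
Proof.
move=> mf f2.
have mf2 : measurable_fun [set: R] (EFin \o (fun x => f x ^+ 2)).
  exact/measurable_EFinP/measurable_funX.
apply/integrableP; split => //.
under eq_integral do rewrite /= ger0_norm ?sqr_ge0//.
rewrite integral_uniform//; last by move=> x; rewrite lee_fin sqr_ge0.
by rewrite subr0 invr1 mul1e.
Qed.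

End uniform_law.

Section transition.
Context (R : realType) (mu1 mu2 : R).
Implicit Types (b f g : R -> R).
Local Notation lam := (unif R).

Lemma bmeas_phi k : bmeas (phi k : R -> R).
Proof.
apply: bmeasM; first exact: bmeas_cst.
by apply: bmeas_sin; apply: measurable_funM.
Qed.

Lemma norm_phi_le k (x : R) : `|phi k x| <= 2.
Proof.
have s2 : Num.sqrt 2 <= 2 :> R.
  have := @sqr_sqrtr R 2 (ler0n _ _); have := sqrtr_ge0 (2 : R); nra.
rewrite /phi normrM (ger0_norm (sqrtr_ge0 _)) -[leRHS]mulr1 ler_pM//.
by rewrite ler_norml sin_geN1 sin_le1.
Qed.

Definition coef k b : R := \int[lam]_y (phi k y * b y).

(* The density of [sine_copula] is [1 + sum_k mu_k phi_k(x) phi_k(y)]. *)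
Definition transition b (x : R) : R :=
  \int[lam]_y b y + mu1 * coef 1 b * phi 1 x + mu2 * coef 2 b * phi 2 x.

Lemma integr_phiM k b : integr lam b -> integr lam (fun y => phi k y * b y).
Proof. by apply: integrM; exact: bmeas_phi. Qed.

Lemma coef_lin k (c : R) f g : integr lam f -> integr lam g ->
  coef k (fun y => c * f y + g y) = c * coef k f + coef k g.
Proof.
move=> intf intg; rewrite /coef.
under eq_Rintegral do rewrite mulrDr mulrCA.
have If := integr_phiM k intf; have Ig := integr_phiM k intg.
by rewrite expectD// ?expectZ//; exact: integrZ.
Qed.

Lemma transition_lin (c : R) f g x : integr lam f -> integr lam g ->
  transition (fun y => c * f y + g y) x = c * transition f x + transition g x.
Proof.
move=> intf intg; rewrite /transition !coef_lin// expectD ?expectZ//.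
  by ring.
exact: integrZ.
Qed.

Lemma bmeas_transition b : bmeas (transition b).
Proof.
apply: bmeasD; first apply: bmeasD; first exact: bmeas_cst.
  by apply: bmeasM; [exact: bmeas_cst|exact: bmeas_phi].
by apply: bmeasM; [exact: bmeas_cst|exact: bmeas_phi].
Qed.

Lemma coef_dominated k (f_ : nat -> R -> R) f g :
  (forall n, measurable_fun [set: R] (f_ n)) -> measurable_fun [set: R] f ->
  integr lam g -> (forall n x, `|f_ n x| <= g x) ->
  (forall x, f_ ^~ x @ \oo --> f x) ->
  coef k (f_ n) @[n --> \oo] --> coef k f.
Proof.
move=> mf_ mf intg f_g cf; have [mphi [M phiM]] := bmeas_phi k.
apply: (@dominated_expect _ _ R lam (fun n y => phi k y * f_ n y)
  (fun y => phi k y * f y) (fun x => M * g x)).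
- by move=> n; exact: (measurable_funM mphi (mf_ n)).
- exact: (measurable_funM mphi mf).
- exact: integrZ.
- by move=> n x; rewrite normrM ler_pM.
- by move=> x; apply: cvgM; [exact: cvg_cst|exact: cf].
Qed.

Lemma transition_dominated (f_ : nat -> R -> R) f g x :
  (forall n, measurable_fun [set: R] (f_ n)) -> measurable_fun [set: R] f ->
  integr lam g -> (forall n x, `|f_ n x| <= g x) ->
  (forall x, f_ ^~ x @ \oo --> f x) ->
  transition (f_ n) x @[n --> \oo] --> transition f x.
Proof.
move=> mf_ mf intg f_g cf.
apply: cvgD; first apply: cvgD.
- exact: (@dominated_expect _ _ R lam f_ f g mf_ mf intg f_g cf).
- apply: cvgM; last exact: cvg_cst.
  by apply: cvgM; [exact: cvg_cst|exact: (@coef_dominated 1 f_ f g)].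
- apply: cvgM; last exact: cvg_cst.
  by apply: cvgM; [exact: cvg_cst|exact: (@coef_dominated 2 f_ f g)].
Qed.

(** The kernel of [transition] is bounded, so its values are controlled by the L^1 norm alone. The
    uniformity in [f] provides a constant dominating function when [transition] is applied to a
    sequence. *)
Lemma transition_bounded g : integr lam g -> exists M, forall f x,
  measurable_fun [set: R] f -> (forall x, `|f x| <= g x) -> `|transition f x| <= M.
Proof.
move=> intg.
pose I := \int[lam]_x g x.
exists (I + `|mu1| * (2 * I) * 2 + `|mu2| * (2 * I) * 2) => f x mf fg.
have coefM k : `|coef k f| <= 2 * I.
  rewrite /I -expectZ//; apply: le_norm_expect.
  - by apply: integr_phiM; exact: le_integr intg.
  - exact: integrZ.
  - by move=> y; rewrite normrM ler_pM// norm_phi_le.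
have bnd (m c p : R) : `|c| <= 2 * I -> `|p| <= 2 -> `|m * c * p| <= `|m| * (2 * I) * 2.
  move=> hc hp; rewrite !normrM; apply: ler_pM => //.
  exact: ler_wpM2l.
rewrite /transition (le_trans (ler_normD _ _))// lerD//.
  rewrite (le_trans (ler_normD _ _))// lerD//.
    by apply: le_norm_expect => //; exact: le_integr intg.
  exact: bnd (norm_phi_le _ _).
exact: bnd (norm_phi_le _ _).
Qed.

End transition.

(** * The law of the chain *)

Section chain_law.
Context (R : realType) (mu1 mu2 : R) d (T : measurableType d)
  (P : probability T R) (U : nat -> {RV P >-> R}).
Hypothesis hU : stationary_copula_chain (sine_copula mu1 mu2) U.
Local Notation lam := (unif R).
Local Notation tr := (transition mu1 mu2).

Lemma measurable_chain k : measurable_fun [set: T] (U k : T -> R).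
Proof. exact: measurable_funP. Qed.

Lemma chain_integral k (f : R -> \bar R) : measurable_fun [set: R] f ->
  (forall x, 0 <= f x)%E ->
  (\int[P]_w f (U k w) = \int[lam]_x f x)%E.
Proof.
move=> mf f0.
have mU : @measurable_fun _ _ T (measurableTypeR R) [set: T] (U k).
  exact: measurable_chain.
(* The uniform law lives on [measurableTypeR R]; the variable is repackaged with this codomain so
   that the change of variables for [distribution] applies. *)
pose V : {mfun T >-> measurableTypeR R} :=
  @mfun_Sub _ _ T (measurableTypeR R) (U k) (mem_set mU).
have mf' : measurable_fun [set: measurableTypeR R] f by exact: mf.
transitivity (\int[P]_w (f \o V) w)%E; first by [].
rewrite -(ge0_integral_distribution V mf' f0).
by apply: (eq_measure_integral lam) => A mA _; have [_ _ + _] := hU; exact.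
Qed.

Lemma chain_integr k (f : R -> R) : integr lam f -> integr P (fun w => f (U k w)).
Proof.
move=> intf; have mf := integr_measurable intf.
apply/integrableP; split.
  by apply/measurable_EFinP; exact: (measurableT_comp mf (measurable_chain k)).
rewrite (@chain_integral k (fun x => `|(f x)%:E|%E))//.
  by have /integrableP[] := intf.
by apply: measurableT_comp => //; exact/measurable_EFinP.
Qed.

Lemma chain_expect k (f : R -> R) : measurable_fun [set: R] f ->
  \int[P]_w f (U k w) = \int[lam]_x f x.
Proof.
move=> mf; have mfE : measurable_fun [set: R] (EFin \o f) by exact/measurable_EFinP.
rewrite /Rintegral; congr fine; rewrite integralE [RHS]integralE.
congr (_ - _)%E.
  rewrite -(@chain_integral k ((EFin \o f)^\+)%E).
  - by apply: eq_integral => w _; rewrite !funeposE.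
  - exact: measurable_funepos.
  - by move=> x; exact: funepos_ge0.
rewrite -(@chain_integral k ((EFin \o f)^\-)%E).
- by apply: eq_integral => w _; rewrite !funenegE.
- exact: measurable_funeneg.
- by move=> x; exact: funeneg_ge0.
Qed.

Lemma bmeas_chain k (f : R -> R) : bmeas f -> bmeas (fun w => f (U k w)).
Proof. exact: (bmeas_comp (measurable_chain k)). Qed.

End chain_law.

(** * The law of two consecutive variables *)

Section pair_transition.
Context (R : realType) (mu1 mu2 : R) d (T : measurableType d)
  (P : probability T R) (U : nat -> {RV P >-> R}).
Hypothesis hU : stationary_copula_chain (sine_copula mu1 mu2) U.
Local Notation lam := (unif R).
Local Notation tr := (transition mu1 mu2).
Local Notation lower := (fun u : R => [set x : R | x <= u]).

(** Isolated as a predicate so that a monotone class argument can be run in one of [a], [b] while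
    the other is fixed. *)
Definition pair_transition_at k (a b : R -> R) : Prop :=
  \int[P]_w (a (U k w) * b (U k.+1 w)) = \int[lam]_x (a x * tr b x).

Lemma measurable_lower (u : R) : measurable (lower u).
Proof.
have -> : lower u = `]-oo, u]%classic by apply/seteqP; split=> y /=; rewrite in_itv.
exact: measurable_itv.
Qed.

Lemma unif_lower (u : R) (f : R -> R) : 0 <= u <= 1 -> measurable_fun [set: R] f ->
  \int[lam]_x (\1_(lower u) x * f x) = \int[lebesgue_measure]_(x in `[0, u]) f x.
Proof.
move=> /andP[u0 u1] mf; rewrite unif_lebesgue; last first.
  by apply: measurable_funM => //; apply: measurable_indic; exact: measurable_lower.
rewrite Rintegral_mkcond [RHS]Rintegral_mkcond; apply: eq_Rintegral => x _.
rewrite !patchE !mem_setE !in_itv/= indicE.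
have -> : (x \in lower u) = (x <= u) by apply/idP/idP; rewrite inE.
case: (leP 0 x) => //= x0; case: (leP x u) => xu.
  by rewrite (le_trans xu u1) mul1r.
by rewrite mul0r; case: ifP.
Qed.

(** The left side is C(u, v) by hypothesis. On the right, [coef j] of the ray at [v] is [Phi j v],
    and integrating [phi j] over [0, u] produces [Phi j u]: the copula reappears term by term. *)
Lemma pair_transition_lower k (u v : R) : 0 <= u <= 1 -> 0 <= v <= 1 ->
  pair_transition_at k (\1_(lower u)) (\1_(lower v)).
Proof.
move=> hu hv; rewrite /pair_transition_at.
have mphi j : measurable_fun [set: R] (phi j : R -> R) by have [] := bmeas_phi R j.
have [_ _ _ /(_ k u v hu hv) hC] := hU.
have -> : (fun w => \1_(lower u) (U k w) * \1_(lower v) (U k.+1 w)) =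
    \1_[set w | U k w <= u /\ U k.+1 w <= v] :> (T -> R).
  apply/funext => w; rewrite !indicE -natrM mulnb; congr (_%:R); congr nat_of_bool.
  apply/idP/idP => [/andP[/set_mem/= h1 /set_mem/= h2]|/set_mem[/= h1 h2]].
    exact/mem_set.
  by apply/andP; split; exact/mem_set.
rewrite expect_indic; last first.
  have -> : [set w | U k w <= u /\ U k.+1 w <= v] =
      (U k @^-1` lower u) `&` (U k.+1 @^-1` lower v) by [].
  apply: measurableI; rewrite -[X in measurable X]setTI.
    exact: (measurable_chain U k _ (measurable_lower u)).
  exact: (measurable_chain U k.+1 _ (measurable_lower v)).
rewrite hC /sine_copula /=.
have cE j : coef j (\1_(lower v)) = Phi j v.
  rewrite /coef /Phi; under eq_Rintegral do rewrite mulrC.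
  by rewrite unif_lower.
have oneE (t : R) : 0 <= t <= 1 -> \int[lam]_x \1_(lower t) x = t.
  move=> ht; have := @unif_lower t (fun _ => 1) ht.
  under eq_Rintegral do rewrite mulr1.
  move=> -> //; rewrite Rintegral_cst// mul1r.
  have /= -> := @lebesgue_measure_itv R `[0, t]; rewrite lte_fin.
  by case: ifPn => //=; move: ht => /andP[]; lra.
have il : integr lam (\1_(lower u)).
  by apply: integr_bmeas; apply: bmeas_indic; exact: measurable_lower.
have ip j : integr lam (fun x => \1_(lower u) x * phi j x).
  by apply: integrM; [by apply: bmeas_indic; exact: measurable_lower|exact/integr_bmeas/bmeas_phi].
have -> : (fun x => \1_(lower u) x * tr (\1_(lower v)) x) =
    fun x => (v * \1_(lower u) x + (mu1 * Phi 1 v) * (\1_(lower u) x * phi 1 x)) +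
      (mu2 * Phi 2 v) * (\1_(lower u) x * phi 2 x).
  by apply/funext => x; rewrite /transition !cE oneE//; ring.
rewrite (expectD (integrD (integrZ _ il) (integrZ _ (ip 1))) (integrZ _ (ip 2))).
rewrite (expectD (integrZ _ il) (integrZ _ (ip 1))).
rewrite (expectZ _ il) (expectZ _ (ip 1)) (expectZ _ (ip 2)) oneE// !unif_lower//.
by rewrite -/(Phi 1 u) -/(Phi 2 u); ring.
Qed.

Lemma pair_transition_lin_r k (c : R) (a b b' : R -> R) : bmeas a -> bmeas b -> bmeas b' ->
  pair_transition_at k a b -> pair_transition_at k a b' ->
  pair_transition_at k a (fun x => c * b x + b' x).
Proof.
move=> ba bb bb' h h'; rewrite /pair_transition_at.
have ib := integr_bmeas lam bb; have ib' := integr_bmeas lam bb'.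
under eq_Rintegral do rewrite mulrDr mulrCA.
have iL (g : R -> R) : bmeas g -> integr P (fun w => a (U k w) * g (U k.+1 w)).
  move=> bg; apply: integr_bmeas.
  exact: (bmeasM (bmeas_chain U k ba) (bmeas_chain U k.+1 bg)).
have iR (g : R -> R) : integr lam (fun x => a x * tr g x).
  by apply: integr_bmeas; apply: bmeasM => //; exact: bmeas_transition.
rewrite (expectD (integrZ c (iL _ bb)) (iL _ bb')) (expectZ c (iL _ bb)) h h'.
under [RHS]eq_Rintegral do rewrite transition_lin// mulrDr mulrCA.
by rewrite (expectD (integrZ c (iR b)) (iR b')) (expectZ c (iR b)).
Qed.

Lemma pair_transition_lin_l k (c : R) (a a' b : R -> R) : bmeas a -> bmeas a' -> bmeas b ->
  pair_transition_at k a b -> pair_transition_at k a' b ->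
  pair_transition_at k (fun x => c * a x + a' x) b.
Proof.
move=> ba ba' bb h h'; rewrite /pair_transition_at.
have E (x y z : R) : (c * x + y) * z = c * (x * z) + y * z by ring.
under eq_Rintegral do rewrite E.
have iL (g : R -> R) : bmeas g -> integr P (fun w => g (U k w) * b (U k.+1 w)).
  move=> bg; apply: integr_bmeas.
  exact: (bmeasM (bmeas_chain U k bg) (bmeas_chain U k.+1 bb)).
have iR (g : R -> R) : bmeas g -> integr lam (fun x => g x * tr b x).
  by move=> bg; apply: integr_bmeas; apply: bmeasM => //; exact: bmeas_transition.
rewrite (expectD (integrZ c (iL _ ba)) (iL _ ba')) (expectZ c (iL _ ba)) h h'.
under [RHS]eq_Rintegral do rewrite E.
by rewrite (expectD (integrZ c (iR _ ba)) (iR _ ba')) (expectZ c (iR _ ba)).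
Qed.

(** The copula is prescribed on the unit square only. Rays with endpoint outside [0, 1] agree almost
    everywhere with rays at 0 or 1, and this lemma allows the replacement. *)
Lemma pair_transition_null_l k (a a' b : R -> R) : bmeas a -> bmeas a' -> bmeas b ->
  \int[lam]_x `|a x - a' x| = 0 ->
  pair_transition_at k a' b -> pair_transition_at k a b.
Proof.
move=> ba ba' bb h0 h'.
have -> : a = fun x => 1 * (a x - a' x) + a' x by apply/funext => x; ring.
apply: pair_transition_lin_l => //; first exact: bmeasB.
have bd : bmeas (fun x => a x - a' x) by exact: bmeasB.
have id : integr lam (fun x => `|a x - a' x|) by exact/integr_norm/integr_bmeas.
rewrite /pair_transition_at; transitivity (0 : R).
  have [_ [M bM]] := bb.
  apply/eqP; rewrite -normr_le0.
  apply: (@le_trans _ _ (\int[P]_w (M * `|a (U k w) - a' (U k w)|))).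
    apply: le_norm_expect.
    - apply: integr_bmeas.
      exact: (bmeasM (bmeas_chain U k bd) (bmeas_chain U k.+1 bb)).
    - by apply: integrZ; exact: (chain_integr hU k id).
    - by move=> w; rewrite normrM mulrC ler_wpM2r.
  rewrite expectZ; last exact: (chain_integr hU k id).
  rewrite (chain_expect hU k (integr_measurable id)).
  by rewrite h0 mulr0.
have [mt [M tM]] := bmeas_transition mu1 mu2 b.
apply/esym/eqP; rewrite -normr_le0.
apply: (@le_trans _ _ (\int[lam]_x (M * `|a x - a' x|))).
  apply: le_norm_expect.
  - by apply: integr_bmeas; apply: bmeasM => //; exact: bmeas_transition.
  - exact: integrZ.
  - by move=> x; rewrite normrM mulrC ler_wpM2r.
by rewrite expectZ// h0 mulr0.
Qed.

Lemma pair_transition_lim_l k (a_ : nat -> R -> R) (a b : R -> R) (M : R) :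
  (forall n, bmeas (a_ n)) -> bmeas a -> bmeas b -> (forall n x, `|a_ n x| <= M) ->
  (forall n, pair_transition_at k (a_ n) b) ->
  (forall x, a_ ^~ x @ \oo --> a x) -> pair_transition_at k a b.
Proof.
move=> ba_ ba bb aM h ca; rewrite /pair_transition_at.
have [mb [N bN]] := bb; have [mt [N' tN]] := bmeas_transition mu1 mu2 b.
have cL : \int[P]_w (a_ n (U k w) * b (U k.+1 w)) @[n --> \oo] -->
    \int[P]_w (a (U k w) * b (U k.+1 w)).
  apply: (@dominated_expect _ _ R P _ _ (fun _ => M * N)).
  - by move=> n; have [] := bmeasM (bmeas_chain U k (ba_ n)) (bmeas_chain U k.+1 bb).
  - by have [] := bmeasM (bmeas_chain U k ba) (bmeas_chain U k.+1 bb).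
  - exact: integr_cst.
  - by move=> n w; rewrite normrM ler_pM.
  - by move=> w; apply: cvgM; [exact: ca|exact: cvg_cst].
have cR : \int[lam]_x (a_ n x * tr b x) @[n --> \oo] --> \int[lam]_x (a x * tr b x).
  apply: (@dominated_expect _ _ R lam _ _ (fun _ => M * N')).
  - by move=> n; have [] := bmeasM (ba_ n) (bmeas_transition mu1 mu2 b).
  - by have [] := bmeasM ba (bmeas_transition mu1 mu2 b).
  - exact: integr_cst.
  - by move=> n x; rewrite normrM ler_pM.
  - by move=> x; apply: cvgM; [exact: ca|exact: cvg_cst].
have E : (fun n => \int[P]_w (a_ n (U k w) * b (U k.+1 w))) =
    fun n => \int[lam]_x (a_ n x * tr b x) by apply/funext => n; exact: h.
by rewrite E in cL; exact: (cvg_unique (@Rhausdorff R) cL cR).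
Qed.

Lemma pair_transition_lim_r k (b_ : nat -> R -> R) (a b : R -> R) (M : R) :
  (forall n, bmeas (b_ n)) -> bmeas a -> bmeas b -> (forall n x, `|b_ n x| <= M) ->
  (forall n, pair_transition_at k a (b_ n)) ->
  (forall x, b_ ^~ x @ \oo --> b x) -> pair_transition_at k a b.
Proof.
move=> bb_ ba bb bM h cb; rewrite /pair_transition_at.
have [ma [N aN]] := ba.
have [K tK] := transition_bounded mu1 mu2 (integr_cst lam M).
have cL : \int[P]_w (a (U k w) * b_ n (U k.+1 w)) @[n --> \oo] -->
    \int[P]_w (a (U k w) * b (U k.+1 w)).
  apply: (@dominated_expect _ _ R P _ _ (fun _ => N * M)).
  - by move=> n; have [] := bmeasM (bmeas_chain U k ba) (bmeas_chain U k.+1 (bb_ n)).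
  - by have [] := bmeasM (bmeas_chain U k ba) (bmeas_chain U k.+1 bb).
  - exact: integr_cst.
  - by move=> n w; rewrite normrM ler_pM.
  - by move=> w; apply: cvgM; [exact: cvg_cst|exact: cb].
have cR : \int[lam]_x (a x * tr (b_ n) x) @[n --> \oo] --> \int[lam]_x (a x * tr b x).
  apply: (@dominated_expect _ _ R lam _ _ (fun _ => N * K)).
  - by move=> n; have [] := bmeasM ba (bmeas_transition mu1 mu2 (b_ n)).
  - by have [] := bmeasM ba (bmeas_transition mu1 mu2 b).
  - exact: integr_cst.
  - by move=> n x; rewrite normrM ler_pM ?tK//; have [] := bb_ n.
  - move=> x; apply: cvgM; first exact: cvg_cst.
    apply: (@transition_dominated _ _ _ b_ b (fun _ => M)) => //.
    + by move=> n; have [] := bb_ n.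
    + by have [] := bb.
    + exact: integr_cst.
have E : (fun n => \int[P]_w (a (U k w) * b_ n (U k.+1 w))) =
    fun n => \int[lam]_x (a x * tr (b_ n) x) by apply/funext => n; exact: h.
by rewrite E in cL; exact: (cvg_unique (@Rhausdorff R) cL cR).
Qed.

End pair_transition.

(** * The transition operator given the whole past *)

Section markov.
Context (R : realType) (mu1 mu2 : R) d (T : measurableType d)
  (P : probability T R) (U : nat -> {RV P >-> R}).
Hypothesis hU : stationary_copula_chain (sine_copula mu1 mu2) U.
Local Notation lam := (unif R).
Local Notation tr := (transition mu1 mu2).
Local Notation lower := (fun u : R => [set x : R | x <= u]).
Local Notation pair_at := (pair_transition_at mu1 mu2 U).

Lemma expect_null_mul d' (T' : measurableType d') (Q : probability T' R)
    (f g : T' -> R) : bmeas f -> integr Q g -> \int[Q]_x `|g x| = 0 ->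
  \int[Q]_x (f x * g x) = 0.
Proof.
move=> bf ig g0; have [_ [M fM]] := bf.
apply/eqP; rewrite -normr_le0 -(mulr0 M) -g0 -expectZ; last exact: integr_norm.
apply: le_norm_expect; first exact: integrM.
  exact/integrZ/integr_norm.
by move=> x; rewrite normrM ler_wpM2r.
Qed.

(** A null function is sent by [tr] to 0 at every point, because [tr] sees its argument only through
    integrals. *)
Lemma pair_transition_null_r k (a b b' : R -> R) : bmeas a -> bmeas b -> bmeas b' ->
  \int[lam]_x `|b x - b' x| = 0 -> pair_at k a b' -> pair_at k a b.
Proof.
move=> ba bb bb' h0 h'.
have -> : b = fun x => 1 * (b x - b' x) + b' x by apply/funext => x; ring.
have bd : bmeas (fun x => b x - b' x) by exact: bmeasB.
apply: (pair_transition_lin_r 1 ba bd bb' _ h').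
have id : integr lam (fun x => b x - b' x) by exact: integr_bmeas.
rewrite /pair_transition_at; transitivity (0 : R).
  apply: (expect_null_mul (bmeas_chain U k ba) (chain_integr hU k.+1 id)).
  by rewrite (chain_expect hU k.+1 (integr_measurable (integr_norm id))).
have t0 x : tr (fun x => b x - b' x) x = 0.
  have e0 (f : R -> R) : bmeas f -> \int[lam]_x (f x * (b x - b' x)) = 0.
    by move=> bf; exact: expect_null_mul.
  rewrite /transition /coef (e0 _ (bmeas_phi R 1)) (e0 _ (bmeas_phi R 2)).
  have := e0 (fun=> 1) (bmeas_cst _ 1); under eq_Rintegral do rewrite mul1r.
  by move=> ->; rewrite !mulr0 !mul0r !addr0.
by under eq_Rintegral do rewrite t0 mulr0; rewrite expect_cst.
Qed.

Lemma bmeas_lower (u : R) : bmeas (\1_(lower u) : R -> R).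
Proof. by apply: bmeas_indic; exact: measurable_lower. Qed.

Lemma unif_null (f : R -> R) : measurable_fun [set: R] f ->
  (forall x, 0 <= x <= 1 -> f x = 0) -> \int[lam]_x `|f x| = 0.
Proof.
move=> mf f0; rewrite unif_lebesgue; last exact: measurableT_comp.
transitivity (\int[lebesgue_measure]_(x in `[0%R, 1%R]) (0 : R)).
  by apply: eq_Rintegral => x; rewrite inE/= in_itv/= => /f0 ->; rewrite normr0.
by rewrite Rintegral_cst// mul0r.
Qed.

Lemma unif_lower_gt1 (u : R) : 1 <= u ->
  \int[lam]_x `|\1_(lower u) x - \1_(lower 1) x| = 0.
Proof.
move=> u1; apply: unif_null.
  by have [] := bmeasB (bmeas_lower u) (bmeas_lower 1).
move=> x /andP[_ x1]; rewrite !indicE !mem_set ?subrr//=.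
exact: le_trans u1.
Qed.

Lemma unif_lower1 : \int[lam]_x `|1 - \1_(lower 1) x| = 0.
Proof.
apply: unif_null.
  by have [] := bmeasB (bmeas_cst _ 1) (bmeas_lower 1).
by move=> x /andP[_ x1]; rewrite indicE mem_set ?subrr.
Qed.

Lemma unif_lower_lt0 (u : R) : u < 0 ->
  \int[lam]_x `|\1_(lower u) x - \1_(lower 0) x| = 0.
Proof.
(* Within [0, 1] the ray at [u] is empty and the ray at 0 is a single point, so the integral is one
   over the degenerate interval [0, 0]. *)
move=> u0; transitivity (\int[lam]_x (\1_(lower 0) x * 1)); last first.
  rewrite unif_lower ?lexx ?ler01// Rintegral_cst//.
  have /= -> := @lebesgue_measure_itv R `[0, 0]; rewrite lte_fin ltxx.
  by rewrite mulr0.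
have md : measurable_fun [set: R] (fun x => \1_(lower u) x - \1_(lower 0) x : R).
  by have [] := bmeasB (bmeas_lower u) (bmeas_lower 0).
have ml : measurable_fun [set: R] (fun x => \1_(lower 0) x * 1 : R).
  by have [] := bmeasM (bmeas_lower 0) (bmeas_cst _ 1).
rewrite !unif_lebesgue//; last exact: measurableT_comp.
apply: eq_Rintegral => x; rewrite inE/= in_itv/= mulr1 => /andP[x0 _].
rewrite !indicE (_ : x \in lower u = false) ?sub0r ?normrN ?ger0_norm//.
by apply/negbTE; rewrite notin_setE /=; apply/negP; rewrite -ltNge (lt_le_trans u0).
Qed.

Lemma pair_transition_lowerR k (u v : R) : pair_at k (\1_(lower u)) (\1_(lower v)).
Proof.
have bl := bmeas_lower.
have h01 : (0 <= 0 :> R) && (0 <= 1 :> R) by rewrite lexx ler01.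
have h11 : (0 <= 1 :> R) && (1 <= 1 :> R) by rewrite lexx ler01.
have L w : 0 <= w <= 1 -> pair_at k (\1_(lower w)) (\1_(lower v)).
  move=> hw; have [v0|v0] := ltP v 0.
    apply: (pair_transition_null_r (bl _) (bl _) (bl 0) (unif_lower_lt0 v0)).
    exact: pair_transition_lower.
  have [v1|/ltW v1] := leP v 1.
    by apply: pair_transition_lower => //; rewrite v0.
  apply: (pair_transition_null_r (bl _) (bl _) (bl 1) (unif_lower_gt1 v1)).
  exact: pair_transition_lower.
have [u0|u0] := ltP u 0.
  by apply: (pair_transition_null_l hU (bl _) (bl 0) (bl _) (unif_lower_lt0 u0)); exact: L.
have [u1|/ltW u1] := leP u 1; first by apply: L; rewrite u0.
by apply: (pair_transition_null_l hU (bl _) (bl 1) (bl _) (unif_lower_gt1 u1)); exact: L.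
Qed.

Lemma rays_setI_closed : setI_closed (@RGenOInfty.G R).
Proof.
move=> A B [x ->] [y ->]; exists (Num.max x y).
by apply/seteqP; split=> z /=; rewrite !in_itv/= !andbT gt_max => /andP.
Qed.

(** The generators of the Borel sets used here are right rays, whereas the copula describes left
    ones; linearity links the two. *)
Lemma indic_ray (x : R) :
  \1_(`]x, +oo[%classic) = (fun y => -1 * \1_(lower x) y + 1) :> (R -> R).
Proof.
apply/funext => y; rewrite !indicE mem_setE in_itv/= andbT ltNge.
have -> : (y \in lower x) = (y <= x) by apply/idP/idP; rewrite inE.
by case: (y <= x); rewrite ?mulr1 ?mulr0 ?addNr ?add0r.
Qed.

Lemma pair_transition k (a b : R -> R) : bmeas a -> bmeas b -> pair_at k a b.
Proof.
have bl := bmeas_lower; have b1 : bmeas (fun _ : R => 1 : R) by exact: bmeas_cst.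
have GE := @RGenOInfty.measurableE R.
(* The arguments are freed one at a time: [b] for an arbitrary bounded [a], assuming the case of
   rays in the second place, then [a]. *)
suff H a' v : bmeas a' -> pair_at k a' (\1_(lower v)).
  move=> ba; move: b; apply: (functional_monotone_class GE rays_setI_closed).
  - apply: (pair_transition_null_r ba b1 (bl 1) unif_lower1).
    exact: H.
  - move=> _ [x ->]; rewrite indic_ray.
    apply: (pair_transition_lin_r _ ba (bl x) b1); first exact: H.
    apply: (pair_transition_null_r ba b1 (bl 1) unif_lower1).
    exact: H.
  - by move=> c f g bf bg; exact: pair_transition_lin_r.
  - by move=> f_ f M bf_ bf fM hf cf; exact: (pair_transition_lim_r bf_ ba bf fM hf cf).
move=> {a b}; have P1 : pair_at k (fun=> 1) (\1_(lower v)).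
  apply: (pair_transition_null_l hU b1 (bl 1) (bl v) unif_lower1).
  exact: pair_transition_lowerR.
move: a'; apply: (functional_monotone_class GE rays_setI_closed) => //.
- move=> _ [x ->]; rewrite indic_ray.
  by apply: (pair_transition_lin_l _ (bl x) b1 (bl v)) => //; exact: pair_transition_lowerR.
- by move=> c f g bf bg; exact: pair_transition_lin_l.
- by move=> f_ f M bf_ bf fM hf cf; exact: (pair_transition_lim_l bf_ bf (bl v) fM hf cf).
Qed.

(** Unfolds to the sigma-algebra of the past in [markov_chain]. As a type of its own, it lets
    [bmeas] and [measurable_fun] express measurability with respect to the past. *)
Definition past k : measurableType _ := g_sigma_algebraType
  (\big[setU/set0]_(i < k.+1) preimage_set_system setT (U i : T -> R) measurable).

Lemma past_measurable k (A : set T) : @measurable _ (past k) A -> measurable A.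
Proof.
move=> sA; have : @sigma_algebra T setT (@measurable _ T).
  by split=> [|B mB|F mF];
    [exact: measurable0|rewrite setTD; exact: measurableC|exact: bigcupT_measurable].
move=> /smallest_sub; apply; last exact: sA.
elim/big_ind: _ => // [A1 A2 h1 h2 B [/h1|/h2]//|i _ B [C mC <-]].
exact: (measurable_chain U i).
Qed.

Lemma past_measurable_fun k (W : T -> R) :
  @measurable_fun _ _ (past k) R setT W -> measurable_fun [set: T] W.
Proof. by move=> mW _ B mB; apply: (@past_measurable k); exact: mW. Qed.

Lemma past_bmeas k (W : T -> R) : @bmeas _ (past k) R W -> bmeas W.
Proof. by move=> [/past_measurable_fun mW bW]. Qed.

Lemma past_chain k i : (i <= k)%N -> @measurable_fun _ _ (past k) R setT (U i).
Proof.
move=> ik _ B mB; apply: sub_sigma_algebra; rewrite setTI.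
have key n (F : 'I_n -> set (set T)) (j : 'I_n) A :
    F j A -> (\big[setU/set0]_(i < n) F i) A.
  by move=> FA; rewrite (bigD1 j)//=; left.
by apply: (key _ _ (inord i)); exists B => //; rewrite setTI inordK.
Qed.

Lemma abs_expect_eq0 (D : T -> R) (A : set T) : integr P D -> measurable A ->
  (forall w, A w -> 0 <= D w) -> (forall w, ~ A w -> D w <= 0) ->
  \int[P]_w (\1_A w * D w) = 0 -> \int[P]_w (\1_(~` A) w * D w) = 0 ->
  \int[P]_w `|D w| = 0.
Proof.
move=> iD mA A0 A1 h h'.
transitivity (\int[P]_w (\1_A w * D w - \1_(~` A) w * D w)); last first.
  rewrite expectB ?h ?h' ?subr0//; apply: integrM => //; apply: bmeas_indic => //.
  exact: measurableC.
apply: eq_Rintegral => w _; rewrite !indicE in_setC.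
case: (boolP (w \in A)) => [/set_mem/A0 D0|]; rewrite ?mul1r ?mul0r ?subr0 ?sub0r.
  by rewrite ger0_norm.
by rewrite notin_setE => /A1 D0; rewrite ler0_norm.
Qed.

(** The pair law shows that [tr (\1_B) (U k)] is a version of the conditional probability given
    [U k]. It therefore agrees almost surely with the version [Z] of the Markov property, which is
    also a version given the past. *)
Lemma markov_indic k (A : set T) (B : set R) :
  @measurable _ (past k) A -> measurable B ->
  \int[P]_w (\1_A w * \1_B (U k.+1 w)) = \int[P]_w (\1_A w * tr (\1_B) (U k w)).
Proof.
move=> sA mB; have bB : bmeas (\1_B : R -> R) by exact: bmeas_indic.
have mA := past_measurable sA.
have [mk _ _ _] := hU; have [Z [[Z1 Z2 Z3] [_ _ Z4]]] := mk k B mB.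
have mUB : measurable (U k.+1 @^-1` B).
  by rewrite -[X in measurable X]setTI; exact: (measurable_chain U k.+1).
have condE (C : set T) : measurable C ->
    (\int[P]_(w in C) (Z w)%:E)%E = P (C `&` U k.+1 @^-1` B) ->
    \int[P]_w (\1_C w * Z w) = \int[P]_w (\1_C w * \1_B (U k.+1 w)).
  move=> mC ZC; rewrite expect_indicM// /Rintegral ZC -expect_indic; last exact: measurableI.
  by apply: eq_Rintegral => w _; rewrite indicI.
pose D w := Z w - tr (\1_B) (U k w).
have bt := bmeas_transition mu1 mu2 (\1_B : R -> R).
have iD : integr P D.
  by apply: integrB; [exact: Z2|exact/integr_bmeas/(bmeas_chain U k bt)].
have mD : @measurable_fun _ _ (g_sigma_algebra_preimageType (U k)) R setT D.
  apply: measurable_funB.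
    by move=> _ C mC; rewrite setTI; exact: Z1.
  apply: (measurableT_comp (proj1 bt)).
  by move=> _ C mC; exists C.
have D0 (C : set R) : measurable C -> \int[P]_w (\1_(U k @^-1` C) w * D w) = 0.
  move=> mC; have bC : bmeas (\1_C : R -> R) by exact: bmeas_indic.
  have mUC : measurable (U k @^-1` C).
    by rewrite -[X in measurable X]setTI; exact: (measurable_chain U k).
  under eq_Rintegral do rewrite mulrBr.
  have b1 : bmeas (\1_(U k @^-1` C) : T -> R) by exact: bmeas_indic.
  rewrite expectB; last 2 first.
  - exact: integrM.
  - exact: (integrM b1 (integr_bmeas P (bmeas_chain U k bt))).
  rewrite condE//; last by apply: Z3; exists C => //; rewrite setTI.
  have := pair_transition k bC bB; rewrite /pair_transition_at => ->.
  have := chain_expect hU k (proj1 (bmeasM bC bt)) => <-.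
  by rewrite subrr.
(* Since [D] is measurable with respect to [U k], the event D >= 0 has the form [U k] in [C]. So
   [D0] applies to it and to its complement, and E|D| = 0. *)
have [C mC CE] := mD measurableT _ (measurable_itv `[0, +oo[%R).
have E0 : \int[P]_w `|D w| = 0.
  have CD w : (U k @^-1` C) w = (0 <= D w).
    have : ([set: T] `&` U k @^-1` C) w <-> ([set: T] `&` D @^-1` `[0, +oo[) w.
      by rewrite CE.
    rewrite /setI/= in_itv/= andbT => -[h1 h2]; rewrite propeqE.
    by split=> h; [exact: (h1 (conj I h)).2|exact: (h2 (conj I h)).2].
  apply: (abs_expect_eq0 (A := U k @^-1` C)) => //.
  - by rewrite -[X in measurable X]setTI; exact: (measurable_chain U k).
  - by move=> w; rewrite CD.
  - by move=> w; rewrite CD => /negP; rewrite -ltNge => /ltW.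
  - exact: D0.
  - by have := D0 (~` C) (measurableC mC).
have b1 : bmeas (\1_A : T -> R) by exact: bmeas_indic.
rewrite -condE//; last exact: Z4.
have := expect_null_mul b1 iD E0; rewrite /D.
under eq_Rintegral do rewrite mulrBr.
rewrite expectB; last 2 first.
- exact: integrM.
- exact: (integrM b1 (integr_bmeas P (bmeas_chain U k bt))).
by move/eqP; rewrite subr_eq0 => /eqP.
Qed.

(** Here [b] is merely integrable, since it will also be the square of a function that is only
    square integrable. First [W] is approximated for indicators [b], then [b] for the given [W]. *)
Lemma markov_transition k (W : T -> R) (b : R -> R) :
  @bmeas _ (past k) R W -> integr lam b ->
  \int[P]_w (W w * b (U k.+1 w)) = \int[P]_w (W w * tr b (U k w)).
Proof.
have bt b' k' := bmeas_chain U k' (bmeas_transition mu1 mu2 b').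
pose Pr (W : T -> R) b := \int[P]_w (W w * b (U k.+1 w)) = \int[P]_w (W w * tr b (U k w)).
have PrW (B : set R) : measurable B -> forall W, @bmeas _ (past k) R W -> Pr W (\1_B).
  move=> mB W' bW.
  have bB : bmeas (fun w => \1_B (U k.+1 w) : R).
    by apply: (bmeas_chain U k.+1); exact: bmeas_indic.
  have [W_ [bW_ PW_ W_W cW_]] : exists W_ : nat -> T -> R,
      [/\ forall n, @bmeas _ (past k) R (W_ n), forall n, Pr (W_ n) (\1_B),
       forall n w, `|W_ n w| <= `|W' w| & forall w, W_ ^~ w @ \oo --> W' w].
    apply: (@measurable_approx _ (past k) R (fun W => Pr W (\1_B))); last by case: bW.
      by move=> A sA; exact: markov_indic.
    move=> c f g /past_bmeas bf /past_bmeas bg hf hg; rewrite /Pr.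
    have E (x y z : R) : (c * x + y) * z = c * (x * z) + y * z by ring.
    under eq_Rintegral do rewrite E; under [RHS]eq_Rintegral do rewrite E.
    have i1 V h : bmeas V -> bmeas h -> integr P (fun w => V w * h w).
      by move=> bV bh; apply: integr_bmeas; exact: bmeasM.
    rewrite (expectD (integrZ c (i1 _ _ bf bB)) (i1 _ _ bg bB)) (expectZ c (i1 _ _ bf bB)).
    rewrite (expectD (integrZ c (i1 _ _ bf (bt _ _))) (i1 _ _ bg (bt _ _))).
    by rewrite (expectZ c (i1 _ _ bf (bt _ _))) hf hg.
  have bW' := past_bmeas bW.
  have lim (h : T -> R) : bmeas h ->
      \int[P]_w (W_ n w * h w) @[n --> \oo] --> \int[P]_w (W' w * h w).
    move=> bh; apply: (@dominated_expect _ _ R P _ _ (fun w => `|W' w * h w|)).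
    - by move=> n; have [] := bmeasM (past_bmeas (bW_ n)) bh.
    - by have [] := bmeasM bW' bh.
    - by apply: integr_norm; apply: integr_bmeas; exact: bmeasM.
    - by move=> n w; rewrite !normrM ler_wpM2r.
    - by move=> w; apply: cvgM; [exact: cW_|exact: cvg_cst].
  have L := lim _ bB; have L' := lim _ (bt (\1_B) k).
  have E : (fun n => \int[P]_w (W_ n w * \1_B (U k.+1 w))) =
     fun n => \int[P]_w (W_ n w * tr (\1_B) (U k w)).
    by apply/funext => n; exact: PW_.
  by rewrite E in L; exact: (cvg_unique (@Rhausdorff R) L L').
move=> bW ib; have bW' := past_bmeas bW.
have mb := integr_measurable ib.
have [b_ [bb_ Pb_ b_b cb_]] : exists b_ : nat -> R -> R,
    [/\ forall n, bmeas (b_ n), forall n, Pr W (b_ n),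
     forall n w, `|b_ n w| <= `|b w| & forall w, b_ ^~ w @ \oo --> b w].
  apply: (measurable_approx (Pr := Pr W)); last exact: mb.
    by move=> B mB; exact: PrW.
  move=> c f g bf bg hf hg; rewrite /Pr.
  under eq_Rintegral do rewrite mulrDr mulrCA.
  have jf := integr_bmeas lam bf; have jg := integr_bmeas lam bg.
  under [RHS]eq_Rintegral do rewrite transition_lin// mulrDr mulrCA.
  have i1 h : bmeas h -> integr P (fun w => W w * h w).
    by move=> bh; apply: integr_bmeas; exact: bmeasM.
  have If := i1 _ (bmeas_chain U k.+1 bf); have Ig := i1 _ (bmeas_chain U k.+1 bg).
  rewrite (expectD (integrZ c If) Ig) (expectZ c If) hf hg.
  have Jf := i1 _ (bt f k); have Jg := i1 _ (bt g k).
  by rewrite (expectD (integrZ c Jf) Jg) (expectZ c Jf).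
have [M WM] := proj2 bW'.
(* The approximants of [b] lie below |b|, so their images under [tr] share the bound [K]. *)
have [K tK] := transition_bounded mu1 mu2 (integr_norm ib).
have L : \int[P]_w (W w * b_ n (U k.+1 w)) @[n --> \oo] --> \int[P]_w (W w * b (U k.+1 w)).
  have ibU := chain_integr hU k.+1 ib.
  apply: (@dominated_expect _ _ R P _ _ (fun w => `|W w * b (U k.+1 w)|)).
  - by move=> n; have [] := bmeasM bW' (bmeas_chain U k.+1 (bb_ n)).
  - exact: (integr_measurable (integrM bW' ibU)).
  - exact/integr_norm/(integrM bW' ibU).
  - by move=> n w; rewrite !normrM ler_wpM2l.
  - by move=> w; apply: cvgM; [exact: cvg_cst|exact: cb_].
have L' : \int[P]_w (W w * tr (b_ n) (U k w)) @[n --> \oo] --> \int[P]_w (W w * tr b (U k w)).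
  apply: (@dominated_expect _ _ R P _ _ (fun w => M * K)).
  - by move=> n; have [] := bmeasM bW' (bt (b_ n) k).
  - by have [] := bmeasM bW' (bt b k).
  - exact: integr_cst.
  - move=> n w; rewrite normrM ler_pM ?tK//; first by have [] := bb_ n.
  - move=> w; apply: cvgM; first exact: cvg_cst.
    apply: (@transition_dominated _ _ _ b_ b (fun x => `|b x|)) => //.
    + by move=> n; have [] := bb_ n.
    + exact: integr_norm.
have E : (fun n => \int[P]_w (W w * b_ n (U k.+1 w))) =
   fun n => \int[P]_w (W w * tr (b_ n) (U k w)).
  by apply/funext => n; exact: Pb_.
by rewrite E in L; exact: (cvg_unique (@Rhausdorff R) L L').
Qed.

End markov.

(** * Trigonometric estimates and moments *)

Section trigonometric_bounds.
Context (R : realType).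
Implicit Types (x a d : R).

Lemma is_derive_continuous (f : R -> R) x df : is_derive x 1 f df ->
  {for x, continuous f}.
Proof. by move=> [+ _] => /derivable1_diffP/differentiable_continuous. Qed.

(** Differentiating any of the Taylor inequalities below gives an earlier one, down to cos <= 1 and
    sin <= 1; this is the induction step. *)
Lemma nonneg_of_derive (f df : R -> R) :
  (forall x, is_derive x 1 f (df x)) -> 0 <= f 0 ->
  (forall x, 0 <= x -> 0 <= df x) -> forall x, 0 <= x -> 0 <= f x.
Proof.
move=> fE f0 df0 x; rewrite le_eqVlt => /predU1P[<-//|x0].
have [|c] := @MVT R f df 0 x x0.
  by apply: continuous_subspaceT => y; exact: is_derive_continuous (fE y).
rewrite in_itv/= => /andP[c0 _] E.
rewrite -[f x](subrK (f 0)) E subr0 addr_ge0// mulr_ge0// ?df0//; exact: ltW.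
Qed.

Lemma sin_le_id x : 0 <= x -> 0 <= x - sin x.
Proof.
apply: (@nonneg_of_derive (fun y => y - sin y)
  (fun y => 1 - cos y)).
- by rewrite sin0 subrr.
- by move=> y _; rewrite subr_ge0 cos_le1.
Qed.

Lemma cos_ge_quad x : 0 <= x -> 0 <= cos x - 1 + x ^+ 2 / 2.
Proof.
apply: (@nonneg_of_derive (fun y => cos y - 1 + y ^+ 2 / 2)
  (fun y => y - sin y)).
- move=> y; apply: is_derive_eq.
  by rewrite /= /GRing.scale/=; field.
- by rewrite cos0 subrr expr0n mul0r addr0.
- exact: sin_le_id.
Qed.

Lemma cos_ge_lin x : 0 <= x -> 0 <= cos x - 1 + x.
Proof.
apply: (@nonneg_of_derive (fun y => cos y - 1 + y)
  (fun y => 1 - sin y)).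
- move=> y; apply: is_derive_eq.
  by rewrite /= /GRing.scale/=; ring.
- by rewrite cos0 subrr addr0.
- by move=> y _; rewrite subr_ge0 sin_le1.
Qed.

Lemma sin_ge_quad x : 0 <= x -> 0 <= sin x - x + x ^+ 2 / 2.
Proof.
apply: (@nonneg_of_derive (fun y => sin y - y + y ^+ 2 / 2)
  (fun y => cos y - 1 + y)).
- move=> y; apply: is_derive_eq.
  by rewrite /= /GRing.scale/=; field.
- by rewrite sin0 subrr expr0n mul0r addr0.
- exact: cos_ge_lin.
Qed.

Lemma sin_ge_cubic x : 0 <= x -> 0 <= sin x - x + x ^+ 3 / 6.
Proof.
apply: (@nonneg_of_derive (fun y => sin y - y + y ^+ 3 / 6)
  (fun y => cos y - 1 + y ^+ 2 / 2)).
- move=> y; apply: is_derive_eq.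
  by rewrite /= /GRing.scale/=; field.
- by rewrite sin0 subrr expr0n mul0r addr0.
- exact: cos_ge_quad.
Qed.

Lemma cos_le_cubic x : 0 <= x -> 0 <= x ^+ 3 / 6 - (cos x - 1 + x ^+ 2 / 2).
Proof.
apply: (@nonneg_of_derive (fun y => y ^+ 3 / 6 - (cos y - 1 + y ^+ 2 / 2))
  (fun y => sin y - y + y ^+ 2 / 2)).
- move=> y; apply: is_derive_eq.
  by rewrite /= /GRing.scale/=; field.
- by rewrite cos0 !expr0n/= !mul0r; lra.
- exact: sin_ge_quad.
Qed.

Lemma cos_quad_bound x :
  `|cos x - 1 + x ^+ 2 / 2| <= x ^+ 2 / 2 /\
  `|cos x - 1 + x ^+ 2 / 2| <= `|x| ^+ 3 / 6.
Proof.
have [x0 c e] : [/\ 0 <= `|x|, cos x = cos `|x| & x ^+ 2 = `|x| ^+ 2].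
  by rewrite real_normK ?num_real// normr_ge0; case: (ger0P x) => _; rewrite ?cosN.
rewrite c e; have := cos_ge_quad x0; have := cos_le_cubic x0; have := cos_le1 `|x|.
by move=> c1 c2 c3; rewrite ger0_norm//; split; lra.
Qed.

Lemma sin_lin_bound x :
  `|sin x - x| <= x ^+ 2 / 2 /\ `|sin x - x| <= `|x| ^+ 3 / 6.
Proof.
have [x0 c e] : [/\ 0 <= `|x|, `|sin x - x| = `|sin `|x| - `|x| | & x ^+ 2 = `|x| ^+ 2].
  rewrite real_normK ?num_real// normr_ge0; split=> //.
  by case: (ger0P x) => // _; rewrite sinN -opprD normrN.
rewrite c e; have := sin_le_id x0; have := sin_ge_quad x0; have := sin_ge_cubic x0.
by move=> c1 c2 c3; rewrite ler0_norm; [split; lra|lra].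
Qed.

Lemma cos_taylor a d :
  `|cos (a + d) - (cos a * (1 - d ^+ 2 / 2) - sin a * d)| <=
    Num.min (d ^+ 2) (`|d| ^+ 3).
Proof.
have -> : cos (a + d) - (cos a * (1 - d ^+ 2 / 2) - sin a * d) =
    cos a * (cos d - 1 + d ^+ 2 / 2) - sin a * (sin d - d) by rewrite cosD; ring.
have [c1 c2] := cos_quad_bound d; have [s1 s2] := sin_lin_bound d.
have h (u v : R) : `|cos a * u - sin a * v| <= `|u| + `|v|.
  rewrite (le_trans (ler_normB _ _))// !normrM lerD// ler_piMl//.
    by rewrite ler_norml cos_geN1 cos_le1.
  by rewrite ler_norml sin_geN1 sin_le1.
apply: le_trans (h _ _) _; rewrite le_min; apply/andP; split; first by lra.
by have : 0 <= `|d| ^+ 3 by []; lra.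
Qed.

Lemma cos_lipschitz a b : `|cos a - cos b| <= `|a - b|.
Proof.
wlog ab : a b / a < b.
  move=> H; case: (ltgtP a b) => [|ba|->];
    [exact: H|rewrite distrC (distrC a); exact: H|by rewrite subrr normr0].
have [|c _ E] := @MVT R (@cos R) (fun x => - sin x) a b ab.
  by apply: continuous_subspaceT => x; exact: continuous_cos.
rewrite distrC E normrM normrN distrC ler_piMl//.
by rewrite ler_norml sin_geN1 sin_le1.
Qed.

(** Transfers tightness from the martingale to a sum at bounded L^1 distance from it; with [b] = 0
    it gives the linear growth used for integrability. *)
Lemma sqrt1_lipschitz a b : Num.sqrt (1 + a ^+ 2) <= Num.sqrt (1 + b ^+ 2) + `|a - b|.
Proof.
have b0 := sqrtr_ge0 (1 + b ^+ 2); have bb : Num.sqrt (1 + b ^+ 2) ^+ 2 = 1 + b ^+ 2.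
  by rewrite sqr_sqrtr// addr_ge0// sqr_ge0.
have aa : Num.sqrt (1 + a ^+ 2) ^+ 2 = 1 + a ^+ 2.
  by rewrite sqr_sqrtr// addr_ge0// sqr_ge0.
have d0 := normr_ge0 (a - b); have dd : `|a - b| ^+ 2 = (a - b) ^+ 2.
  by rewrite real_normK ?num_real.
have bs : `|b| <= Num.sqrt (1 + b ^+ 2).
  by rewrite -sqrtr_sqr ler_sqrt ?lerDr ?addr_ge0 ?sqr_ge0.
rewrite -(ler_pXn2r (n := 2))// ?nnegrE ?sqrtr_ge0 ?addr_ge0// aa sqrrD bb dd.
have : b * (a - b) <= Num.sqrt (1 + b ^+ 2) * `|a - b|.
  by rewrite (le_trans (ler_norm _))// normrM ler_wpM2r.
rewrite -mulr_natl; nra.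
Qed.

(* Concavity of the square root at [1 + a^2]. *)
Lemma sqrt1_increment a d :
  Num.sqrt (1 + (a + d) ^+ 2) <=
    Num.sqrt (1 + a ^+ 2) + a / Num.sqrt (1 + a ^+ 2) * d + d ^+ 2 / 2.
Proof.
set s := Num.sqrt (1 + a ^+ 2); set u := Num.sqrt _.
have ss : s ^+ 2 = 1 + a ^+ 2 by rewrite sqr_sqrtr// addr_ge0// sqr_ge0.
have uu : u ^+ 2 = 1 + (a + d) ^+ 2 by rewrite sqr_sqrtr// addr_ge0// sqr_ge0.
have s1 : 1 <= s by rewrite -[leLHS]sqrtr1 ler_sqrt ?lerDl ?sqr_ge0// addr_ge0// sqr_ge0.
have s0 : 0 < s by lra.
(* With the denominator cleared, this is s u <= (s^2 + u^2) / 2 together with s >= 1. *)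
have h : s * u <= s * (s + a / s * d + d ^+ 2 / 2).
  have -> : s * (s + a / s * d + d ^+ 2 / 2) = s ^+ 2 + a * d + s * d ^+ 2 / 2.
    by field; rewrite gt_eqF.
  have : 0 <= (s - 1) * d ^+ 2 by rewrite mulr_ge0// ?sqr_ge0//; lra.
  have : 0 <= (s - u) ^+ 2 by exact: sqr_ge0.
  nra.
by rewrite -(ler_pM2l s0).
Qed.

(** The upper bound is exp(-x) <= 1 / (1 + x) <= 1 - x + x^2. *)
Lemma expRN_taylor x : 0 <= x -> `|expR (- x) - (1 - x)| <= x ^+ 2.
Proof.
move=> x0; have h1 := expR_ge1Dx (- x); have h2 := expR_ge1Dx x.
have h3 := expRxMexpNx_1 x; have h4 := expR_gt0 (- x).
have : expR (- x) * (1 + x) <= 1 by rewrite -[leRHS]h3 [leRHS]mulrC ler_wpM2l// ltW.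
by move=> h5; rewrite ger0_norm; nra.
Qed.

End trigonometric_bounds.

(** * Fourier moments and the Poisson equation *)

Section trigonometric_moments.
Context (R : realType) (mu1 mu2 : R).
Local Notation lam := (unif R).
Local Notation tr := (transition mu1 mu2).

Definition cosk k (x : R) : R := cos (2 * k%:R * pi * x).
Definition sink k (x : R) : R := sin (2 * k%:R * pi * x).

Lemma bmeas_cosk k : bmeas (cosk k).
Proof. by apply: bmeas_cos; apply: measurable_funM. Qed.

Lemma bmeas_sink k : bmeas (sink k).
Proof. by apply: bmeas_sin; apply: measurable_funM. Qed.

Lemma unif_FTC (f F : R -> R) : continuous f -> (forall x : R, is_derive x 1 F (f x)) ->
  \int[lam]_x f x = F 1 - F 0.
Proof.
move=> cf dF; rewrite unif_lebesgue; last exact: continuous_measurable_fun.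
rewrite /Rintegral (@continuous_FTC2 _ f F)//.
- exact: continuous_subspaceT.
- split.
  + by move=> x _; have [] := dF x.
  + by apply: cvg_at_right_filter; exact: is_derive_continuous (dF 0).
  + by apply: cvg_at_left_filter; exact: is_derive_continuous (dF 1).
- by move=> x _; rewrite derive1E; have [_] := dF x.
Qed.

Lemma twopiS k : 2 * k.+1%:R * pi = 2 * k%:R * pi + pi *+ 2 :> R.
Proof. by rewrite -(natr1 k) -[pi *+ 2]mulr_natl; ring. Qed.

Lemma sin_2kpi k : sin (2 * k%:R * pi) = 0 :> R.
Proof.
elim: k => [|k ih]; first by rewrite mulr0 mul0r sin0.
by rewrite twopiS sinD ih mul0r add0r sin2pi mulr0.
Qed.

Lemma cos_2kpi k : cos (2 * k%:R * pi) = 1 :> R.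
Proof.
elim: k => [|k ih]; first by rewrite mulr0 mul0r cos0.
by rewrite twopiS cosD ih sin_2kpi mul0r subr0 mul1r cos2pi.
Qed.

Lemma is_derive_sin_lin (c x : R) : is_derive x 1 (fun y => sin (c * y)) (c * cos (c * x)).
Proof.
have h : is_derive x 1 ( *%R c) c by apply: is_derive_eq; rewrite /GRing.scale/= mulr1.
have := @is_derive1_comp R (@sin R) ( *%R c) x _ _ (is_derive_sin _) h.
by rewrite mulrC.
Qed.

Lemma is_derive_cos_lin (c x : R) : is_derive x 1 (fun y => cos (c * y)) (- (c * sin (c * x))).
Proof.
have h : is_derive x 1 ( *%R c) c by apply: is_derive_eq; rewrite /GRing.scale/= mulr1.
have := @is_derive1_comp R (@cos R) ( *%R c) x _ _ (is_derive_cos _) h.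
by rewrite mulNr mulrC.
Qed.

Lemma expect_cosk k : (0 < k)%N -> \int[lam]_x cosk k x = 0.
Proof.
move=> k0; set c : R := 2 * k%:R * pi.
have c0 : c != 0 by rewrite !mulf_neq0// ?pnatr_eq0 ?gt_eqF ?pi_gt0// lt0n_neq0.
have dF (x : R) : is_derive x 1 (fun y => c^-1 * sin (c * y)) (cosk k x).
  have := is_deriveZ c^-1 (is_derive_sin_lin c x).
  by rewrite /GRing.scale/= mulKf.
have cf : continuous (cosk k).
  by move=> x; exact: is_derive_continuous (is_derive_cos_lin c x).
rewrite (unif_FTC cf dF).
by rewrite mulr0 sin0 mulr1 sin_2kpi !mulr0 subrr.
Qed.

Lemma expect_sink k : \int[lam]_x sink k x = 0.
Proof.
case: k => [|k].
  by under eq_Rintegral do rewrite /sink mulr0 !mul0r sin0; rewrite expect_cst.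
set c : R := 2 * k.+1%:R * pi.
have c0 : c != 0 by rewrite !mulf_neq0// ?pnatr_eq0 ?gt_eqF ?pi_gt0.
have dF (x : R) : is_derive x 1 (fun y => - c^-1 * cos (c * y)) (sink k.+1 x).
  have := is_deriveZ (- c^-1) (is_derive_cos_lin c x).
  by rewrite /GRing.scale/= mulrNN mulKf.
have cf : continuous (sink k.+1).
  by move=> x; exact: is_derive_continuous (is_derive_sin_lin c x).
rewrite (unif_FTC cf dF).
by rewrite mulr0 cos0 mulr1 cos_2kpi !mulr1 subrr.
Qed.

Lemma coskD m n x : cosk (m + n) x = cosk m x * cosk n x - sink m x * sink n x.
Proof.
rewrite /cosk /sink -cosD; congr (cos _); rewrite natrD; ring.
Qed.

Lemma sinkD m n x : sink (m + n) x = sink m x * cosk n x + cosk m x * sink n x.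
Proof.
rewrite /cosk /sink -sinD; congr (sin _); rewrite natrD; ring.
Qed.

Lemma cosk_sink_sqr m x : cosk m x ^+ 2 = 1 - sink m x ^+ 2.
Proof. by rewrite /cosk cos2sin2. Qed.

Lemma phiE k x : phi k x = Num.sqrt 2 * sink k x :> R. Proof. by []. Qed.

Lemma sqrt2_sqr : Num.sqrt 2 * Num.sqrt 2 = 2 :> R.
Proof. by rewrite -expr2 sqr_sqrtr. Qed.

(** Product-to-sum formula. The frequencies are written m and m + n so that their difference is a
    natural number without truncated subtraction. *)
Lemma sink_sink m n x :
  sink m x * sink (m + n) x = 2^-1 * (cosk n x - cosk (m + (m + n)) x).
Proof.
rewrite !coskD !sinkD; have := cosk_sink_sqr m x.
set c := cosk m x; set s := sink m x => h.
have -> : c * (c * cosk n x - s * sink n x) = c ^+ 2 * cosk n x - c * s * sink n x by ring.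
by rewrite h; field.
Qed.

Lemma sink_cosk m n x : 
  sink m x * cosk (m + n) x = 2^-1 * (sink (m + (m + n)) x - sink n x) /\
  sink (m + n) x * cosk m x = 2^-1 * (sink (m + (m + n)) x + sink n x).
Proof.
rewrite !coskD !sinkD !coskD; have := cosk_sink_sqr m x.
set c := cosk m x; set s := sink m x => h.
have e : c * (c * sink n x) = sink n x - s * (s * sink n x).
  by rewrite !mulrA -!expr2 h; ring.
by split; lra.
Qed.

Lemma expect_sink_sink m n : (0 < m)%N ->
  \int[lam]_x (sink m x * sink n x) = if m == n then 2^-1 else 0.
Proof.
have aux p q : (0 < p)%N -> \int[lam]_x (sink p x * sink (p + q) x) = if q == 0%N then 2^-1 else 0.
  move=> p0; under eq_Rintegral do rewrite sink_sink.
  have ic k := integr_bmeas lam (bmeas_cosk k).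
  rewrite expectZ; last exact: integrB.
  rewrite expectB// (@expect_cosk (p + (p + q))) ?addn_gt0 ?p0// subr0.
  have [->|q0] := eqVneq q 0%N.
    under eq_Rintegral do rewrite /cosk mulr0 !mul0r cos0.
    by rewrite expect_cst mulr1.
  by rewrite expect_cosk ?lt0n// mulr0.
move=> m0; have [mn|nm] := leqP m n.
  have -> : (m == n) = (n - m == 0)%N by rewrite subn_eq0 eqn_leq mn.
  by under eq_Rintegral do rewrite -{1}(subnKC mn); exact: aux.
have [->|n0] := eqVneq n 0%N.
  under eq_Rintegral do rewrite [X in _ * X]/sink mulr0 !mul0r sin0 mulr0.
  by rewrite expect_cst gtn_eqF.
under eq_Rintegral do rewrite mulrC.
rewrite -(subnKC (ltnW nm)) aux ?lt0n//.
by rewrite subn_eq0 leqNgt nm/= subnKC ?(ltnW nm)// gtn_eqF.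
Qed.

Lemma expect_sink_cosk m n : \int[lam]_x (sink m x * cosk n x) = 0.
Proof.
have is_ k := integr_bmeas lam (bmeas_sink k).
have [mn|/ltnW mn] := leqP m n; rewrite -(subnKC mn).
  under eq_Rintegral do rewrite (sink_cosk _ _ _).1.
  by rewrite expectZ ?expectB ?expect_sink ?subrr ?mulr0//; exact: integrB.
under eq_Rintegral do rewrite (sink_cosk _ _ _).2.
by rewrite expectZ ?expectD ?expect_sink ?addr0 ?mulr0//; exact: integrD.
Qed.

Lemma coef_sink k m : (0 < k)%N ->
  coef k (sink m) = if k == m then Num.sqrt 2 / 2 else 0.
Proof.
move=> k0; rewrite /coef; under eq_Rintegral do rewrite phiE -mulrA.
rewrite expectZ; last exact/integr_bmeas/bmeasM/bmeas_sink/bmeas_sink.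
by rewrite expect_sink_sink//; case: ifP; rewrite ?mulr0.
Qed.

Lemma coef_cosk k m : coef k (cosk m) = 0.
Proof.
rewrite /coef; under eq_Rintegral do rewrite phiE -mulrA.
rewrite expectZ ?expect_sink_cosk ?mulr0//.
exact/integr_bmeas/bmeasM/bmeas_cosk/bmeas_sink.
Qed.

Lemma transition_cosk m x : (0 < m)%N -> tr (cosk m) x = 0.
Proof.
by move=> m0; rewrite /transition !coef_cosk expect_cosk// !mulr0 !mul0r !addr0.
Qed.

Lemma transition_sink m x :
  tr (sink m) x = (m == 1%N)%:R * mu1 * sink 1 x + (m == 2%N)%:R * mu2 * sink 2 x.
Proof.
have h (b : bool) (y : R) : (if b then Num.sqrt 2 / 2 else 0) * (Num.sqrt 2 * y) = b%:R * y.
  case: b; last by rewrite !mul0r.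
  have -> : Num.sqrt 2 / 2 * (Num.sqrt 2 * y) = Num.sqrt 2 * Num.sqrt 2 * y / 2 by ring.
  by rewrite sqrt2_sqr /=; field.
rewrite /transition !coef_sink// expect_sink !phiE add0r -!mulrA !h.
by rewrite ![(1%N == _)]eq_sym ![(2%N == _)]eq_sym; ring.
Qed.

Lemma transition_cst (c : R) x : tr (fun _ => c) x = c.
Proof.
have e0 k : coef k (fun _ => c) = 0.
  rewrite /coef; under eq_Rintegral do rewrite mulrC.
  rewrite expectZ; last exact/integr_bmeas/bmeas_phi.
  under eq_Rintegral do rewrite phiE.
  by rewrite expectZ ?expect_sink ?mulr0//; exact/integr_bmeas/bmeas_sink.
by rewrite /transition !e0 expect_cst !mulr0 !mul0r !addr0.
Qed.

Lemma coef_phi j k : (0 < j)%N -> coef j (phi k) = (j == k)%:R :> R.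
Proof.
move=> j0; have -> : phi k = fun x : R => Num.sqrt 2 * sink k x + 0.
  by apply/funext => x; rewrite addr0.
rewrite coef_lin ?coef_sink//; last 2 first.
- exact/integr_bmeas/bmeas_sink.
- exact: integr_cst.
rewrite [X in _ + X](_ : _ = 0) ?addr0.
  by case: eqP => _; rewrite ?mulr0// mulrA sqrt2_sqr mulfV.
rewrite /coef; under eq_Rintegral do rewrite mulr0; exact: expect_cst.
Qed.

Lemma expect_phi k : \int[lam]_x phi k x = 0 :> R.
Proof.
under eq_Rintegral do rewrite phiE.
by rewrite expectZ ?expect_sink ?mulr0//; exact/integr_bmeas/bmeas_sink.
Qed.

(* Solution [g] of the Poisson equation [g - transition g = b - int b]. *)
Definition poisson (b : R -> R) (x : R) : R :=
  b x + mu1 / (1 - mu1) * coef 1 b * phi 1 x + mu2 / (1 - mu2) * coef 2 b * phi 2 x.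

(** Each [phi k] is an eigenfunction of [tr] with eigenvalue mu_k, and mu_k + mu_k * (mu_k / (1 -
    mu_k)) = mu_k / (1 - mu_k). *)
Lemma transition_poisson b x : 1 - mu1 != 0 -> 1 - mu2 != 0 -> integr lam b ->
  tr (poisson b) x = poisson b x - b x + \int[lam]_y b y.
Proof.
move=> m1 m2 ib; have ip k := integr_bmeas lam (bmeas_phi R k).
set c1 := mu1 / (1 - mu1) * coef 1 b; set c2 := mu2 / (1 - mu2) * coef 2 b.
have -> : poisson b = fun x => c2 * phi 2 x + (c1 * phi 1 x + b x).
  by apply/funext => y; rewrite /poisson -/c1 -/c2; ring.
rewrite !transition_lin//; last exact/integrD/ib/integrZ.
rewrite /transition !coef_phi// !expect_phi/= /c1 /c2.
by field; rewrite m1 m2.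
Qed.

End trigonometric_moments.

(** * Central limit theorem for martingale differences *)

Section martingale_clt.
Context (R : realType) (mu1 mu2 : R) d (T : measurableType d)
  (P : probability T R) (U : nat -> {RV P >-> R}).
Hypothesis hU : stationary_copula_chain (sine_copula mu1 mu2) U.
Hypotheses (mu1_neq1 : 1 - mu1 != 0) (mu2_neq1 : 1 - mu2 != 0).
Local Notation lam := (unif R).
Local Notation tr := (transition mu1 mu2).
Local Notation pois := (poisson mu1 mu2).

(** [D1] and [D2] say that [D k] has conditional mean zero and conditional variance [v (U k)] given
    the past. The envelope [xi] is evaluated at [U k.+1] alone, so that its integrals do not depend
    on [k], all variables being uniform. *)
Variables (D : nat -> T -> R) (xi v : R -> R).
Hypothesis mD : forall k n, (k < n)%N -> @measurable_fun _ _ (past U n) R setT (D k).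
Hypothesis mxi : measurable_fun [set: R] xi.
Hypothesis ixi : integr lam (fun x => xi x ^+ 2).
Hypothesis D_xi : forall k w, `|D k w| <= xi (U k.+1 w).
Hypothesis bv : bmeas v.
Hypothesis D1 : forall k W, @bmeas _ (past U k) R W -> \int[P]_w (W w * D k w) = 0.
Hypothesis D2 : forall k W, @bmeas _ (past U k) R W ->
  \int[P]_w (W w * D k w ^+ 2) = \int[P]_w (W w * v (U k w)).

Definition psum n w : R := \sum_(i < n) D i w.

Lemma psumS n w : psum n.+1 w = psum n w + D n w.
Proof. by rewrite /psum big_ord_recr. Qed.

Lemma past_psum n : @measurable_fun _ _ (past U n) R setT (psum n).
Proof.
suff H m : (m <= n)%N -> @measurable_fun _ _ (past U n) R setT (psum m) by exact: H.
elim: m => [_|m ih mn].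
  have -> : psum 0 = fun=> 0 by apply/funext => w; rewrite /psum big_ord0.
  exact: measurable_cst.
have -> : psum m.+1 = fun w => psum m w + D m w by apply/funext => w; rewrite psumS.
exact: (measurable_funD (ih (ltnW mn)) (mD mn)).
Qed.

Lemma measurable_psum n : measurable_fun [set: T] (psum n).
Proof. exact: past_measurable_fun (@past_psum n). Qed.

Lemma measurable_D k : measurable_fun [set: T] (D k).
Proof. by apply: (@past_measurable_fun _ _ _ P U k.+1); exact: mD. Qed.

Lemma xi_ge0_chain k w : 0 <= xi (U k.+1 w).
Proof. exact: le_trans (D_xi k w). Qed.

Lemma integr_xi : integr lam xi.
Proof. exact: integr_of_sqr. Qed.

Lemma integr_D k : integr P (D k).
Proof.
apply: (le_integr (measurable_D k) (D_xi k)).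
exact: (chain_integr hU k.+1 integr_xi).
Qed.

Lemma integr_D2 k : integr P (fun w => D k w ^+ 2).
Proof.
apply: (le_integr (g := fun w => xi (U k.+1 w) ^+ 2)).
- by apply: measurable_funX; exact: measurable_D.
- move=> w; rewrite normrX lerXn2r ?nnegrE ?xi_ge0_chain//; exact: D_xi.
- exact: (chain_integr hU k.+1 ixi).
Qed.

Local Notation s := (\int[lam]_x v x).

Lemma expect_D2 k : \int[P]_w D k w ^+ 2 = s.
Proof.
have := @D2 k (fun=> 1) (bmeas_cst _ 1).
under eq_Rintegral do rewrite mul1r.
under [RHS]eq_Rintegral do rewrite mul1r.
by move=> ->; rewrite (chain_expect hU k (proj1 bv)).
Qed.

Lemma expect_cond_var_ge0 : 0 <= s.
Proof. by rewrite -(expect_D2 0); apply: expect_ge0 => w; exact: sqr_ge0. Qed.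

Lemma bmeas_poisson : bmeas (pois v).
Proof.
apply: bmeasD; first apply: bmeasD => //.
  by apply: bmeasM; [exact: bmeas_cst|exact: bmeas_phi].
by apply: bmeasM; [exact: bmeas_cst|exact: bmeas_phi].
Qed.

(** The remainder of [cos_taylor] for the increment [h * D k], divided by h^2, with [D k] replaced
    by its envelope. *)
Definition cubic_rem (h x : R) : R := Num.min (xi x ^+ 2) (`|h| * `|xi x| ^+ 3).

Lemma cubic_rem_ge0 h x : 0 <= cubic_rem h x.
Proof. by rewrite /cubic_rem le_min sqr_ge0 mulr_ge0. Qed.

Lemma measurable_cubic_rem h : measurable_fun [set: R] (cubic_rem h).
Proof.
apply: measurable_minr; first exact: measurable_funX.
by apply: measurable_funM => //; apply: measurable_funX; exact: measurableT_comp.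
Qed.

Lemma integr_cubic_rem h : integr lam (cubic_rem h).
Proof.
apply: (@le_integr _ _ R lam _ _ (measurable_cubic_rem h) _ ixi) => x.
by rewrite ger0_norm ?cubic_rem_ge0// /cubic_rem ge_min lexx.
Qed.

(** This plays the role of the Lindeberg condition: the square is the dominating function, the cubic
    bound gives the pointwise limit. *)
Lemma cubic_rem_cvg (h_ : nat -> R) : h_ @ \oo --> 0 ->
  \int[lam]_x cubic_rem (h_ n) x @[n --> \oo] --> 0.
Proof.
move=> h0; rewrite -[X in _ --> X](expect_cst lam 0).
apply: (@dominated_expect _ _ R lam (fun n => cubic_rem (h_ n)) (fun=> 0) _ _ _ ixi).
- by move=> n; exact: measurable_cubic_rem.
- exact: measurable_cst.
- by move=> n x; rewrite ger0_norm ?cubic_rem_ge0// /cubic_rem ge_min lexx.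
move=> x; apply: (@squeeze_cvgr _ _ _ _ (fun=> 0) (fun n => `|h_ n| * `|xi x| ^+ 3)).
- by apply: nearW => n; rewrite cubic_rem_ge0/= /cubic_rem ge_min lexx orbT.
- exact: cvg_cst.
- rewrite -[X in _ --> X](mul0r (`|xi x| ^+ 3)); apply: cvgM; last exact: cvg_cst.
  by rewrite -(normr0 R); exact: cvg_norm.
Qed.

Section step.
Variables (h theta Mw : R).
Hypothesis wM : forall x, `|pois v x| <= Mw.

Definition cosW k w : R := cos (h * psum k w + theta).
Definition sinW k w : R := sin (h * psum k w + theta).
(* The correction replaces the conditional variance [v (U k)] by its mean [s] in the
   recursion satisfied by the expectation of [cosW k]. *)
Definition corrected k : R := \int[P]_w (cosW k w * (1 - h ^+ 2 / 2 * pois v (U k w))).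

Lemma past_argument k : @measurable_fun _ _ (past U k) R setT (fun w => h * psum k w + theta).
Proof.
apply: measurable_funD; last exact: measurable_cst.
by apply: measurable_funM; [exact: measurable_cst|exact: past_psum].
Qed.

Lemma past_cosW k : @bmeas _ (past U k) R (cosW k).
Proof. apply: bmeas_cos; exact: past_argument. Qed.

Lemma past_sinW k : @bmeas _ (past U k) R (sinW k).
Proof. apply: bmeas_sin; exact: past_argument. Qed.

Lemma bmeas_cosW k : bmeas (cosW k).
Proof. exact: past_bmeas (past_cosW k). Qed.

Lemma cosW_le1 k w : `|cosW k w| <= 1.
Proof. by rewrite ler_norml cos_geN1 cos_le1. Qed.

(** Expansion at the argument of [cosW k]: the linear term vanishes by [D1] with weight [sinW k],
    and [D2] with weight [cosW k] turns D^2 into [v (U k)]. *)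
Lemma cosW_taylor k : `|\int[P]_w cosW k.+1 w -
  (\int[P]_w cosW k w - h ^+ 2 / 2 * \int[P]_w (cosW k w * v (U k w)))| <=
  h ^+ 2 * \int[lam]_x cubic_rem h x.
Proof.
have iW := integr_bmeas P (bmeas_cosW k).
have iD2 : integr P (fun w => cosW k w * D k w ^+ 2).
  exact: (integrM (bmeas_cosW k) (integr_D2 k)).
have iD : integr P (fun w => sinW k w * D k w).
  exact: (integrM (past_bmeas (past_sinW k)) (integr_D k)).
have iA := integrB iW (integrZ (h ^+ 2 / 2) iD2).
have iB := integrB iA (integrZ h iD).
have -> : \int[P]_w cosW k w - h ^+ 2 / 2 * \int[P]_w (cosW k w * v (U k w)) =
    \int[P]_w (cosW k w - h ^+ 2 / 2 * (cosW k w * D k w ^+ 2) - h * (sinW k w * D k w)).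
  rewrite (expectB iA (integrZ h iD)) (expectB iW (integrZ _ iD2)).
  by rewrite (expectZ _ iD2) (expectZ h iD) D1 ?D2 ?mulr0 ?subr0//;
    [exact: past_cosW|exact: past_sinW].
have iW' := integr_bmeas P (bmeas_cosW k.+1).
rewrite -(expectB iW' iB).
have ic := integr_cubic_rem h.
have icU : integr P (fun w => cubic_rem h (U k.+1 w)) by exact: (chain_integr hU k.+1 ic).
rewrite -(chain_expect hU k.+1 (integr_measurable ic)) -(expectZ _ icU).
apply: le_norm_expect; [exact: integrB|exact: integrZ|move=> w].
set a := h * psum k w + theta; set e := h * D k w.
have -> : cosW k.+1 w = cos (a + e).
  by rewrite /cosW psumS; congr cos; rewrite /a /e; ring.
have -> : cosW k w - h ^+ 2 / 2 * (cosW k w * D k w ^+ 2) - h * (sinW k w * D k w) =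
    cos a * (1 - e ^+ 2 / 2) - sin a * e.
  by rewrite /cosW /sinW -/a /e; ring.
apply: le_trans (cos_taylor a e) _.
have x0 := xi_ge0_chain k w.
have [h0 hh] : 0 <= `|h| /\ `|h| ^+ 2 = h ^+ 2 by rewrite real_normK ?num_real.
have he : `|e| <= `|h| * xi (U k.+1 w) by rewrite normrM ler_wpM2l// D_xi.
have e2 : e ^+ 2 <= h ^+ 2 * xi (U k.+1 w) ^+ 2.
  by rewrite -(real_normK (num_real e)) -hh -exprMn lerXn2r// nnegrE mulr_ge0.
have e3 : `|e| ^+ 3 <= h ^+ 2 * (`|h| * `|xi (U k.+1 w)| ^+ 3).
  rewrite (ger0_norm x0) mulrA -hh -exprSr -exprMn lerXn2r// nnegrE mulr_ge0//.
rewrite /cubic_rem minr_pMr ?sqr_ge0//.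
by rewrite le_min !ge_min e2 e3 orbT.
Qed.

(** With [cosW k] in both integrals there would be equality, by the Markov property and the Poisson
    equation for [v]. Replacing it by [cosW k.+1] costs at most |h| xi pointwise, the cosine being
    Lipschitz. *)
Lemma cosW_poisson k : `|\int[P]_w (cosW k.+1 w * pois v (U k.+1 w)) -
  \int[P]_w (cosW k w * (pois v (U k w) - v (U k w) + s))| <=
  `|h| * (Mw * \int[lam]_x xi x).
Proof.
have bw := bmeas_poisson; have iw := integr_bmeas lam bw.
have iv := integr_bmeas lam bv.
have -> : \int[P]_w (cosW k w * (pois v (U k w) - v (U k w) + s)) =
    \int[P]_w (cosW k w * pois v (U k.+1 w)).
  rewrite (markov_transition hU (past_cosW k) iw).
  by apply: eq_Rintegral => w _; rewrite transition_poisson.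
have i1 j : integr P (fun w => cosW j w * pois v (U k.+1 w)).
  by apply: integr_bmeas; exact: (bmeasM (bmeas_cosW j) (bmeas_chain U k.+1 bw)).
rewrite -(expectB (i1 k.+1) (i1 k)).
have ixU : integr P (fun w => xi (U k.+1 w)) by exact: (chain_integr hU k.+1 integr_xi).
rewrite -(chain_expect hU k.+1 mxi) mulrA -(expectZ _ ixU).
apply: le_norm_expect; [exact: integrB|exact: integrZ|move=> w].
rewrite -mulrBl normrM.
have c : `|cosW k.+1 w - cosW k w| <= `|h| * xi (U k.+1 w).
  apply: le_trans (cos_lipschitz _ _) _.
  have -> : h * psum k.+1 w + theta - (h * psum k w + theta) = h * D k w.
    by rewrite psumS; ring.
  by rewrite normrM ler_wpM2l// D_xi.
have -> : `|h| * Mw * xi (U k.+1 w) = `|h| * xi (U k.+1 w) * Mw by ring.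
exact: ler_pM.
Qed.

(** The error of one step divided by h^2. With c = s h^2 / 2, the terms come, in order, from the
    Taylor remainder, from [cosW_poisson], from the factor 1 - c acting on the correction, and from
    replacing 1 - c by exp(-c). *)
Definition step_error : R :=
  \int[lam]_x cubic_rem h x + `|h| * (Mw * \int[lam]_x xi x) / 2 +
  s * h ^+ 2 * Mw / 4 + s ^+ 2 * h ^+ 2 / 4 * (1 + h ^+ 2 / 2 * Mw).

Lemma Mw_ge0 : 0 <= Mw.
Proof. exact: le_trans (wM 0). Qed.

Lemma corrected_near k : `|corrected k - \int[P]_w cosW k w| <= h ^+ 2 / 2 * Mw /\
  corrected k = \int[P]_w cosW k w - h ^+ 2 / 2 * \int[P]_w (cosW k w * pois v (U k w)) /\
  `|\int[P]_w (cosW k w * pois v (U k w))| <= Mw.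
Proof.
have bWw := bmeasM (bmeas_cosW k) (bmeas_chain U k bmeas_poisson).
have iWw := integr_bmeas P bWw.
have E : corrected k = \int[P]_w cosW k w -
    h ^+ 2 / 2 * \int[P]_w (cosW k w * pois v (U k w)).
  rewrite -(expectZ _ iWw) -(expectB (integr_bmeas P (bmeas_cosW k)) (integrZ _ iWw)).
  by apply: eq_Rintegral => w _; ring.
have B : `|\int[P]_w (cosW k w * pois v (U k w))| <= Mw.
  apply: norm_expect_le; first exact: (proj1 bWw).
  by move=> w; rewrite normrM -[leRHS]mul1r ler_pM// cosW_le1.
split=> //; rewrite E addrAC subrr add0r normrN normrM ler_pM//.
by rewrite ger0_norm// divr_ge0// sqr_ge0.
Qed.

Lemma corrected_step k :
  `|corrected k.+1 - expR (- (s * h ^+ 2 / 2)) * corrected k| <= h ^+ 2 * step_error.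
Proof.
have [_ [E1 _]] := corrected_near k.+1; have [B0 [E0 N0]] := corrected_near k.
have T1 := cosW_taylor k; have T2 := cosW_poisson k.
have bW := bmeas_cosW k; have iW := integr_bmeas P bW.
have bw := bmeas_poisson.
have iWw := integr_bmeas P (bmeasM bW (bmeas_chain U k bw)).
have iWv := integr_bmeas P (bmeasM bW (bmeas_chain U k bv)).
have E2 : \int[P]_w (cosW k w * (pois v (U k w) - v (U k w) + s)) =
    \int[P]_w (cosW k w * pois v (U k w)) - \int[P]_w (cosW k w * v (U k w)) +
    s * \int[P]_w cosW k w.
  rewrite -(expectB iWw iWv) -(expectZ s iW) -(expectD (integrB iWw iWv) (integrZ s iW)).
  by apply: eq_Rintegral => w _; ring.
have cA : `|\int[P]_w cosW k w| <= 1.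
  by apply: norm_expect_le; [exact: (proj1 bW)|exact: cosW_le1].
rewrite E2 in T2; rewrite E1.
set A := \int[P]_w cosW k w in T1 T2 E0 B0 cA *.
set B := \int[P]_w (cosW k w * pois v (U k w)) in T1 T2 E0 B0 N0 *.
set V := \int[P]_w (cosW k w * v (U k w)) in T1 T2 E0 B0 *.
set e1 := \int[P]_w cosW k.+1 w - _ in T1.
set e2 := \int[P]_w (cosW k.+1 w * pois v (U k.+1 w)) - _ in T2.
set c := s * h ^+ 2 / 2.
have c0 : 0 <= c.
  by apply: divr_ge0 => //; apply: mulr_ge0; [exact: expect_cond_var_ge0|exact: sqr_ge0].
have q0 : 0 <= h ^+ 2 / 2 by rewrite divr_ge0// sqr_ge0.
have M0 := Mw_ge0.
have cor1 : `|corrected k| <= 1 + h ^+ 2 / 2 * Mw.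
  rewrite -[corrected k](subrK A) addrC (le_trans (ler_normD _ _))// lerD//.
(* The integral [V] of the conditional variance has cancelled between the Taylor step and the
   Poisson step, which is the purpose of the correction. *)
have -> : \int[P]_w cosW k.+1 w - h ^+ 2 / 2 * \int[P]_w (cosW k.+1 w * pois v (U k.+1 w)) -
    expR (- c) * corrected k =
    e1 - h ^+ 2 / 2 * e2 - c * (h ^+ 2 / 2) * B - (expR (- c) - (1 - c)) * corrected k.
  by rewrite E0 /e1 /e2 /c; field.
have -> : h ^+ 2 * step_error = h ^+ 2 * \int[lam]_x cubic_rem h x +
    h ^+ 2 / 2 * (`|h| * (Mw * \int[lam]_x xi x)) + c * (h ^+ 2 / 2) * Mw +
    c ^+ 2 * (1 + h ^+ 2 / 2 * Mw).
  by rewrite /step_error /c; field.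
rewrite (le_trans (ler_normB _ _))// lerD//; last first.
  by rewrite normrM ler_pM// expRN_taylor.
rewrite (le_trans (ler_normB _ _))// lerD//; last first.
  rewrite normrM ler_pM// ger0_norm//; exact: mulr_ge0.
rewrite (le_trans (ler_normB _ _))// lerD//.
by rewrite normrM ler_pM// ger0_norm.
Qed.

Lemma corrected_iter n :
  `|corrected n - expR (- (s * h ^+ 2 / 2)) ^+ n * corrected 0| <= n%:R * (h ^+ 2 * step_error).
Proof.
elim: n => [|n ih]; first by rewrite expr0 mul1r subrr normr0 mul0r.
set q := expR _ in ih *.
have q1 : `|q| <= 1.
  rewrite ger0_norm ?expR_ge0// /q expR_le1 oppr_le0 divr_ge0// mulr_ge0// ?sqr_ge0//.
  exact: expect_cond_var_ge0.
have -> : corrected n.+1 - q ^+ n.+1 * corrected 0 =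
    (corrected n.+1 - q * corrected n) + q * (corrected n - q ^+ n * corrected 0).
  by rewrite exprS; ring.
rewrite -(natr1 n) mulrDl mul1r; apply: le_trans (ler_normD _ _) _.
rewrite [leRHS]addrC lerD//; first exact: corrected_step.
by rewrite normrM (le_trans _ ih)// ler_piMl.
Qed.

Lemma cosW_bound n :
  `|\int[P]_w cosW n w - expR (- (n%:R * h ^+ 2 * s / 2)) * cos theta| <=
    n%:R * h ^+ 2 * step_error + h ^+ 2 * Mw.
Proof.
have [Bn _] := corrected_near n; have [B0 _] := corrected_near 0.
have W0 : \int[P]_w cosW 0 w = cos theta.
  have -> : cosW 0 = fun=> cos theta.
    by apply/funext => w; rewrite /cosW /psum big_ord0 mulr0 add0r.
  exact: expect_cst.
have I := corrected_iter n.
rewrite -expRM_natl in I; rewrite W0 in B0.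
have qE : n%:R * - (s * h ^+ 2 / 2) = - (n%:R * h ^+ 2 * s / 2) by field.
rewrite qE in I.
set q := expR _ in I *.
have q1 : `|q| <= 1.
  rewrite ger0_norm ?expR_ge0// /q expR_le1 oppr_le0 divr_ge0// mulr_ge0// ?expect_cond_var_ge0//.
  by rewrite mulr_ge0// sqr_ge0.
have -> : \int[P]_w cosW n w - q * cos theta =
   (corrected n - q * corrected 0) + (q * (corrected 0 - cos theta) -
   (corrected n - \int[P]_w cosW n w)) by ring.
rewrite (le_trans (ler_normD _ _))// lerD//; first by rewrite -mulrA.
rewrite (le_trans (ler_normB _ _))//.
(* One half pays for removing the correction at step n, the other at step 0. *)
have -> : h ^+ 2 * Mw = h ^+ 2 / 2 * Mw + h ^+ 2 / 2 * Mw by field.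
by rewrite lerD// normrM (le_trans _ B0)// ler_piMl.
Qed.

End step.

Theorem psum_cos_cvg (t theta : R) :
  \int[P]_w cos (t / Num.sqrt n%:R * psum n w + theta) @[n --> \oo] -->
    expR (- (t ^+ 2 * s / 2)) * cos theta.
Proof.
have [_ [Mw wM]] := bmeas_poisson.
pose h n : R := t / Num.sqrt n%:R.
have hE n : (0 < n)%N -> n%:R * h n ^+ 2 = t ^+ 2.
  move=> n0; rewrite /h expr_div_n sqr_sqrtr// mulrC divfK// pnatr_eq0 gtn_eqF//.
have h2E n : (0 < n)%N -> h n ^+ 2 = t ^+ 2 * n%:R^-1.
  by move=> n0; rewrite /h expr_div_n sqr_sqrtr.
have inv0 : (n%:R^-1 : R) @[n --> \oo] --> 0.
  apply/gtr0_cvgV0; first by near=> n; rewrite ltr0n; near: n; exact: nbhs_infty_gt.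
  exact: cvgr_idn.
have h20 : h n ^+ 2 @[n --> \oo] --> 0.
  have : t ^+ 2 * n%:R^-1 @[n --> \oo] --> t ^+ 2 * 0 by apply: cvgM => //; exact: cvg_cst.
  rewrite mulr0; apply: cvg_trans; apply: near_eq_cvg; near=> n; rewrite h2E//.
  by near: n; exact: nbhs_infty_gt.
have h0 : `|h n| @[n --> \oo] --> 0.
  have -> : (fun n => `|h n|) = fun n => Num.sqrt (h n ^+ 2).
    by apply/funext => n; rewrite sqrtr_sqr.
  by rewrite -sqrtr0; apply: continuous_cvg => //; exact: sqrt_continuous.
have h0' : h @ \oo --> 0 by exact: norm_cvg0.
(* Since n h^2 = t^2 for n > 0, this is the bound of [cosW_bound]. *)
have E0 : t ^+ 2 * step_error (h n) Mw + h n ^+ 2 * Mw @[n --> \oo] --> 0.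
  have cc (c : R) (F : nat -> R) : F @ \oo --> 0 -> c * F n @[n --> \oo] --> 0.
    by move=> F0; rewrite -(mulr0 c); apply: cvgM => //; exact: cvg_cst.
  rewrite -[X in _ --> X]addr0; apply: cvgD; last by under eq_cvg do rewrite mulrC; exact: cc.
  apply: (cc); rewrite -[X in _ --> X](addr0 0) /step_error; apply: cvgD.
    rewrite -[X in _ --> X](addr0 0); apply: cvgD.
      rewrite -[X in _ --> X](addr0 0); apply: cvgD; first exact: cubic_rem_cvg.
      by under eq_cvg do rewrite -mulrA mulrC; exact: cc.
    have E n : s * h n ^+ 2 * Mw / 4 = (s * Mw / 4) * h n ^+ 2 by ring.
    by under eq_cvg do rewrite E; exact: cc.
  have -> : (fun n => s ^+ 2 * h n ^+ 2 / 4 * (1 + h n ^+ 2 / 2 * Mw)) =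
      fun n => (s ^+ 2 / 4) * h n ^+ 2 + (s ^+ 2 / 8 * Mw) * (h n ^+ 2 * h n ^+ 2).
    by apply/funext => n; field.
  rewrite -[X in _ --> X](addr0 0); apply: cvgD; first exact: cc.
  by apply: (cc); rewrite -(mulr0 0); exact: cvgM.
apply/cvgrPdist_le => e e0.
have /cvgr0Pnorm_le/(_ e e0) := E0; apply: filterS2 (nbhs_infty_gt 0) => n n0 ne.
rewrite distrC; have := cosW_bound (h n) theta wM n.
rewrite hE//; move=> /le_trans; apply.
by rewrite (le_trans _ ne)// ler_norm.
Unshelve. all: by end_near. Qed.

(** By [sqrt1_increment] a step adds a term linear in [D n], whose coefficient is bounded and
    past-measurable so that [D1] removes it, and at most h^2 s / 2 in expectation. *)
Lemma psum_tight (h : R) n :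
  integr P (fun w => Num.sqrt (1 + (h * psum n w) ^+ 2)) /\
  \int[P]_w Num.sqrt (1 + (h * psum n w) ^+ 2) <= 1 + n%:R * h ^+ 2 * (s / 2).
Proof.
have ip m : integr P (psum m).
  by apply: integr_sum => i; exact: integr_D.
have ms m : measurable_fun [set: T] (fun w => Num.sqrt (1 + (h * psum m w) ^+ 2)).
  apply: (measurableT_comp (continuous_measurable_fun (@sqrt_continuous R))).
  apply: measurable_funD => //; apply: measurable_funX.
  by apply: measurable_funM => //; exact: measurable_psum.
have isq m : integr P (fun w => Num.sqrt (1 + (h * psum m w) ^+ 2)).
  apply: (le_integr (ms m) (g := fun w => 1 + `|h * psum m w|)).
    move=> w; rewrite ger0_norm ?sqrtr_ge0//.
    have := sqrt1_lipschitz (h * psum m w) 0.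
    by rewrite expr0n addr0 sqrtr1 subr0.
  by apply: integrD; [exact: integr_cst|exact/integr_norm/integrZ].
split=> //; elim: n => [|n ih].
  have E w : Num.sqrt (1 + (h * psum 0 w) ^+ 2) = 1.
    by rewrite /psum big_ord0 mulr0 expr0n addr0 sqrtr1.
  by under eq_Rintegral do rewrite E; rewrite expect_cst !mul0r addr0.
pose W w := h * psum n w / Num.sqrt (1 + (h * psum n w) ^+ 2).
have bW : @bmeas _ (past U n) R W.
  split; last first.
    exists 1 => w; rewrite /W normrM normfV ler_pdivrMr ?mul1r.
      by rewrite [leRHS]ger0_norm ?sqrtr_ge0// -sqrtr_sqr ler_sqrt ?lerDr// addr_ge0 ?sqr_ge0.
    by rewrite normr_gt0 gt_eqF// sqrtr_gt0 ltr_pwDl// sqr_ge0.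
  have -> : W = (fun y => y / Num.sqrt (1 + y ^+ 2)) \o (fun w => h * psum n w) by [].
  apply: (@measurableT_comp _ _ _ (past U n) R R).
    apply: continuous_measurable_fun => y; apply: cvgM; first exact: cvg_id.
    apply: cvgV; first by rewrite gt_eqF// sqrtr_gt0 ltr_pwDl// sqr_ge0.
    apply: continuous_cvg; first exact: sqrt_continuous.
    by apply: cvgD; [exact: cvg_cst|exact: exprn_continuous].
  by apply: measurable_funM; [exact: measurable_cst|exact: past_psum].
have iWD : integr P (fun w => W w * D n w).
  exact: (integrM (past_bmeas bW) (integr_D n)).
have iR : integr P (fun w => Num.sqrt (1 + (h * psum n w) ^+ 2) + h * (W w * D n w) +
    h ^+ 2 / 2 * D n w ^+ 2).
  apply: integrD; first by apply: integrD => //; exact: integrZ.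
  exact/integrZ/integr_D2.
apply: (@le_trans _ _ (\int[P]_w (Num.sqrt (1 + (h * psum n w) ^+ 2) + h * (W w * D n w) +
    h ^+ 2 / 2 * D n w ^+ 2))).
  apply: le_expect => // w; rewrite psumS mulrDr.
  apply: le_trans (sqrt1_increment _ _) _.
  by rewrite /W le_eqVlt; apply/orP; left; apply/eqP; ring.
rewrite (expectD (integrD (isq n) (integrZ h iWD)) (integrZ _ (integr_D2 n))).
rewrite (expectD (isq n) (integrZ h iWD)) (expectZ _ iWD) (expectZ _ (integr_D2 n)).
rewrite D1// mulr0 addr0 expect_D2 -(natr1 n).
have -> : 1 + (n%:R + 1) * h ^+ 2 * (s / 2) = 1 + n%:R * h ^+ 2 * (s / 2) + h ^+ 2 / 2 * s.
  by field.
by rewrite lerD2r.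
Qed.

End martingale_clt.

(** * From trigonometric polynomials to continuous functions *)

Section bernstein.
Context (R : realType).
Implicit Types (p q x y : R) (F : nat -> R).

(* [bern n F p] is the expectation of [F S] for [S] binomial of parameters [n] and
   [p], by conditioning on the last trial. *)
Fixpoint bern n F p : R :=
  if n is n'.+1 then p * bern n' (fun k => F k.+1) p + (1 - p) * bern n' F p
  else F 0%N.

Lemma bern_lin n c F F' p :
  bern n (fun k => c * F k + F' k) p = c * bern n F p + bern n F' p.
Proof. by elim: n F F' => [//|n ih] F F' /=; rewrite !ih; ring. Qed.

Lemma bern_cst n c p : bern n (fun=> c) p = c.
Proof. by elim: n => [//|n ih] /=; rewrite !ih; ring. Qed.

Lemma bern_le n F F' p : 0 <= p <= 1 -> (forall k, (k <= n)%N -> F k <= F' k) ->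
  bern n F p <= bern n F' p.
Proof.
move=> /andP[p0 p1]; elim: n F F' => [|n ih] F F' FF' /=; first exact: FF'.
rewrite lerD// ler_wpM2l ?subr_ge0// ih// => k kn; apply: FF' => //.
exact: leqW.
Qed.

Lemma eq_bern n F F' p : F =1 F' -> bern n F p = bern n F' p.
Proof. by move=> /funext ->. Qed.

(** The centre [c] is arbitrary because conditioning on a success moves it to c - 1. *)
Lemma bern_sqr n c p :
  bern n (fun k => (k%:R - c) ^+ 2) p = n%:R * p * (1 - p) + (n%:R * p - c) ^+ 2.
Proof.
elim: n c => [|n ih] c /=; first by rewrite mulr0n; ring.
have -> : bern n (fun k => (k.+1%:R - c) ^+ 2) p = bern n (fun k => (k%:R - (c - 1)) ^+ 2) p.
  by apply: eq_bern => k; rewrite -(natr1 k); congr (_ ^+ 2); ring.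
by rewrite !ih -(natr1 n); ring.
Qed.

Lemma bern_variance n p : (0 < n)%N ->
  bern n (fun k => (k%:R / n%:R - p) ^+ 2) p = p * (1 - p) / n%:R.
Proof.
move=> n0; have nn : n%:R != 0 :> R by rewrite pnatr_eq0 gtn_eqF.
have -> : bern n (fun k => (k%:R / n%:R - p) ^+ 2) p =
    bern n (fun k => n%:R ^- 2 * (k%:R - n%:R * p) ^+ 2 + 0) p.
  by apply: eq_bern => k; field.
by rewrite bern_lin bern_cst bern_sqr; field.
Qed.

(** A modulus of continuity quadratic in the increments reduces the Bernstein estimate to a
    variance. By compactness it is enough to find an n that works near each pair of points: on the
    diagonal continuity gives an error below [e], off it n Q exceeds 2 M for large n. *)
Lemma quadratic_modulus (G : R * R -> R) (M e : R) : continuous G ->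
  (forall z, `|G z| <= M) -> 0 < e -> exists2 C : R, 0 <= C &
  forall p q p' q', 0 <= p <= 1 -> 0 <= q <= 1 -> 0 <= p' <= 1 -> 0 <= q' <= 1 ->
    `|G (p', q') - G (p, q)| <= e + C * ((p' - p) ^+ 2 + (q' - q) ^+ 2).
Proof.
move=> cG GM e0.
pose K := (`[0, 1]%classic `*` `[0, 1]%classic : set (R * R)).
have cK : compact (K `*` K).
  by apply: compact_setX; apply: compact_setX; exact: segment_compact.
pose Q (z : (R * R) * (R * R)) := (z.2.1 - z.1.1) ^+ 2 + (z.2.2 - z.1.2) ^+ 2.
pose E (z : (R * R) * (R * R)) := `|G z.2 - G z.1|.
have c11 : continuous (fun z : (R * R) * (R * R) => z.1.1).
  by move=> z; apply: (@continuous_comp _ _ _ fst fst); exact: cvg_fst.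
have c12 : continuous (fun z : (R * R) * (R * R) => z.1.2).
  by move=> z; apply: (@continuous_comp _ _ _ fst snd); [exact: cvg_fst|exact: cvg_snd].
have c21 : continuous (fun z : (R * R) * (R * R) => z.2.1).
  by move=> z; apply: (@continuous_comp _ _ _ snd fst); [exact: cvg_snd|exact: cvg_fst].
have c22 : continuous (fun z : (R * R) * (R * R) => z.2.2).
  by move=> z; apply: (@continuous_comp _ _ _ snd snd); exact: cvg_snd.
have cQ : continuous Q.
  by move=> z; apply: cvgD; rewrite !expr2; apply: cvgM; apply: cvgB;
    [exact: c21|exact: c11|exact: c21|exact: c11|exact: c22|exact: c12|exact: c22|exact: c12].
have cE : continuous E.
  move=> z; apply: cvg_norm; apply: cvgB.
    by apply: (@continuous_comp _ _ _ snd G); [exact: cvg_snd|exact: cG].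
  by apply: (@continuous_comp _ _ _ fst G); [exact: cvg_fst|exact: cG].
have EM z : E z <= 2 * M.
  by rewrite (le_trans (ler_normB _ _))// mulr_natl lerD.
have /compact_near_coveringP nc := cK.
have h : \forall n \near \oo, (K `*` K) `<=` (fun z => E z <= e + n%:R * Q z).
  apply: nc => z _.
  have Q0 z' : 0 <= Q z' by rewrite addr_ge0 ?sqr_ge0.
  have [z0|z0] := eqVneq (Q z) 0.
    have Ez : E z < e.
      have : (z.2.1 - z.1.1) ^+ 2 = 0 /\ (z.2.2 - z.1.2) ^+ 2 = 0.
        by move/eqP: z0; rewrite paddr_eq0 ?sqr_ge0// => /andP[/eqP -> /eqP ->].
      move=> [/eqP + /eqP]; rewrite !sqrf_eq0 !subr_eq0 => /eqP h1 /eqP h2.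
      rewrite /E (_ : z.2 = z.1) ?subrr ?normr0//.
      by case: z h1 h2 {z0} => [[? ?] [? ?]] /= -> ->.
    exists ([set z' | E z' < e], setT).
      split; last exact: filterT.
      exact: (cvgr_lt _ (cE z) _ Ez).
    move=> [z' n] [/= Ez' _]; rewrite (le_trans (ltW Ez'))// lerDl mulr_ge0//.
  have Qz : 0 < Q z by rewrite lt_neqAle eq_sym z0 Q0.
  (* Then n Q(z') >= (4 M / Q z) (Q z / 2) = 2 M, which bounds [E z']. *)
  exists ([set z' | Q z / 2 < Q z'], [set n | 4 * M / Q z <= n%:R]).
    split.
      by apply: (cvgr_gt _ (cQ z)); rewrite ltr_pdivrMr// ltr_pMr// ltr1n.
    exact: nbhs_infty_ger.
  move=> [z' n] [/= Qz' nM]; rewrite (le_trans (EM z'))// ler_wpDl//; first exact: ltW.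
  have n0 : (0 : R) <= n%:R by [].
  rewrite ler_pdivrMr// in nM.
  have : n%:R * (Q z / 2) <= n%:R * Q z' by rewrite ler_wpM2l// ltW.
  lra.
have [n _ /(_ n (leqnn n)) Hn] := h.
exists n%:R => // p q p' q' hp hq hp' hq'.
by have := Hn ((p, q), (p', q')); apply; split; split; rewrite /= in_itv.
Qed.

Definition bern2 n (G : R * R -> R) p q : R :=
  bern n (fun i => bern n (fun j => G (i%:R / n%:R, j%:R / n%:R)) q) p.

Lemma bern2_cvg (G : R * R -> R) (M e : R) : continuous G ->
  (forall z, `|G z| <= M) -> 0 < e -> exists n : nat,
  forall p q, 0 <= p <= 1 -> 0 <= q <= 1 -> `|bern2 n G p q - G (p, q)| <= e.
Proof.
move=> cG GM e0; have e20 : 0 < e / 2 by rewrite divr_gt0.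
have [C C0 HC] := quadratic_modulus cG GM e20.
(* Each coordinate has variance at most 1 / (4 n), so the quadratic term contributes at most C / (2
   n) <= e / 2. *)
have [n nC] : exists n : nat, C / e < n%:R.
  by exists (Num.truncn (C / e)).+1; exact: truncnS_gt.
exists n => p q hp hq.
have n0 : (0 < n)%N.
  by rewrite -(ltr_nat R); apply: le_lt_trans nC; rewrite divr_ge0// ltW.
have nn : 0 < n%:R :> R by rewrite ltr0n.
have node k : (k <= n)%N -> 0 <= (k%:R / n%:R : R) <= 1.
  by move=> kn; rewrite divr_ge0//= ler_pdivrMr// mul1r ler_nat.
have hv (x : R) : 0 <= x <= 1 -> x * (1 - x) / n%:R <= 4^-1 / n%:R.
  move=> _; rewrite ler_wpM2r// ?invr_ge0//.
  have : 0 <= (x - 2^-1) ^+ 2 by exact: sqr_ge0.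
  by lra.
pose F i j : R := (i%:R / n%:R - p) ^+ 2 + (j%:R / n%:R - q) ^+ 2.
have F2 : bern n (fun i => bern n (fun j => e / 2 + C * F i j) q) p <= e.
  have -> : bern n (fun i => bern n (fun j => e / 2 + C * F i j) q) p =
      e / 2 + C * (p * (1 - p) / n%:R + q * (1 - q) / n%:R).
    have E1 i : bern n (fun j => e / 2 + C * F i j) q =
        C * (i%:R / n%:R - p) ^+ 2 + (e / 2 + C * (q * (1 - q) / n%:R)).
      rewrite -(bern_variance q n0).
      have -> : bern n (fun j => e / 2 + C * F i j) q =
         bern n (fun j => C * (j%:R / n%:R - q) ^+ 2 + (e / 2 + C * (i%:R / n%:R - p) ^+ 2)) q.
        by apply: eq_bern => j; rewrite /F; ring.
      by rewrite bern_lin bern_cst; ring.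
    by rewrite (eq_bern n p E1) bern_lin bern_cst bern_variance//; ring.
  have h1 := hv p hp; have h2 := hv q hq.
  have h3 : C / n%:R <= e.
    by rewrite ler_pdivrMr// mulrC -ler_pdivrMr// ltW.
  have : C * (p * (1 - p) / n%:R + q * (1 - q) / n%:R) <= C * (4^-1 / n%:R + 4^-1 / n%:R).
    by rewrite ler_wpM2l// lerD.
  lra.
have bnd i j : (i <= n)%N -> (j <= n)%N ->
    `|G (i%:R / n%:R, j%:R / n%:R) - G (p, q)| <= e / 2 + C * F i j.
  by move=> hi hj; apply: HC => //; exact: node.
have up : bern2 n G p q - G (p, q) <= e.
  apply: le_trans F2.
  have -> : bern2 n G p q - G (p, q) =
      bern n (fun i => bern n (fun j => 1 * G (i%:R / n%:R, j%:R / n%:R) + - G (p, q)) q) p.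
    under eq_bern do rewrite bern_lin bern_cst.
    by rewrite bern_lin bern_cst mul1r.
  apply: bern_le => // i hi; apply: bern_le => // j hj.
  by rewrite mul1r (le_trans (ler_norm _))// bnd.
have lo : - e <= bern2 n G p q - G (p, q).
  rewrite lerNl; apply: le_trans F2.
  have -> : - (bern2 n G p q - G (p, q)) =
      bern n (fun i => bern n (fun j => -1 * G (i%:R / n%:R, j%:R / n%:R) + G (p, q)) q) p.
    under eq_bern do rewrite bern_lin bern_cst.
    by rewrite bern_lin bern_cst mulN1r opprB addrC.
  apply: bern_le => // i hi; apply: bern_le => // j hj.
  by rewrite mulN1r addrC (le_trans (ler_norm _))// distrC bnd.
by rewrite ler_norml lo up.
Qed.

End bernstein.

(** * Trigonometric polynomials in two variables *)

Section trigonometric_polynomials.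
Context (R : realType).

(** The phase covers sines and constants, so that the product-to-sum formula for cosines alone makes
    the class an algebra. *)
Inductive trig : (R -> R -> R) -> Prop :=
| trig_cos c a b theta : trig (fun x y => c * cos (a * x + b * y + theta))
| trig_add f g : trig f -> trig g -> trig (fun x y => f x y + g x y).

Lemma trig_ext f g : (forall x y, f x y = g x y) -> trig f -> trig g.
Proof.
by move=> fg tf; have -> : g = f by apply/funext => x; apply/funext => y; rewrite fg.
Qed.

Lemma trig_cst c : trig (fun _ _ => c).
Proof.
apply: trig_ext (trig_cos c 0 0 0) => x y.
by rewrite !mul0r !addr0 cos0 mulr1.
Qed.

Lemma trig_mul f g : trig f -> trig g -> trig (fun x y => f x y * g x y).
Proof.
move=> tf tg; elim: tf => [c a b t|f1 f2 _ h1 _ h2]; last first.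
  by apply: trig_ext (trig_add h1 h2) => x y; rewrite mulrDl.
elim: tg => [c' a' b' t'|g1 g2 _ h1 _ h2]; last first.
  by apply: trig_ext (trig_add h1 h2) => x y; rewrite mulrDr.
apply: trig_ext (trig_add (trig_cos (c * c' / 2) (a + a') (b + b') (t + t'))
                          (trig_cos (c * c' / 2) (a - a') (b - b') (t - t'))) => x y.
set u := a * x + b * y + t; set w := a' * x + b' * y + t'.
have -> : (a + a') * x + (b + b') * y + (t + t') = u + w by rewrite /u /w; ring.
have -> : (a - a') * x + (b - b') * y + (t - t') = u - w by rewrite /u /w; ring.
by rewrite cosD cosB; field.
Qed.

Lemma trig_bern n (F : nat -> R -> R -> R) p : trig p -> (forall k, trig (F k)) ->
  trig (fun x y => bern n (fun k => F k x y) (p x y)).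
Proof.
move=> tp; elim: n F => [|n ih] F tF /=; first exact: tF.
apply: trig_add.
  by apply: trig_mul => //; apply: (ih (fun k => F k.+1)) => k; exact: tF.
apply: trig_mul; last exact: ih.
apply: trig_ext (trig_add (trig_cst 1) (trig_mul (trig_cst (-1)) tp)) => x y.
by rewrite mulN1r.
Qed.

(* [unwind K] inverts [x |-> (1 + sin (x / 2K)) / 2] on [-K, K]; the argument of
   [asin] is [2 u - 1] truncated to [-1/2, 1/2]. *)
Definition unwind (K u : R) : R :=
  2 * K * asin ((`|2 * u - 2^-1| - `|2 * u - (1 + 2^-1)|) / 2).

Lemma continuous_unwind K : continuous (unwind K).
Proof.
move=> u; apply: cvgM; first exact: cvg_cst.
have c1 a : continuous (fun v : R => `|2 * v - a|).
  by move=> v; apply: cvg_norm; apply: cvgB;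
    [apply: cvgM; [exact: cvg_cst|exact: cvg_id]|exact: cvg_cst].
have h : continuous (fun v : R => (`|2 * v - 2^-1| - `|2 * v - (1 + 2^-1)|) / 2).
  by move=> v; apply: cvgM; [apply: cvgB; exact: c1|exact: cvg_cst].
apply: (cvg_comp _ _ (h u)); apply: continuous_asin.
set a := `|_|; set b := `|_|; have : `|a - b| <= 1.
  rewrite (le_trans (ler_dist_dist _ _))//.
  have -> : 2 * u - 2^-1 - (2 * u - (1 + 2^-1)) = 1 by ring.
  by rewrite normr1.
by rewrite ler_norml => /andP[h1 h2]; apply/andP; split; lra.
Qed.

Lemma norm_sin_le (x : R) : `|sin x| <= `|x|.
Proof.
have := cos_lipschitz (x - pi / 2) (- (pi / 2)).
by rewrite cosN cos_pihalf subr0 cosBpihalf opprK subrK.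
Qed.

Lemma unwindK (K x : R) : 0 < K -> `|x| <= K ->
  unwind K ((1 + sin (x / (2 * K))) / 2) = x.
Proof.
move=> K0 xK; set y := x / (2 * K).
have K20 : 0 < 2 * K by rewrite mulr_gt0.
(* The factor 2 in [2 * K] is chosen for this: |sin y| <= 1/2, so the truncation in [unwind] is
   inactive, and y lies in the range of [asin]. *)
have yh : `|y| <= 2^-1.
  by rewrite normrM normfV (gtr0_norm K20) ler_pdivrMr// mulrA mulVf// mul1r.
have := le_trans (norm_sin_le y) yh; rewrite ler_norml => /andP[s1 s2].
rewrite /unwind.
have -> : 2 * ((1 + sin y) / 2) - 2^-1 = sin y + 2^-1 by field.
have -> : 2 * ((1 + sin y) / 2) - (1 + 2^-1) = sin y - 2^-1 by field.
rewrite ger0_norm; last by lra.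
rewrite ler0_norm; last by lra.
have -> : (sin y + 2^-1 - - (sin y - 2^-1)) / 2 = sin y by field.
rewrite sinK; last first.
  rewrite in_itv/=; move: yh; rewrite ler_norml => /andP[y1 y2].
  by have := @pi_ge2 R => ?; apply/andP; split; lra.
by rewrite /y; field; rewrite gt_eqF.
Qed.

(** The substituted values lie in [0, 1] for all x and y, so the Bernstein estimate holds
    everywhere; this gives the global bound M + e, needed where the approximation of [g] itself
    fails. *)
Lemma trig_approx (g : R * R -> R) (M K e : R) : continuous g ->
  (forall z, `|g z| <= M) -> 0 < K -> 0 < e ->
  exists h : R -> R -> R, [/\ trig h, forall x y, `|h x y| <= M + e &
    forall x y, `|x| <= K -> `|y| <= K -> `|h x y - g (x, y)| <= e].
Proof.
move=> cg gM K0 e0.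
pose G (z : R * R) := g (unwind K z.1, unwind K z.2).
have cG : continuous G.
  move=> z; apply: (@continuous_comp _ _ _ (fun z => (unwind K z.1, unwind K z.2)) g);
    last exact: cg.
  have h1 : unwind K z'.1 @[z' --> z] --> unwind K z.1.
    by apply: (@continuous_comp _ _ _ fst (unwind K)); [exact: cvg_fst|exact: continuous_unwind].
  have h2 : unwind K z'.2 @[z' --> z] --> unwind K z.2.
    by apply: (@continuous_comp _ _ _ snd (unwind K)); [exact: cvg_snd|exact: continuous_unwind].
  exact: cvg_pair h1 h2.
have [n hn] := bern2_cvg cG (fun z => gM _) e0.
pose wind (x : R) : R := (1 + sin (x / (2 * K))) / 2.
have windI x : 0 <= wind x <= 1.
  by have := sin_geN1 (x / (2 * K)); have := sin_le1 (x / (2 * K)); rewrite /wind => *;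
    apply/andP; split; lra.
have tw1 : trig (fun x _ => wind x).
  apply: trig_ext (trig_add (trig_cst 2^-1) (trig_cos 2^-1 (2 * K)^-1 0 (- (pi / 2)))) => x y.
  rewrite mul0r addr0 cosBpihalf /wind [(2 * K)^-1 * x]mulrC; field.
  by rewrite ?gt_eqF.
have tw2 : trig (fun _ y => wind y).
  apply: trig_ext (trig_add (trig_cst 2^-1) (trig_cos 2^-1 0 (2 * K)^-1 (- (pi / 2)))) => x y.
  rewrite mul0r add0r cosBpihalf /wind [(2 * K)^-1 * y]mulrC; field.
  by rewrite ?gt_eqF.
exists (fun x y => bern2 n G (wind x) (wind y)); split=> [|x y|x y xK yK].
- rewrite /bern2.
  apply: (@trig_bern n (fun i x y => bern n (fun j => G (i%:R / n%:R, j%:R / n%:R)) (wind y))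
    (fun x _ => wind x) tw1) => i.
  apply: (@trig_bern n (fun j _ _ => G (i%:R / n%:R, j%:R / n%:R)) (fun _ y => wind y) tw2) => j.
  exact: trig_cst.
- rewrite -[bern2 _ _ _ _](subrK (G (wind x, wind y))) addrC (le_trans (ler_normD _ _))// lerD//.
    exact: gM.
  exact: hn.
- have := hn (wind x) (wind y) (windI x) (windI y).
  by rewrite /G /= !unwindK.
Qed.

End trigonometric_polynomials.

(** * From cosine transforms to convergence in distribution *)

Section continuity_theorem.
Context (R : realType).

Lemma measurable_sqrt1 d (T : measurableType d) (X : T -> R) :
  measurable_fun [set: T] X -> measurable_fun [set: T] (fun w => Num.sqrt (1 + X w ^+ 2)).
Proof.
move=> mX; apply: (measurableT_comp (continuous_measurable_fun (@sqrt_continuous R))).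
by apply: measurable_funD => //; exact: measurable_funX.
Qed.

Lemma trig_bmeas d (T : measurableType d) (X Y : T -> R) (f : R -> R -> R) :
  measurable_fun [set: T] X -> measurable_fun [set: T] Y -> trig f ->
  bmeas (fun w => f (X w) (Y w)).
Proof.
move=> mX mY; elim=> [c a b t|g h _ bg _ bh]; last exact: bmeasD.
apply: bmeasM; first exact: bmeas_cst.
apply: bmeas_cos; apply: measurable_funD => //.
by apply: measurable_funD; exact: measurable_funM.
Qed.

(** Measurability follows from a pointwise limit of trigonometric polynomials, on squares of side
    growing with n and with error 1 / (n + 1). No comparison of the Borel sets of the product
    topology with the product sigma-algebra is involved. *)
Lemma continuous_bmeas d (T : measurableType d) (X Y : T -> R) (g : R * R -> R) (M : R) :
  measurable_fun [set: T] X -> measurable_fun [set: T] Y -> continuous g ->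
  (forall z, `|g z| <= M) -> bmeas (fun w => g (X w, Y w)).
Proof.
move=> mX mY cg gM; split; last by exists M.
have approx n : exists h : R -> R -> R, [/\ trig h, forall x y, `|h x y| <= M + n.+1%:R^-1 &
    forall x y, `|x| <= n.+1%:R -> `|y| <= n.+1%:R -> `|h x y - g (x, y)| <= n.+1%:R^-1].
  by apply: trig_approx => //; rewrite ?ltr0n ?invr_gt0 ?ltr0n.
pose h n := projT1 (cid (approx n)).
have hP n := projT2 (cid (approx n)).
apply: (@measurable_fun_cvg _ _ _ _ (fun n w => h n (X w) (Y w))).
  by move=> n; have [th _ _] := hP n; have [] := trig_bmeas mX mY th.
move=> w _; apply/cvgrPdist_le => e e0; near=> n.
have [_ _ hn] := hP n.
rewrite distrC; apply: le_trans (hn _ _ _ _) _; near: n.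
- have [N _ HN] := nbhs_infty_ger (`|X w|); exists N => // n /= /HN /= h1.
  by rewrite (le_trans h1)// ler_nat.
- have [N _ HN] := nbhs_infty_ger (`|Y w|); exists N => // n /= /HN /= h1.
  by rewrite (le_trans h1)// ler_nat.
- have [N _ HN] := nbhs_infty_ger (e^-1); exists N => // n /= /HN /= h1.
  rewrite -[leRHS]invrK lef_pV2 ?posrE ?invr_gt0 ?ltr0n// (le_trans h1)// ler_nat.
  exact: leqW.
Unshelve. all: by end_near. Qed.

(** Markov's inequality in pointwise form: outside the square |h - g| <= 2 M + e, and there one of
    the two square roots exceeds K, so 2 M is below 2 M / K times their sum. *)
Lemma expect_approx_bound d (T : measurableType d) (P : probability T R) (X Y : T -> R)
    (g : R * R -> R) (h : R -> R -> R) (M K e B : R) :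
  measurable_fun [set: T] X -> measurable_fun [set: T] Y -> continuous g ->
  (forall z, `|g z| <= M) -> trig h -> 0 < K -> 0 <= e -> 0 <= M ->
  (forall x y, `|h x y| <= M + e) ->
  (forall x y, `|x| <= K -> `|y| <= K -> `|h x y - g (x, y)| <= e) ->
  integr P (fun w => Num.sqrt (1 + X w ^+ 2)) ->
  integr P (fun w => Num.sqrt (1 + Y w ^+ 2)) ->
  \int[P]_w Num.sqrt (1 + X w ^+ 2) <= B -> \int[P]_w Num.sqrt (1 + Y w ^+ 2) <= B ->
  `|\int[P]_w h (X w) (Y w) - \int[P]_w g (X w, Y w)| <= e + 2 * M / K * (B + B).
Proof.
move=> mX mY cg gM th K0 e0 M0 hM hg iX iY BX BY.
have ih := integr_bmeas P (trig_bmeas mX mY th).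
have ig := integr_bmeas P (continuous_bmeas mX mY cg gM).
rewrite -expectB//.
have q0 : 0 <= 2 * M / K by rewrite divr_ge0 ?mulr_ge0// ltW.
apply: (@le_trans _ _ (\int[P]_w (e + 2 * M / K *
    (Num.sqrt (1 + X w ^+ 2) + Num.sqrt (1 + Y w ^+ 2))))); last first.
  rewrite (expectD (integr_cst P e) (integrZ _ (integrD iX iY))) expect_cst.
  rewrite (expectZ _ (integrD iX iY)) (expectD iX iY) lerD2l ler_wpM2l// lerD//.
apply: le_norm_expect; first exact: integrB.
  by apply: integrD; [exact: integr_cst|apply: integrZ; exact: integrD].
move=> w; set x := X w; set y := Y w.
have sx (u : R) : `|u| <= Num.sqrt (1 + u ^+ 2).
  by rewrite -sqrtr_sqr ler_sqrt ?lerDr// addr_ge0 ?sqr_ge0.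
have x0 := sqrtr_ge0 (1 + x ^+ 2); have y0 := sqrtr_ge0 (1 + y ^+ 2).
have [xK|xK] := leP `|x| K; last first.
  have h1 : 2 * M <= 2 * M / K * Num.sqrt (1 + x ^+ 2).
    rewrite mulrAC ler_pdivlMr// ler_wpM2l ?mulr_ge0//.
    by rewrite (le_trans (ltW xK)).
  have h2 : 0 <= 2 * M / K * Num.sqrt (1 + y ^+ 2) by rewrite mulr_ge0.
  rewrite (le_trans (ler_normB _ _))//.
  by have := hM x y; have := gM (x, y); lra.
have [yK|yK] := leP `|y| K; last first.
  have h1 : 2 * M <= 2 * M / K * Num.sqrt (1 + y ^+ 2).
    rewrite mulrAC ler_pdivlMr// ler_wpM2l ?mulr_ge0//.
    by rewrite (le_trans (ltW yK)).
  have h2 : 0 <= 2 * M / K * Num.sqrt (1 + x ^+ 2) by rewrite mulr_ge0.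
  rewrite (le_trans (ler_normB _ _))//.
  by have := hM x y; have := gM (x, y); lra.
by rewrite (le_trans (hg _ _ _ _))// lerDl mulr_ge0// addr_ge0.
Qed.

Theorem cvg_expect_of_trig d (T : measurableType d) (P : probability T R)
    (X Y : nat -> T -> R) d' (T' : measurableType d') (Q : probability T' R)
    (X' Y' : T' -> R) (B : R) :
  (forall n, measurable_fun [set: T] (X n)) -> (forall n, measurable_fun [set: T] (Y n)) ->
  measurable_fun [set: T'] X' -> measurable_fun [set: T'] Y' ->
  (forall n, integr P (fun w => Num.sqrt (1 + X n w ^+ 2))) ->
  (forall n, integr P (fun w => Num.sqrt (1 + Y n w ^+ 2))) ->
  (forall n, \int[P]_w Num.sqrt (1 + X n w ^+ 2) <= B) ->
  (forall n, \int[P]_w Num.sqrt (1 + Y n w ^+ 2) <= B) ->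
  integr Q (fun w => Num.sqrt (1 + X' w ^+ 2)) ->
  integr Q (fun w => Num.sqrt (1 + Y' w ^+ 2)) ->
  (forall a b theta, \int[P]_w cos (a * X n w + b * Y n w + theta) @[n --> \oo] -->
    \int[Q]_w cos (a * X' w + b * Y' w + theta)) ->
  forall (g : R * R -> R) (M : R), continuous g -> (forall z, `|g z| <= M) ->
    \int[P]_w g (X n w, Y n w) @[n --> \oo] --> \int[Q]_w g (X' w, Y' w).
Proof.
move=> mX mY mX' mY' iX iY BX BY iX' iY' cf g M cg gM.
have ct h : trig h -> \int[P]_w h (X n w) (Y n w) @[n --> \oo] -->
    \int[Q]_w h (X' w) (Y' w).
  elim=> [c a b t|h1 h2 t1 c1 t2 c2].
    have bc n := trig_bmeas (mX n) (mY n) (trig_cos 1 a b t).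
    have bc' := trig_bmeas mX' mY' (trig_cos 1 a b t).
    have E d0 (T0 : measurableType d0) (P0 : probability T0 R) (Z1 Z2 : T0 -> R) :
        measurable_fun [set: T0] Z1 -> measurable_fun [set: T0] Z2 ->
        \int[P0]_w (c * cos (a * Z1 w + b * Z2 w + t)) =
        c * \int[P0]_w cos (a * Z1 w + b * Z2 w + t).
      move=> m1 m2; rewrite expectZ//; apply: integr_bmeas; apply: bmeas_cos.
      by apply: measurable_funD => //; apply: measurable_funD; exact: measurable_funM.
    rewrite E//.
    have -> : (fun n => \int[P]_w (c * cos (a * X n w + b * Y n w + t))) =
        fun n => c * \int[P]_w cos (a * X n w + b * Y n w + t).
      by apply/funext => n; rewrite E.
    by apply: cvgM; [exact: cvg_cst|exact: cf].
  have i d0 (T0 : measurableType d0) (P0 : probability T0 R) (Z1 Z2 : T0 -> R) h0 :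
      measurable_fun [set: T0] Z1 -> measurable_fun [set: T0] Z2 -> trig h0 ->
      integr P0 (fun w => h0 (Z1 w) (Z2 w)).
    by move=> m1 m2 t0; apply: integr_bmeas; exact: trig_bmeas.
  rewrite (expectD (i _ _ Q _ _ _ mX' mY' t1) (i _ _ Q _ _ _ mX' mY' t2)).
  have -> : (fun n => \int[P]_w (h1 (X n w) (Y n w) + h2 (X n w) (Y n w))) =
      fun n => \int[P]_w h1 (X n w) (Y n w) + \int[P]_w h2 (X n w) (Y n w).
    by apply/funext => n; rewrite expectD//; exact: i.
  exact: cvgD.
have M0 : 0 <= M by exact: le_trans (gM (0, 0)).
(* A common bound for the sequence and for the limit. *)
pose B' := Num.max B (Num.max (\int[Q]_w Num.sqrt (1 + X' w ^+ 2))
  (\int[Q]_w Num.sqrt (1 + Y' w ^+ 2))).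
have B0 : 0 <= B by apply: le_trans (BX 0%N); apply: expect_ge0 => w; exact: sqrtr_ge0.
have B'0 : 0 <= B' by rewrite le_max B0.
apply/cvgrPdist_le => e e0.
have e8 : 0 < e / 8 by rewrite divr_gt0.
(* Large enough for 4 M B' / K <= e / 8. Each approximation then costs e / 4, leaving e / 2 for the
   convergence of the trigonometric integrals. *)
pose K := 1 + 16 * (M * B') / (e / 8).
have K0 : 0 < K by rewrite ltr_pwDl// divr_ge0 ?mulr_ge0// ltW.
have [h [th hM hg]] := trig_approx cg gM K0 e8.
have small : e / 8 + 2 * M / K * (B' + B') <= e / 4.
  have : 2 * M / K * (B' + B') <= e / 8.
    have -> : 2 * M / K * (B' + B') = 4 * (M * B') / K by field; rewrite gt_eqF.
    have -> : e / 8 = e / 8 * K / K by rewrite mulfK// gt_eqF.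
    have hK : e / 8 * K = e / 8 + 16 * (M * B') by rewrite /K; field; rewrite gt_eqF.
    rewrite ler_wpM2r ?invr_ge0 ?(ltW K0)// hK.
    have : 0 <= M * B' by exact: mulr_ge0.
    by lra.
  by lra.
have AQ : `|\int[Q]_w h (X' w) (Y' w) - \int[Q]_w g (X' w, Y' w)| <= e / 4.
  apply: le_trans small; apply: expect_approx_bound => //; first exact: ltW.
    by rewrite /B' !le_max lexx orbT.
  by rewrite /B' !le_max lexx !orbT.
have AP n : `|\int[P]_w h (X n w) (Y n w) - \int[P]_w g (X n w, Y n w)| <= e / 4.
  apply: le_trans small; apply: expect_approx_bound => //; first exact: ltW.
    by rewrite /B' le_max BX.
  by rewrite /B' le_max BY.
have e2 : 0 < e / 2 by rewrite divr_gt0.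
have /cvgrPdist_le/(_ _ e2) := ct h th; apply: filterS => n hn.
have := AP n; move: AQ hn; rewrite !ler_norml.
set a := \int[Q]_w h _ _; set b := \int[Q]_w g _; set c := \int[P]_w h _ _.
set f := \int[P]_w g _.
by move=> /andP[? ?] /andP[? ?] /andP[? ?]; apply/andP; split; lra.
Qed.

End continuity_theorem.

(** * The cosine transform of the normal law *)

Section gaussian.
Context (R : realType) (s : R).
Hypothesis s0 : s != 0.
Local Notation leb := (@lebesgue_measure R).
Local Notation p := (normal_pdf 0 s).
Local Notation N := (normal_prob 0 s : probability (measurableTypeR R) R).
Definition lintegr (f : R -> R) : Prop := leb.-integrable [set: R] (EFin \o f).

Lemma normal_pdf_formula (u x : R) : u != 0 ->
  normal_pdf 0 u x = normal_peak u * expR (- (x ^+ 2 / (2 * u ^+ 2))).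
Proof.
move=> u0; rewrite normal_pdfE//= /normal_fun subr0 mulNr; congr (_ * expR (- (_ / _))).
by rewrite mulr_natl.
Qed.

Lemma le_lintegr (f g : R -> R) : measurable_fun [set: R] f ->
  (forall x, `|f x| <= g x) -> lintegr g -> lintegr f.
Proof.
move=> mf fg; apply: le_integrable => //; first exact/measurable_EFinP.
by move=> x _; rewrite /= lee_fin (le_trans (fg x))// ler_norm.
Qed.

Lemma lintegrZ c f : lintegr f -> lintegr (fun x => c * f x).
Proof.
by move=> /(integrableZl measurableT c); apply: eq_integrable.
Qed.

Lemma measurable_pdf : measurable_fun [set: R] (p : R -> R).
Proof. exact: measurable_normal_pdf. Qed.

Lemma lintegr_pdf : lintegr p.
Proof. exact: integrable_normal_pdf. Qed.

(** Half of the exponent absorbs the quadratic factor: with y = x^2 / (4 s^2) the density carries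
    exp(-2 y), and y exp(-y) <= 1. What remains is the density of standard deviation sqrt 2 s, up to
    a constant. *)
Lemma lintegr_quad_pdf : lintegr (fun x => (1 + x ^+ 2) * p x).
Proof.
pose u := Num.sqrt 2 * s.
have s2 : 0 < s ^+ 2 by rewrite exprn_even_gt0.
have u2 : u ^+ 2 = 2 * s ^+ 2 by rewrite exprMn sqr_sqrtr.
have u0 : u != 0 by rewrite mulf_neq0// gt_eqF// sqrtr_gt0.
have ps := normal_peak_gt0 s0; have pu := normal_peak_gt0 u0.
pose C := (1 + 4 * s ^+ 2) * normal_peak s / normal_peak u.
have iu : lintegr (fun x => C * normal_pdf 0 u x).
  by apply: lintegrZ; exact: integrable_normal_pdf.
apply: le_lintegr iu => [|x].
  by apply: measurable_funM;
    [apply: measurable_funD => //; exact: measurable_funX|exact: measurable_pdf].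
rewrite ger0_norm; last by rewrite mulr_ge0 ?addr_ge0 ?sqr_ge0 ?normal_pdf_ge0.
rewrite !normal_pdf_formula// u2.
set y := x ^+ 2 / (4 * s ^+ 2).
have -> : x ^+ 2 / (2 * s ^+ 2) = y + y by rewrite /y; field.
have -> : x ^+ 2 / (2 * (2 * s ^+ 2)) = y by rewrite /y; field.
have x2 : x ^+ 2 = 4 * s ^+ 2 * y by rewrite /y; field.
have y0 : 0 <= y by rewrite /y divr_ge0 ?sqr_ge0// mulr_ge0// ltW.
rewrite opprD expRD.
have -> : C * (normal_peak u * expR (- y)) = (1 + 4 * s ^+ 2) * normal_peak s * expR (- y).
  by rewrite /C; field; rewrite gt_eqF.
have -> : (1 + x ^+ 2) * (normal_peak s * (expR (- y) * expR (- y))) =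
  (1 + x ^+ 2) * expR (- y) * (normal_peak s * expR (- y)) by ring.
rewrite -[leRHS]mulrA ler_wpM2r// ?mulr_ge0 ?expR_ge0 ?(ltW ps)//.
have h1 := expR_ge1Dx y; have h2 := expRxMexpNx_1 y; have h3 := expR_gt0 (- y).
have h4 : expR (- y) <= 1 by rewrite expR_le1 oppr_le0.
have h5 : y * expR (- y) <= 1.
  by rewrite -[leRHS]h2 ler_wpM2r ?(ltW h3)//; lra.
have : 4 * s ^+ 2 * (y * expR (- y)) <= 4 * s ^+ 2.
  by rewrite ler_piMr// mulr_ge0// ltW.
by rewrite x2 => ?; lra.
Qed.

Lemma lintegr_linear_pdf (f : R -> R) : measurable_fun [set: R] f ->
  (forall x, `|f x| <= 1 + `|x|) -> lintegr (fun x => f x * p x).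
Proof.
move=> mf fx; apply: le_lintegr (lintegrZ 2 lintegr_quad_pdf) => [|x].
  by apply: measurable_funM => //; exact: measurable_pdf.
have p0 := normal_pdf_ge0 0 s x.
rewrite normrM (ger0_norm p0) mulrA ler_wpM2r//.
apply: le_trans (fx x) _.
have := sqr_ge0 (`|x| - 1); rewrite sqrrB expr1n real_normK ?num_real//.
have := normr_ge0 x; have := sqr_ge0 x; rewrite -mulr_natl; lra.
Qed.

Lemma is_derive_pdf (x : R) : is_derive x 1 (p : R -> R) (- (x / s ^+ 2) * p x).
Proof.
have -> : (p : R -> R) = fun x => normal_peak s * expR (- (x ^+ 2 / (2 * s ^+ 2))).
  by apply/funext => y; exact: normal_pdf_formula.
have h : is_derive x 1 (fun y : R => - (y ^+ 2 / (2 * s ^+ 2))) (- (x / s ^+ 2)).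
  apply: is_derive_eq; rewrite /= /GRing.scale/=; field.
  by rewrite ?s0.
have := @is_derive1_comp R expR _ x _ _ (is_derive_expR _) h.
move=> /(is_deriveZ (normal_peak s)); rewrite /GRing.scale/=.
set a := (X in is_derive _ _ _ X); set b := (X in _ -> is_derive _ _ _ X).
have -> : b = a by rewrite /a /b; ring.
exact.
Qed.

Lemma leb_dominated (f_ : nat -> R -> R) (f g : R -> R) :
  (forall n, measurable_fun [set: R] (f_ n)) -> measurable_fun [set: R] f ->
  lintegr g -> (forall n x, `|f_ n x| <= g x) ->
  (forall x, f_ ^~ x @ \oo --> f x) ->
  \int[leb]_x f_ n x @[n --> \oo] --> \int[leb]_x f x.
Proof.
move=> mf_ mf intg fg f_f.
have := @dominated_convergence _ _ _ leb _ measurableT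
  (fun n => EFin \o f_ n) (EFin \o f) (EFin \o g).
case=> //.
- by move=> n; apply/measurable_EFinP; exact: (mf_ n).
- by apply/measurable_EFinP; exact: mf.
- by apply: aeW => x _; apply: cvg_EFin; [exact: nearW|exact: f_f].
- by apply: aeW => x n _; rewrite /= lee_fin.
move=> /integrable_fin_num intf _.
by rewrite -(fineK (intf measurableT)) => /fine_cvgP[].
Qed.

Lemma pdf_cvg0 : p n%:R @[n --> \oo] --> 0 /\ p (- n%:R) @[n --> \oo] --> 0.
Proof.
have s2 : 0 < s ^+ 2 by rewrite exprn_even_gt0.
have sym (x : R) : p (- x) = p x by rewrite !normal_pdf_formula// sqrrN.
have c : p n%:R @[n --> \oo] --> 0.
  have inv0 : (n%:R^-1 : R) @[n --> \oo] --> 0.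
    apply/gtr0_cvgV0; first by near=> n; rewrite ltr0n; near: n; exact: nbhs_infty_gt.
    exact: cvgr_idn.
  apply: (@squeeze_cvgr _ _ _ _ (fun=> 0)
    (fun n => normal_peak s * (2 * s ^+ 2) * n%:R^-1)); last 2 first.
  - exact: cvg_cst.
  - rewrite -(mulr0 (normal_peak s * (2 * s ^+ 2))).
    by apply: cvgM => //; exact: cvg_cst.
  near=> n; rewrite normal_pdf_ge0/= normal_pdf_formula// -mulrA ler_wpM2l ?normal_peak_ge0//.
  have n1 : 1 <= n%:R :> R by rewrite ler1n; near: n; exact: nbhs_infty_gt.
  set y := n%:R ^+ 2 / _.
  have y0 : 0 < y.
    by apply: divr_gt0; [apply: exprn_gt0; lra|exact: mulr_gt0].
  have h1 := expR_ge1Dx y; have h2 := expRxMexpNx_1 y; have h3 := expR_gt0 (- y).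
  have h5 : y * expR (- y) <= 1.
    by rewrite -[leRHS]h2 ler_wpM2r ?(ltW h3)//; lra.
  have h6 : expR (- y) <= y^-1 by rewrite -[leRHS]mul1r ler_pdivlMr// mulrC.
  apply: le_trans h6 _; have q0 : 0 <= 2 * s ^+ 2 by lra.
  rewrite /y invf_div ler_wpM2l//.
  rewrite lef_pV2 ?posrE ?exprn_gt0//; [|lra|lra].
  by rewrite expr2 ler_peMl//; lra.
by split=> //; under eq_cvg do rewrite sym.
Unshelve. all: by end_near. Qed.

(** The integrand is the derivative of sin(t x + theta) p(x), which vanishes at both ends of the
    line. *)
Lemma stein (t theta : R) :
  \int[leb]_x (t * (cos (t * x + theta) * p x) - (x / s ^+ 2) * (sin (t * x + theta) * p x)) = 0.
Proof.
set k := fun x => _.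
pose H (x : R) := sin (t * x + theta) * p x.
have ml : measurable_fun [set: R] (fun x : R => t * x + theta).
  by apply: measurable_funD => //; exact: measurable_funM.
have mk : measurable_fun [set: R] k.
  apply: measurable_funB; apply: measurable_funM => //.
  - by apply: measurable_funM; [have [] := bmeas_cos ml|exact: measurable_pdf].
  - exact: measurable_funM.
  - by apply: measurable_funM; [have [] := bmeas_sin ml|exact: measurable_pdf].
have dlin (x : R) : is_derive x 1 (fun y : R => t * y + theta) t.
  by apply: is_derive_eq; rewrite /GRing.scale/= mulr1 addr0.
have dH (x : R) : is_derive x 1 H (k x).
  have d1 := @is_derive1_comp R (@sin R) _ x _ _ (is_derive_sin _) (dlin x).
  have := is_deriveM d1 (is_derive_pdf x); rewrite /GRing.scale/=.
  set a := (X in is_derive _ _ _ X); have -> : k x = a by rewrite /k /a; ring.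
  exact.
have ck : continuous k.
  have cl x : {for x, continuous (fun x : R => t * x + theta)}.
    exact: is_derive_continuous (dlin x).
  have cp x : {for x, continuous (p : R -> R)} by exact: is_derive_continuous (is_derive_pdf x).
  move=> x; apply: cvgB; apply: cvgM.
  - exact: cvg_cst.
  - apply: cvgM; last exact: cp.
    by apply: (cvg_comp _ _ (cl x)); exact: continuous_cos.
  - by apply: cvgM; [exact: cvg_id|exact: cvg_cst].
  - apply: cvgM; last exact: cp.
    by apply: (cvg_comp _ _ (cl x)); exact: continuous_sin.
(* The successor keeps the interval nondegenerate. *)
have FTC n : \int[leb]_(x in `[- n.+1%:R, n.+1%:R]) k x = H n.+1%:R - H (- n.+1%:R).
  have n0 : 0 < n.+1%:R :> R by rewrite ltr0n.
  rewrite /Rintegral (@continuous_FTC2 _ k H)//; first by lra.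
  - exact: continuous_subspaceT.
  - split.
    + by move=> x _; have [] := dH x.
    + by apply: cvg_at_right_filter; exact: is_derive_continuous (dH _).
    + by apply: cvg_at_left_filter; exact: is_derive_continuous (dH _).
  - by move=> x _; rewrite derive1E; have [_] := dH x.
have mI n : measurable (`[- n.+1%:R, n.+1%:R]%classic : set R) by exact: measurable_itv.
have L : \int[leb]_x (\1_`[- n.+1%:R, n.+1%:R] x * k x) @[n --> \oo] --> \int[leb]_x k x.
  pose C := `|t| + `|s ^- 2|.
  have ic : lintegr (fun x => C * (2 * ((1 + x ^+ 2) * p x))).
    by apply: lintegrZ; apply: lintegrZ; exact: lintegr_quad_pdf.
  apply: (leb_dominated _ mk ic).
  - by move=> n; apply: measurable_funM => //; exact: measurable_indic.
  - move=> n x; have p0 := normal_pdf_ge0 0 s x.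
    have c1 : `|cos (t * x + theta)| <= 1 by rewrite ler_norml cos_geN1 cos_le1.
    have c2 : `|sin (t * x + theta)| <= 1 by rewrite ler_norml sin_geN1 sin_le1.
    apply: (@le_trans _ _ `|k x|).
      rewrite normrM ler_piMl// indicE; case: (_ \in _); rewrite ?normr1 ?normr0//.
    have -> : C * (2 * ((1 + x ^+ 2) * p x)) = `|t| * (2 * (1 + x ^+ 2) * p x) +
       `|s ^- 2| * (2 * (1 + x ^+ 2) * p x) by rewrite /C; ring.
    have x2 : 1 + `|x| <= 2 * (1 + x ^+ 2).
      have := sqr_ge0 (`|x| - 1); rewrite sqrrB expr1n real_normK ?num_real//.
      have := normr_ge0 x; have := sqr_ge0 x; rewrite -mulr_natl; lra.
    have ax := normr_ge0 x.
    rewrite /k (le_trans (ler_normB _ _))// lerD// !normrM (ger0_norm p0).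
      rewrite ler_wpM2l// ler_wpM2r// (le_trans c1)//; lra.
    have -> : `|x| * `|s ^- 2| * (`|sin (t * x + theta)| * p x) =
      `|s ^- 2| * (`|sin (t * x + theta)| * `|x| * p x) by ring.
    rewrite ler_wpM2l// ler_wpM2r//.
    have : `|sin (t * x + theta)| * `|x| <= `|x| by rewrite ler_piMl.
    by lra.
  - move=> x; apply: cvg_near_cst; near=> n.
    rewrite indicE mem_set ?mul1r//= in_itv/= -ler_norml.
    near: n; have [m _ hm] := nbhs_infty_ger `|x|; exists m => // n /= /hm /= h.
    by rewrite (le_trans h)// ler_nat.
have [p1 p2] := pdf_cvg0.
have Hn (u : nat -> R) : p (u n) @[n --> \oo] --> 0 -> H (u n) @[n --> \oo] --> 0.
  move=> pu; apply: norm_cvg0.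
  apply: (@squeeze_cvgr _ _ _ _ (fun=> 0) (fun n => p (u n))) => //; last exact: cvg_cst.
  apply: nearW => n; rewrite normr_ge0/= /H normrM (ger0_norm (normal_pdf_ge0 _ _ _)).
  by rewrite ler_piMl ?normal_pdf_ge0// ler_norml sin_geN1 sin_le1.
have L0 : \int[leb]_x (\1_`[- n.+1%:R, n.+1%:R] x * k x) @[n --> \oo] --> 0.
  have -> : (fun n => \int[leb]_x (\1_`[- n.+1%:R, n.+1%:R] x * k x)) =
      fun n => H n.+1%:R - H (- n.+1%:R).
    apply/funext => n; rewrite -FTC [RHS]Rintegral_mkcond; apply: eq_Rintegral => x _.
    by rewrite patchE indicE; case: (x \in _); rewrite ?mul1r ?mul0r.
  rewrite -(subr0 0); apply: cvgB.
    by have := Hn _ p1; rewrite -(cvg_shiftS (fun n => H n%:R)).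
  by have := Hn _ p2; rewrite -(cvg_shiftS (fun n => H (- n%:R))).
exact: (cvg_unique (@Rhausdorff R) L L0).
Unshelve. all: by end_near. Qed.

Lemma measurable_lin (t theta : R) : measurable_fun [set: R] (fun x : R => t * x + theta).
Proof. by apply: measurable_funD => //; exact: measurable_funM. Qed.

Lemma lintegr_bmeas_pdf (f : R -> R) : bmeas f -> lintegr (fun x => f x * p x).
Proof.
move=> [mf [M fM]].
apply: le_lintegr (lintegrZ M lintegr_pdf) => [|x].
  by apply: measurable_funM => //; exact: measurable_pdf.
by rewrite normrM (ger0_norm (normal_pdf_ge0 _ _ _)) ler_wpM2r ?normal_pdf_ge0.
Qed.

Lemma lebD (f g : R -> R) : lintegr f -> lintegr g ->
  \int[leb]_x (f x + g x) = \int[leb]_x f x + \int[leb]_x g x.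
Proof. by move=> *; exact: RintegralD. Qed.

Lemma lebZ c (f : R -> R) : lintegr f -> \int[leb]_x (c * f x) = c * \int[leb]_x f x.
Proof. by move=> *; exact: RintegralZl. Qed.

Definition gauss_cos (theta t : R) : R := \int[leb]_x (cos (t * x + theta) * p x).

(** Differentiation under the integral is dominated by |x| p(x), and [stein] turns the resulting
    sine integral back into the cosine integral. *)
Lemma is_derive_gauss_cos (theta t : R) :
  is_derive t 1 (gauss_cos theta) (- (s ^+ 2 * t) * gauss_cos theta t).
Proof.
pose f (u x : R) := cos (u * x + theta) * p x.
have bc u : bmeas (fun x : R => cos (u * x + theta)).
  by apply: bmeas_cos; exact: measurable_lin.
have bs u : bmeas (fun x : R => sin (u * x + theta)).
  by apply: bmeas_sin; exact: measurable_lin.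
have df (u x : R) : is_derive u 1 (f ^~ x) (- (x * sin (u * x + theta) * p x)).
  have dlin : is_derive u 1 (fun v : R => v * x + theta) x.
    have h : is_derive u 1 (fun v : R => x * v + theta) x.
      by apply: is_derive_eq; rewrite /GRing.scale/= mulr1 addr0.
    by have -> : (fun v : R => v * x + theta) = (fun v => x * v + theta)
      by apply/funext => v; rewrite mulrC.
  have := @is_derive1_comp R (@cos R) _ u _ _ (is_derive_cos _) dlin.
  move=> /(is_deriveZ (p x)); rewrite /GRing.scale/=.
  have -> : p x \*: (cos \o (fun v : R => v * x + theta)) = f ^~ x.
    by apply/funext => v; exact: mulrC.
  set a := (X in is_derive _ _ _ X); set b := (X in _ -> is_derive _ _ _ X).
  have -> : b = a by rewrite /a /b; ring.
  exact.
have I1 : `]t - 1, t + 1[%classic t by rewrite /= in_itv/=; apply/andP; split; lra.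
pose G (x : R) := `|x| * p x.
have iG : lintegr G.
  have mn : measurable_fun [set: R] (fun x : R => `|x|) by exact: measurableT_comp.
  apply: (lintegr_linear_pdf mn).
  by move=> x; rewrite normr_id lerDr.
have G0 x : 0 <= G x by rewrite mulr_ge0 ?normal_pdf_ge0.
have intf u : `]t - 1, t + 1[%classic u -> leb.-integrable [set: R] (EFin \o f u).
  by move=> _; exact: (lintegr_bmeas_pdf (bc u)).
have derf u x : `]t - 1, t + 1[%classic u -> [set: R] x -> derivable (f ^~ x) u 1.
  by move=> _ _; have [] := df u x.
have d1E u x : partial1of2 f u x = - (x * sin (u * x + theta) * p x).
  by rewrite partial1of2E; have [_] := df u x.
have Gub u x : `]t - 1, t + 1[%classic u -> [set: R] x -> `|partial1of2 f u x| <= G x.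
  move=> _ _; rewrite d1E normrN /G normrM (ger0_norm (normal_pdf_ge0 _ _ _)).
  rewrite ler_wpM2r ?normal_pdf_ge0// normrM ler_piMr//.
  by rewrite ler_norml sin_geN1 sin_le1.
have dG := derivable_under_integral measurableT I1 intf derf G0 iG Gub.
have dE := differentiation_under_integral measurableT I1 intf derf G0 iG Gub.
have ixs : lintegr (fun x => x * sin (t * x + theta) * p x).
  apply: lintegr_linear_pdf; first by apply: measurable_funM => //; have [] := bs t.
  move=> x; rewrite normrM (le_trans (y := `|x|)) ?lerDr// ler_piMr//.
  by rewrite ler_norml sin_geN1 sin_le1.
have S : \int[leb]_x (x * sin (t * x + theta) * p x) = s ^+ 2 * t * gauss_cos theta t.
  have := stein t theta.
  have -> : (fun x => t * (cos (t * x + theta) * p x) - x / s ^+ 2 * (sin (t * x + theta) * p x)) =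
     fun x => t * f t x + (- s ^- 2) * (x * sin (t * x + theta) * p x).
    by apply/funext => x; rewrite /f; ring.
  have itf := lintegr_bmeas_pdf (bc t).
  rewrite (lebD (lintegrZ t itf) (lintegrZ _ ixs)) (lebZ _ itf) (lebZ _ ixs) -/(gauss_cos theta t).
  move/eqP; rewrite addr_eq0 => /eqP e; rewrite -mulrA e mulNr opprK mulrA mulfV ?mul1r//.
  by rewrite expf_neq0.
apply: DeriveDef; first exact: dG.
rewrite -derive1E [LHS]dE.
have -> : (fun x => partial1of2 f t x) = fun x => -1 * (x * sin (t * x + theta) * p x).
  by apply/funext => x; rewrite d1E mulN1r.
by rewrite (lebZ _ ixs) S; ring.
Qed.

Lemma gauss_cosE (theta t : R) :
  gauss_cos theta t = expR (- (t ^+ 2 * s ^+ 2 / 2)) * cos theta.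
Proof.
(* The integrating factor of the differential equation: [F] is constant. *)
pose F (u : R) := gauss_cos theta u * expR (u ^+ 2 * s ^+ 2 / 2).
have dF (u : R) : is_derive u 1 F 0.
  have h : is_derive u 1 (fun u : R => u ^+ 2 * s ^+ 2 / 2) (u * s ^+ 2).
    by apply: is_derive_eq; rewrite /= /GRing.scale/=; field.
  have d2 := @is_derive1_comp R expR _ u _ _ (is_derive_expR _) h.
  have := is_deriveM (is_derive_gauss_cos theta u) d2; rewrite /GRing.scale/=.
  set a := (X in is_derive _ _ _ X); have -> : a = 0 by rewrite /a; ring.
  exact.
have := @is_derive_0_is_cst _ F t 0 dF.
rewrite /F expr0n/= !mul0r expR0 mulr1 => e.
have -> : gauss_cos theta t = gauss_cos theta 0 * expR (- (t ^+ 2 * s ^+ 2 / 2)).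
  by rewrite -e -mulrA expRxMexpNx_1 mulr1.
rewrite mulrC; congr (_ * _); rewrite /gauss_cos.
have -> : (fun x : R => cos (0 * x + theta) * p x) = fun x => cos theta * p x.
  by apply/funext => x; rewrite mul0r add0r.
rewrite (lebZ _ lintegr_pdf).
have -> : \int[leb]_x p x = 1 by rewrite /Rintegral integral_normal_pdf.
by rewrite mulr1.
Qed.

Lemma normal_bmeas_expect (f : R -> R) : bmeas f ->
  \int[N]_x f x = \int[leb]_x (f x * p x).
Proof.
move=> [mf [M fM]].
pose Pr (f : R -> R) := \int[N]_x f x = \int[leb]_x (f x * p x).
have [f_ [bf_ Pf_ f_f cf_]] : exists f_ : nat -> R -> R,
    [/\ forall n, bmeas (f_ n), forall n, Pr (f_ n),
     forall n x, `|f_ n x| <= `|f x| & forall x, f_ ^~ x @ \oo --> f x].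
  apply: (measurable_approx (Pr := Pr)); last exact: mf.
    move=> A mA; rewrite /Pr (expect_indic N mA) /= /normal_prob /Rintegral.
    rewrite [in LHS]integral_mkcond; congr fine; apply: eq_integral => x _.
    by rewrite patchE indicE; case: (x \in A); rewrite ?mul1r ?mul0r.
  move=> c g h bg bh Pg Ph; rewrite /Pr.
  rewrite (expectD (integrZ c (integr_bmeas N bg)) (integr_bmeas N bh)).
  rewrite (expectZ _ (integr_bmeas N bg)) Pg Ph.
  have ig := lintegr_bmeas_pdf bg; have ih := lintegr_bmeas_pdf bh.
  rewrite -(lebZ _ ig) -(lebD (lintegrZ c ig) ih).
  by apply: eq_Rintegral => x _; ring.
have L1 : \int[N]_x f_ n x @[n --> \oo] --> \int[N]_x f x.
  apply: (@dominated_expect _ _ R N f_ f (fun _ => M)) => //.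
  - by move=> n; have [] := bf_ n.
  - exact: integr_cst.
  - by move=> n x; exact: le_trans (f_f n x) (fM x).
have L2 : \int[leb]_x (f_ n x * p x) @[n --> \oo] --> \int[leb]_x (f x * p x).
  apply: (@leb_dominated _ _ (fun x => M * p x)).
  - by move=> n; apply: measurable_funM; [have [] := bf_ n|exact: measurable_pdf].
  - by apply: measurable_funM => //; exact: measurable_pdf.
  - exact/lintegrZ/lintegr_pdf.
  - move=> n x; rewrite normrM (ger0_norm (normal_pdf_ge0 _ _ _)).
    by rewrite ler_wpM2r ?normal_pdf_ge0// (le_trans (f_f n x)).
  - by move=> x; apply: cvgM; [exact: cf_|exact: cvg_cst].
have E : (fun n => \int[N]_x f_ n x) = fun n => \int[leb]_x (f_ n x * p x).
  by apply/funext => n; exact: Pf_.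
by rewrite E in L1; exact: (cvg_unique (@Rhausdorff R) L1 L2).
Qed.

Lemma normal_cos (theta t : R) :
  \int[N]_x cos (t * x + theta) = expR (- (t ^+ 2 * s ^+ 2 / 2)) * cos theta.
Proof.
rewrite -gauss_cosE normal_bmeas_expect//.
by apply: bmeas_cos; exact: measurable_lin.
Qed.

(** The density formula [normal_bmeas_expect] covers bounded functions only, so |x| is truncated at
    n and monotone convergence removes the truncation. *)
Lemma integr_normal_norm : integr N (fun x => `|x|).
Proof.
have mn : measurable_fun [set: R] (fun x : R => `|x|) by exact: measurableT_comp.
pose g n (x : R) := Num.min `|x| n%:R.
have bg n : bmeas (g n).
  split; first exact: measurable_minr.
  exists n%:R => x; rewrite ger0_norm ?ge_min ?lexx ?orbT//.
  by rewrite le_min normr_ge0/=.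
have il : lintegr (fun x => `|x| * p x).
  by apply: lintegr_linear_pdf => // x; rewrite normr_id lerDr.
apply/integrableP; split; first exact/measurable_EFinP.
under eq_integral do rewrite /= normr_id.
have B n : (\int[N]_x (g n x)%:E <= (\int[leb]_x (`|x| * p x))%:E)%E.
  have i := integr_bmeas N (bg n).
  rewrite -(fineK (integrable_fin_num measurableT i)) lee_fin.
  rewrite -[X in X <= _]/(\int[N]_x g n x) normal_bmeas_expect//.
  apply: le_Rintegral => //; first exact: (lintegr_bmeas_pdf (bg n)).
  by move=> x _; rewrite ler_wpM2r ?normal_pdf_ge0// ge_min lexx.
apply: (@le_lt_trans _ _ (\int[leb]_x (`|x| * p x))%:E); last exact: ltry.
have cv := @cvg_monotone_convergence _ _ R N [set: R] measurableT
  (fun n x => (g n x)%:E).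
have -> : (\int[N]_x (`|x|)%:E = \int[N]_x limn (fun n => (g n x)%:E))%E.
  apply: eq_integral => x _; apply/esym/cvg_lim => //.
  apply: cvg_EFin; first exact: nearW.
  apply: cvg_near_cst; near=> n; rewrite /= /g; apply/min_idPl.
  by near: n; exact: nbhs_infty_ger.
apply: (cvge_le _ (cv _ _ _)); first exact: nearW.
- by move=> n; apply/measurable_EFinP; have [] := bg n.
- by move=> n x _; rewrite lee_fin le_min normr_ge0/=.
move=> x _ m n lemn; rewrite lee_fin le_min ge_min lexx/= ge_min.
by rewrite ler_nat lemn orbT.
Unshelve. all: by end_near. Qed.

End gaussian.

(** * Martingale approximation *)

Section separable_kernels.
Context (R : realType) (mu1 mu2 : R) d (T : measurableType d)
  (P : probability T R) (U : nat -> {RV P >-> R}).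
Hypothesis hU : stationary_copula_chain (sine_copula mu1 mu2) U.
Local Notation lam := (unif R).
Local Notation tr := (transition mu1 mu2).

(** Kernels that are finite sums of a(x) b(y). Being bounded and past-measurable at [U k], the
    factor [a] can be absorbed into the weight [W], so [markov_transition] applies to each term. *)
Fixpoint separable_factors (l : seq ((R -> R) * (R -> R))) : Prop :=
  if l is (a, b) :: l' then [/\ bmeas a, integr lam b & separable_factors l'] else True.

(** Applied to [D] and to its square, this supplies the conditional mean and the conditional
    variance required by the martingale theorem. *)
Lemma separable_transition (l : seq ((R -> R) * (R -> R))) (H : R -> R -> R) (v : R -> R) :
  separable_factors l ->
  (forall x y, H x y = \sum_(p <- l) p.1 x * p.2 y) ->
  (forall x, v x = \sum_(p <- l) p.1 x * tr p.2 x) ->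
  [/\ forall k, integr P (fun w => H (U k w) (U k.+1 w)), bmeas v &
    forall k W, @bmeas _ (past U k) R W ->
      \int[P]_w (W w * H (U k w) (U k.+1 w)) = \int[P]_w (W w * v (U k w))].
Proof.
elim: l H v => [|[a b] l ih] H v /=.
  move=> _ HE vE.
  have H0 x y : H x y = 0 by rewrite HE big_nil.
  have -> : v = fun=> 0 by apply/funext => x; rewrite vE big_nil.
  split; [|exact: bmeas_cst|].
    by move=> k; under eq_fun do rewrite H0; exact: integr_cst.
  by move=> k W _; apply: eq_Rintegral => w _; rewrite H0.
move=> [ba ib gl] HE vE.
have [iH bv HW] := ih (fun x y => \sum_(p <- l) p.1 x * p.2 y)
  (fun x => \sum_(p <- l) p.1 x * tr p.2 x) gl (fun _ _ => erefl) (fun _ => erefl).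
have HEE x y : H x y = a x * b y + \sum_(p <- l) p.1 x * p.2 y by rewrite HE big_cons.
have -> : v = fun x => a x * tr b x + \sum_(p <- l) p.1 x * tr p.2 x.
  by apply/funext => x; rewrite vE big_cons.
have iab k : integr P (fun w => a (U k w) * b (U k.+1 w)).
  exact: (integrM (bmeas_chain U k ba) (chain_integr hU k.+1 ib)).
have bab : bmeas (fun x => a x * tr b x) by apply: bmeasM => //; exact: bmeas_transition.
split; [|exact: bmeasD|].
  by move=> k; under eq_fun do rewrite HEE; exact: (integrD (iab k) (iH k)).
move=> k W bW; have bW' := past_bmeas bW.
under eq_Rintegral do rewrite HEE mulrDr.
rewrite (expectD (integrM bW' (iab k)) (integrM bW' (iH k))) HW//.
under [RHS]eq_Rintegral do rewrite mulrDr.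
have i1 := integr_bmeas P (bmeasM bW' (bmeas_chain U k bab)).
have i2 := integr_bmeas P (bmeasM bW' (bmeas_chain U k bv)).
rewrite (expectD i1 i2); congr (_ + _).
have bWa : @bmeas _ (past U k) R (fun w => W w * a (U k w)).
  apply: (@bmeasM _ (past U k)) => //; split.
    apply: (@measurableT_comp _ _ _ (past U k) R R a); first exact: (proj1 ba).
    by apply: past_chain.
  by have [_ [M aM]] := ba; exists M.
under eq_Rintegral do rewrite mulrA.
rewrite (markov_transition hU bWa ib).
by apply: eq_Rintegral => w _; rewrite mulrA.
Qed.

Lemma past_pair (H : R * R -> R) k n : measurable_fun [set: R * R] H -> (k < n)%N ->
  @measurable_fun _ _ (past U n) R setT (fun w => H (U k w, U k.+1 w)).
Proof.
move=> mH kn; apply: (@measurableT_comp _ _ _ (past U n) (R * R)%type R H) => //.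
apply/measurable_fun_pairP; split.
  by apply: past_chain; exact: ltnW.
by apply: past_chain.
Qed.

End separable_kernels.

Section clt_remainder.
Context (R : realType) (mu1 mu2 : R) d (T : measurableType d)
  (P : probability T R) (U : nat -> {RV P >-> R}).
Hypothesis hU : stationary_copula_chain (sine_copula mu1 mu2) U.
Hypotheses (mu1_neq1 : 1 - mu1 != 0) (mu2_neq1 : 1 - mu2 != 0).
Local Notation lam := (unif R).
Local Notation tr := (transition mu1 mu2).

(** The lists [l] and [l2] expand [D] and its square; [tl] and [tl2] then say that the conditional
    mean is 0 and the conditional variance [v]. The sums of interest are the [X n], within [C] in
    L^1 of the martingale. *)
Variables (D : R * R -> R) (xi v : R -> R) (X : nat -> T -> R) (C : R).
Variables (l l2 : seq ((R -> R) * (R -> R))).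
Hypothesis mD : measurable_fun [set: R * R] D.
Hypothesis mxi : measurable_fun [set: R] xi.
Hypothesis ixi : integr lam (fun x => xi x ^+ 2).
Hypothesis D_xi : forall x y, `|D (x, y)| <= xi y.
Hypothesis gl : separable_factors l.
Hypothesis Dl : forall x y, D (x, y) = \sum_(p <- l) p.1 x * p.2 y.
Hypothesis tl : forall x, 0 = \sum_(p <- l) p.1 x * tr p.2 x.
Hypothesis gl2 : separable_factors l2.
Hypothesis Dl2 : forall x y, D (x, y) ^+ 2 = \sum_(p <- l2) p.1 x * p.2 y.
Hypothesis tl2 : forall x, v x = \sum_(p <- l2) p.1 x * tr p.2 x.
Local Notation Dk := (fun k w => D (U k w, U k.+1 w)).
Local Notation S := (psum Dk).
Local Notation s := (\int[lam]_x v x).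
Hypothesis mX : forall n, measurable_fun [set: T] (X n).
Hypothesis iX : forall n, integr P (fun w => X n w - S n w).
Hypothesis XC : forall n, \int[P]_w `|X n w - S n w| <= C.

Let mDk k n : (k < n)%N -> @measurable_fun _ _ (past U n) R setT (Dk k).
Proof. by move=> kn; exact: past_pair. Qed.

Let bv : bmeas v.
Proof. by have [] := separable_transition hU gl2 Dl2 tl2. Qed.

Let D1 k W : @bmeas _ (past U k) R W -> \int[P]_w (W w * Dk k w) = 0.
Proof.
have [_ _ H] := separable_transition hU gl Dl tl => bW.
by rewrite H//; under eq_Rintegral do rewrite mulr0; rewrite expect_cst.
Qed.

Let D2 k W : @bmeas _ (past U k) R W ->
  \int[P]_w (W w * Dk k w ^+ 2) = \int[P]_w (W w * v (U k w)).
Proof. by have [_ _ H] := separable_transition hU gl2 Dl2 tl2 => bW; rewrite H. Qed.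

Let measurable_S n : measurable_fun [set: T] (S n).
Proof. exact: (measurable_psum mDk). Qed.

Lemma clt_cos (t theta : R) :
  \int[P]_w cos (t / Num.sqrt n%:R * X n w + theta) @[n --> \oo] -->
    expR (- (t ^+ 2 * s / 2)) * cos theta.
Proof.
have L : \int[P]_w cos (t / Num.sqrt n%:R * S n w + theta) @[n --> \oo] -->
    expR (- (t ^+ 2 * s / 2)) * cos theta.
  exact: (psum_cos_cvg hU mu1_neq1 mu2_neq1 mDk mxi ixi (fun k w => D_xi _ _) bv D1 D2).
have C0 : 0 <= C by apply: le_trans (XC 0); apply: expect_ge0.
have inv0 : (n%:R^-1 : R) @[n --> \oo] --> 0.
  apply/gtr0_cvgV0; first by near=> n; rewrite ltr0n; near: n; exact: nbhs_infty_gt.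
  exact: cvgr_idn.
have h0 : `|t / Num.sqrt n%:R| * C @[n --> \oo] --> 0.
  have -> : (fun n => `|t / Num.sqrt n%:R| * C) = fun n => `|t| * C * Num.sqrt (n%:R^-1).
    by apply/funext => n; rewrite normrM normfV (ger0_norm (sqrtr_ge0 _)) sqrtrV//; ring.
  rewrite -(mulr0 (`|t| * C)); apply: cvgM; first exact: cvg_cst.
  by rewrite -sqrtr0; apply: continuous_cvg => //; exact: sqrt_continuous.
have ic n (Z : T -> R) : measurable_fun [set: T] Z ->
    integr P (fun w => cos (t / Num.sqrt n%:R * Z w + theta)).
  by move=> mZ; apply/integr_bmeas/bmeas_cos; apply: measurable_funD => //; exact: measurable_funM.
have bnd n : `|\int[P]_w cos (t / Num.sqrt n%:R * X n w + theta) -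
    \int[P]_w cos (t / Num.sqrt n%:R * S n w + theta)| <= `|t / Num.sqrt n%:R| * C.
  rewrite -expectB; [|exact: ic|exact: ic].
  apply: (@le_trans _ _ (\int[P]_w (`|t / Num.sqrt n%:R| * `|X n w - S n w|))).
    apply: le_norm_expect.
    - by apply: integrB; exact: ic.
    - by apply: integrZ; exact: integr_norm.
    move=> w; apply: le_trans (cos_lipschitz _ _) _.
    by rewrite -normrM le_eqVlt; apply/orP; left; apply/eqP; congr `|_|; ring.
  by rewrite expectZ ?ler_wpM2l//; exact: integr_norm.
have Z0 : \int[P]_w cos (t / Num.sqrt n%:R * X n w + theta) -
    \int[P]_w cos (t / Num.sqrt n%:R * S n w + theta) @[n --> \oo] --> 0.
  apply: norm_cvg0.
  apply: (@squeeze_cvgr _ _ _ _ (fun=> 0) (fun n => `|t / Num.sqrt n%:R| * C)) => //.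
    by apply: nearW => n; rewrite normr_ge0 bnd.
  exact: cvg_cst.
rewrite -[X in _ --> X]add0r.
have -> : (fun n => \int[P]_w cos (t / Num.sqrt n%:R * X n w + theta)) =
    fun n => (\int[P]_w cos (t / Num.sqrt n%:R * X n w + theta) -
    \int[P]_w cos (t / Num.sqrt n%:R * S n w + theta)) +
    \int[P]_w cos (t / Num.sqrt n%:R * S n w + theta).
  by apply/funext => n; rewrite subrK.
exact: cvgD.
Unshelve. all: by end_near. Qed.

Lemma clt_tight n : integr P (fun w => Num.sqrt (1 + (X n w / Num.sqrt n%:R) ^+ 2)) /\
  \int[P]_w Num.sqrt (1 + (X n w / Num.sqrt n%:R) ^+ 2) <= 1 + s / 2 + C.
Proof.
(* At m = 0 the inverse is 0 by convention, so this and the next bound hold for every m. *)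
have hle m : (Num.sqrt m%:R)^-1 <= 1 :> R.
  case: m => [|m]; first by rewrite sqrtr0 invr0.
  by rewrite invf_le1 ?sqrtr_gt0 ?ltr0n// -[leLHS]sqrtr1 ler_sqrt// ler1n.
have hsqr m : m%:R * (Num.sqrt m%:R)^-1 ^+ 2 <= 1 :> R.
  rewrite exprVn sqr_sqrtr//; case: m => [|m]; first by rewrite mul0r.
  by rewrite divff// pnatr_eq0.
pose h : R := (Num.sqrt n%:R)^-1.
have [i1 B1] := psum_tight hU mDk mxi ixi (fun k w => D_xi _ _) bv D1 D2 h n.
have s0 : 0 <= s := expect_cond_var_ge0 hU bv D2.
have C0 : 0 <= C by apply: le_trans (XC 0); apply: expect_ge0.
have h0 : 0 <= h by rewrite invr_ge0.
have h1 : h <= 1 by exact: hle.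
have nh : n%:R * h ^+ 2 <= 1 by exact: hsqr.
have mXn : measurable_fun [set: T] (fun w => X n w / Num.sqrt n%:R) by exact: measurable_funM.
have iB : integr P (fun w => Num.sqrt (1 + (h * S n w) ^+ 2) + `|X n w - S n w|).
  by apply: integrD => //; exact: integr_norm.
have pt w : Num.sqrt (1 + (X n w / Num.sqrt n%:R) ^+ 2) <=
    Num.sqrt (1 + (h * S n w) ^+ 2) + `|X n w - S n w|.
  apply: le_trans (sqrt1_lipschitz _ (h * S n w)) _; rewrite lerD2l.
  rewrite [X in X - _]mulrC -mulrBr normrM ger0_norm//.
  by rewrite -[leRHS]mul1r ler_wpM2r.
have iA : integr P (fun w => Num.sqrt (1 + (X n w / Num.sqrt n%:R) ^+ 2)).
  apply: le_integr iB; first exact: measurable_sqrt1.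
  by move=> w; rewrite ger0_norm ?sqrtr_ge0.
split=> //; apply: le_trans (le_expect iA iB pt) _.
rewrite (expectD i1 (integr_norm (iX n))) lerD// (le_trans B1)// lerD2l.
by rewrite ler_piMl// divr_ge0.
Qed.

Lemma clt_var_ge0 : 0 <= s.
Proof. exact: (expect_cond_var_ge0 hU bv D2). Qed.

End clt_remainder.

(** * Cosine transforms and integrability of the limit laws *)

Section normal_laws.
Context (R : realType).

Lemma normal_law_cos (v a theta : R) : 0 <= v ->
  \int[normal_law 0 v]_x cos (a * x + theta) = expR (- (a ^+ 2 * v / 2)) * cos theta.
Proof.
move=> v0; have mc : measurable_fun [set: R] (fun x : R => cos (a * x + theta)).
  by have [] := bmeas_cos (measurable_lin a theta).
rewrite /normal_law; have [->|vn0] := eqVneq v 0.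
  rewrite /Rintegral integral_dirac//; last exact/measurable_EFinP.
  by rewrite diracT mul1e/= !mulr0 mul0r oppr0 expR0 mul1r add0r.
rewrite normal_cos ?sqr_sqrtr// gt_eqF// sqrtr_gt0 lt_neqAle eq_sym vn0//.
Qed.

Lemma integr_normal_law (v : R) : 0 <= v ->
  integr (normal_law 0 v) (fun x => Num.sqrt (1 + x ^+ 2)).
Proof.
move=> v0; have ms : measurable_fun [set: R] (fun x : R => Num.sqrt (1 + x ^+ 2)).
  exact: measurable_sqrt1.
rewrite /normal_law; have [_|vn0] := eqVneq v 0.
  apply/integrableP; split; first exact/measurable_EFinP.
  rewrite integral_dirac//; last by apply: measurableT_comp => //; exact/measurable_EFinP.
  by rewrite diracT mul1e ltry.
have sv : Num.sqrt v != 0 by rewrite gt_eqF// sqrtr_gt0 lt_neqAle eq_sym vn0.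
have := integr_normal_norm sv => iN.
apply: (@le_integr _ (measurableTypeR R) R _ _ (fun x : R => 1 + `|x|) ms).
  move=> x; rewrite ger0_norm ?sqrtr_ge0//.
  by have := sqrt1_lipschitz x 0; rewrite expr0n addr0 sqrtr1 subr0.
by apply: integrD; [exact: integr_cst|exact: iN].
Qed.

Local Notation N1 := (normal_prob 0 1 : probability (measurableTypeR R) R).
Local Notation N2 := (std_normal2 R).

Lemma integr_std_normal2_norm :
  integr N2 (fun z => `|z.1|) /\ integr N2 (fun z => `|z.2|).
Proof.
have i1 := integr_normal_norm (oner_neq0 R).
have mn : measurable_fun [set: R] (fun x : R => `|x|) by exact: measurableT_comp.
have fin : (\int[N1]_x (`|x|)%:E < +oo)%E.
  have /integrableP[_] := i1.
  by under eq_integral do rewrite /= normr_id.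
split; apply/integrableP; split.
- apply/measurable_EFinP; exact: (measurableT_comp mn measurable_fst).
- under eq_integral do rewrite /= normr_id.
  rewrite /std_normal2 /= fubini_tonelli1//=; last first.
  + by apply/measurable_EFinP; exact: (measurableT_comp mn measurable_fst).
  under eq_integral do rewrite /fubini_F /= integral_cst//= probability_setT mule1.
  exact: fin.
- apply/measurable_EFinP; exact: (measurableT_comp mn measurable_snd).
- under eq_integral do rewrite /= normr_id.
  rewrite /std_normal2 /= fubini_tonelli2//=; last first.
  + by apply/measurable_EFinP; exact: (measurableT_comp mn measurable_snd).
  under eq_integral do rewrite /fubini_G /= integral_cst//= probability_setT mule1.
  exact: fin.
Qed.

Lemma std_normal2_cos (p q theta : R) :
  \int[N2]_z cos (p * z.1 + q * z.2 + theta) =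
    expR (- ((p ^+ 2 + q ^+ 2) / 2)) * cos theta.
Proof.
have mc : measurable_fun [set: measurableTypeR R * measurableTypeR R]
    (fun z : R * R => cos (p * z.1 + q * z.2 + theta)).
  have [] // := @bmeas_cos _ _ R (fun z : measurableTypeR R * measurableTypeR R =>
    p * z.1 + q * z.2 + theta).
  apply: measurable_funD => //; apply: measurable_funD; apply: measurable_funM => //.
have i : integr N2 (fun z => cos (p * z.1 + q * z.2 + theta)).
  by apply: integr_bmeas; split=> //; exists 1 => z; rewrite ler_norml cos_geN1 cos_le1.
have e (r : R) : expR (- (r ^+ 2 / 2)) * 1 = expR (- (r ^+ 2 / 2)) by rewrite mulr1.
rewrite {1}/Rintegral -integral12_prod_meas1//.
(* The phase absorbs the other variable: for fixed x this is the one-dimensional transform with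
   phase p x + theta. *)
have inner x : (fubini_F N1 (EFin \o (fun z : R * R => cos (p * z.1 + q * z.2 + theta)))) x =
    (expR (- (q ^+ 2 / 2)) * cos (p * x + theta))%:E.
  rewrite /fubini_F /=.
  have b : bmeas (fun y : R => cos (q * y + (p * x + theta))).
    by apply: bmeas_cos; exact: measurable_lin.
  have iN := integr_bmeas N1 b.
  have := @normal_cos R 1 (oner_neq0 R) (p * x + theta) q.
  rewrite expr1n mulr1 => <-; rewrite /Rintegral fineK ?(integrable_fin_num measurableT iN)//.
  by apply: eq_integral => y _; congr (cos _)%:E; ring.
rewrite (eq_integral (fun x : measurableTypeR R =>
  (expR (- (q ^+ 2 / 2)) * cos (p * x + theta))%:E)); last first.
  by move=> x _; exact: inner.
have b : bmeas (fun x : R => cos (p * x + theta)).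
  by apply: bmeas_cos; exact: measurable_lin.
have iN := integr_bmeas N1 b.
rewrite -[LHS]/(\int[N1]_x (expR (- (q ^+ 2 / 2)) * cos (p * x + theta))).
rewrite (expectZ _ iN) (normal_cos (oner_neq0 R)) expr1n mulr1 mulrA -expRD.
by congr (expR _ * _); ring.
Qed.

End normal_laws.

(** * Sample covariances *)

Lemma expectation_Rintegral d (T : measurableType d) (R : realType) (P : probability T R)
    (X : T -> R) : integr P X -> 'E_P[X]%E = (\int[P]_w X w)%:E.
Proof.
by move=> iX; rewrite unlock /Rintegral fineK//; exact: integrable_fin_num.
Qed.

Section sample_covariance.
Context (R : realType) (mu1 mu2 : R).
Local Notation lam := (unif R).
Local Notation tr := (transition mu1 mu2).

Lemma transition_sink_sink m n x : (0 < m)%N ->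
  tr (fun y => sink m y * sink (m + n) y) x = if n == 0%N then 2^-1 else 0.
Proof.
move=> m0; have ic k := integr_bmeas lam (bmeas_cosk R k).
have -> : (fun y : R => sink m y * sink (m + n) y) =
    fun y => 2^-1 * cosk n y + (- 2^-1 * cosk (m + (m + n)) y + 0).
  by apply/funext => y; rewrite sink_sink; ring.
rewrite !transition_lin//; last 2 first.
- exact: integr_cst.
- by apply: integrD; [exact: integrZ|exact: integr_cst].
rewrite transition_cst (@transition_cosk _ _ _ (m + (m + n))) ?addn_gt0 ?m0// mulr0 !addr0.
have [->|n0] := eqVneq n 0%N; last by rewrite transition_cosk ?lt0n// mulr0.
have -> : cosk 0 = fun=> 1 :> R by apply/funext => y; rewrite /cosk mulr0 !mul0r cos0.
by rewrite transition_cst mulr1.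
Qed.

Lemma cosk_cosk m n (x : R) :
  cosk m x * cosk (m + n) x = 2^-1 * (cosk n x + cosk (m + (m + n)) x).
Proof.
rewrite !coskD !sinkD; have := cosk_sink_sqr m x.
set c := cosk m x; set s := sink m x => h.
have e : s * (s * cosk n x) = cosk n x - c * (c * cosk n x).
  by rewrite !mulrA -!expr2 h; ring.
by lra.
Qed.

Lemma transition_cosk_cosk m n x : (0 < m)%N ->
  tr (fun y => cosk m y * cosk (m + n) y) x = if n == 0%N then 2^-1 else 0.
Proof.
move=> m0; have ic k := integr_bmeas lam (bmeas_cosk R k).
have -> : (fun y : R => cosk m y * cosk (m + n) y) =
    fun y => 2^-1 * cosk n y + (2^-1 * cosk (m + (m + n)) y + 0).
  by apply/funext => y; rewrite cosk_cosk; ring.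
rewrite !transition_lin//; last 2 first.
- exact: integr_cst.
- by apply: integrD; [exact: integrZ|exact: integr_cst].
rewrite transition_cst (@transition_cosk _ _ _ (m + (m + n))) ?addn_gt0 ?m0// mulr0 !addr0.
have [->|n0] := eqVneq n 0%N; last by rewrite transition_cosk ?lt0n// mulr0.
have -> : cosk 0 = fun=> 1 :> R by apply/funext => y; rewrite /cosk mulr0 !mul0r cos0.
by rewrite transition_cst mulr1.
Qed.

Lemma transition_sink_cosk m n x :
  tr (fun y => sink m y * cosk (m + n) y) x =
    2^-1 * (tr (sink (m + (m + n))) x - tr (sink n) x).
Proof.
have is_ k := integr_bmeas lam (bmeas_sink R k).
have -> : (fun y : R => sink m y * cosk (m + n) y) =
    fun y => 2^-1 * sink (m + (m + n)) y + (- 2^-1 * sink n y + 0).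
  by apply/funext => y; rewrite (sink_cosk _ _ _).1; ring.
rewrite !transition_lin//; last 2 first.
- exact: integr_cst.
- by apply: integrD; [exact: integrZ|exact: integr_cst].
by rewrite transition_cst; ring.
Qed.

Variables t1 t2 : R.

(* Martingale differences whose sums are those of
   [sum_i t_i (phi_i(x) phi_i(y) - mu_i)] up to the boundary terms
   [t_i mu_i phi_i^2]; recall [phi_i = sqrt 2 sink i] and
   [phi_i^2 - 1 = - cosk (2 i)]. *)
Definition cov_drift x : R :=
  2 * (t1 * mu1 * sink 1 x ^+ 2 + t2 * mu2 * sink 2 x ^+ 2).
Definition cov_diff (z : R * R) : R :=
  2 * t1 * sink 1 z.1 * sink 1 z.2 + 2 * t2 * sink 2 z.1 * sink 2 z.2
  - t1 * mu1 * cosk 2 z.2 - t2 * mu2 * cosk 4 z.2 - cov_drift z.1.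
(** The conditional second moment of [cov_diff]. The halves come from squared sines and cosines; the
    terms in (t mu sink)^2 come from the products of [sink 1] with [cosk 2] and of [sink 2] with
    [cosk 4], whose difference frequencies are not killed by [tr]. The drift is the conditional mean
    of the other four terms, hence the minus sign of its square. *)
Definition cov_var x : R :=
  2^-1 * ((2 * t1 * sink 1 x) ^+ 2 + (2 * t2 * sink 2 x) ^+ 2 +
    (t1 * mu1) ^+ 2 + (t2 * mu2) ^+ 2) +
  2 * (t1 * mu1 * sink 1 x) ^+ 2 + 2 * (t2 * mu2 * sink 2 x) ^+ 2 - cov_drift x ^+ 2.

Let a1 (x : R) := 2 * t1 * sink 1 x.
Let a2 (x : R) := 2 * t2 * sink 2 x.
Let a3 (x : R) := - (t1 * mu1).
Let a4 (x : R) := - (t2 * mu2).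
Let one (x : R) : R := 1.

Let ba1 : bmeas a1. Proof. by apply: bmeasM; [exact: bmeas_cst|exact: bmeas_sink]. Qed.
Let ba2 : bmeas a2. Proof. by apply: bmeasM; [exact: bmeas_cst|exact: bmeas_sink]. Qed.
Let ba3 : bmeas a3. Proof. exact: bmeas_cst. Qed.
Let ba4 : bmeas a4. Proof. exact: bmeas_cst. Qed.

Lemma bmeas_cov_drift : bmeas cov_drift.
Proof.
apply: bmeasM; first exact: bmeas_cst.
by apply: bmeasD; apply: bmeasM; [exact: bmeas_cst|exact/bmeasX/bmeas_sink|
  exact: bmeas_cst|exact/bmeasX/bmeas_sink].
Qed.

Definition cov_factors : seq ((R -> R) * (R -> R)) :=
  [:: (a1, sink 1); (a2, sink 2); (a3, cosk 2); (a4, cosk 4);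
      (fun x => - cov_drift x, one)].

(** The squares and cross products of the five terms of [cov_diff]. Frequencies are written m + n to
    fit the product formulas for [transition]. *)
Definition cov_factors2 : seq ((R -> R) * (R -> R)) :=
  [:: (fun x => a1 x * a1 x, fun y => sink 1 y * sink (1 + 0) y);
      (fun x => a2 x * a2 x, fun y => sink 2 y * sink (2 + 0) y);
      (fun x => a3 x * a3 x, fun y => cosk 2 y * cosk (2 + 0) y);
      (fun x => a4 x * a4 x, fun y => cosk 4 y * cosk (4 + 0) y);
      (fun x => 2 * (a1 x * a2 x), fun y => sink 1 y * sink (1 + 1) y);
      (fun x => 2 * (a1 x * a3 x), fun y => sink 1 y * cosk (1 + 1) y);
      (fun x => 2 * (a1 x * a4 x), fun y => sink 1 y * cosk (1 + 3) y);
      (fun x => 2 * (a2 x * a3 x), fun y => sink 2 y * cosk (2 + 0) y);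
      (fun x => 2 * (a2 x * a4 x), fun y => sink 2 y * cosk (2 + 2) y);
      (fun x => 2 * (a3 x * a4 x), fun y => cosk 2 y * cosk (2 + 2) y);
      (fun x => -2 * (cov_drift x * a1 x), sink 1);
      (fun x => -2 * (cov_drift x * a2 x), sink 2);
      (fun x => -2 * (cov_drift x * a3 x), cosk 2);
      (fun x => -2 * (cov_drift x * a4 x), cosk 4);
      (fun x => cov_drift x * cov_drift x, one)].

Lemma cov_factorsP : separable_factors cov_factors /\ separable_factors cov_factors2.
Proof.
have bd := bmeas_cov_drift; have bs := bmeas_sink R; have bc := bmeas_cosk R.
have is_ k := integr_bmeas lam (bs k); have ic k := integr_bmeas lam (bc k).
have i1 : integr lam one by exact: integr_cst.
have bM (c : R) (f g : R -> R) : bmeas f -> bmeas g -> bmeas (fun x => c * (f x * g x)).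
  by move=> bf bg; exact: (bmeasM (bmeas_cst _ c) (bmeasM bf bg)).
have iM (f g : R -> R) : bmeas f -> bmeas g -> integr lam (fun x => f x * g x).
  by move=> bf bg; exact: (integr_bmeas lam (bmeasM bf bg)).
have cons (a b : R -> R) l : bmeas a -> integr lam b -> separable_factors l ->
    separable_factors ((a, b) :: l) by [].
split.
  apply: (cons _ _ _ ba1 (is_ 1)); apply: (cons _ _ _ ba2 (is_ 2)).
  apply: (cons _ _ _ ba3 (ic 2)); apply: (cons _ _ _ ba4 (ic 4)).
  exact: (cons _ _ [::] (bmeasN bd) i1 I).
apply: (cons _ _ _ (bmeasM ba1 ba1) (iM _ _ (bs 1) (bs _))).
apply: (cons _ _ _ (bmeasM ba2 ba2) (iM _ _ (bs 2) (bs _))).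
apply: (cons _ _ _ (bmeasM ba3 ba3) (iM _ _ (bc 2) (bc _))).
apply: (cons _ _ _ (bmeasM ba4 ba4) (iM _ _ (bc 4) (bc _))).
apply: (cons _ _ _ (bM _ _ _ ba1 ba2) (iM _ _ (bs 1) (bs _))).
apply: (cons _ _ _ (bM _ _ _ ba1 ba3) (iM _ _ (bs 1) (bc _))).
apply: (cons _ _ _ (bM _ _ _ ba1 ba4) (iM _ _ (bs 1) (bc _))).
apply: (cons _ _ _ (bM _ _ _ ba2 ba3) (iM _ _ (bs 2) (bc _))).
apply: (cons _ _ _ (bM _ _ _ ba2 ba4) (iM _ _ (bs 2) (bc _))).
apply: (cons _ _ _ (bM _ _ _ ba3 ba4) (iM _ _ (bc 2) (bc _))).
apply: (cons _ _ _ (bM _ _ _ bd ba1) (is_ 1)); apply: (cons _ _ _ (bM _ _ _ bd ba2) (is_ 2)).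
apply: (cons _ _ _ (bM _ _ _ bd ba3) (ic 2)); apply: (cons _ _ _ (bM _ _ _ bd ba4) (ic 4)).
exact: (cons _ _ [::] (bmeasM bd bd) i1 I).
Qed.

Lemma cov_diff_factors x y : cov_diff (x, y) = \sum_(p <- cov_factors) p.1 x * p.2 y.
Proof. by rewrite /cov_factors !big_cons big_nil /= /cov_diff /= /a1 /a2 /a3 /a4 /one; ring. Qed.

Lemma cov_diff_factors2 x y :
  cov_diff (x, y) ^+ 2 = \sum_(p <- cov_factors2) p.1 x * p.2 y.
Proof.
rewrite /cov_factors2 !big_cons big_nil /= /cov_diff /= /a1 /a2 /a3 /a4 /one.
rewrite !addn0 !add1n !add2n; ring.
Qed.

Lemma cov_diff_transition x : 0 = \sum_(p <- cov_factors) p.1 x * tr p.2 x.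
Proof.
rewrite /cov_factors !big_cons big_nil /= !transition_sink !transition_cosk// transition_cst /=.
by rewrite /a1 /a2 /a3 /a4 /cov_drift; ring.
Qed.

Lemma cov_diff_transition2 x : cov_var x = \sum_(p <- cov_factors2) p.1 x * tr p.2 x.
Proof.
rewrite /cov_factors2 !big_cons big_nil.
rewrite ![in RHS]/= !transition_sink_sink// !transition_cosk_cosk// !transition_sink_cosk.
rewrite !transition_sink !transition_cosk// transition_cst /=.
by rewrite /a1 /a2 /a3 /a4 /cov_var /cov_drift; field.
Qed.

(** The quadratic form of the limiting covariance matrix at (t1, t2). Expanded in cosines, [cov_var]
    has frequencies 2, 4, 6, 8, which integrate to 0, and this constant term. *)
Lemma expect_cov_var :
  \int[lam]_x cov_var x = t1 ^+ 2 + t2 ^+ 2 - 2 * (mu1 * mu2) * (t1 * t2).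
Proof.
set b1 := t1 * mu1; set b2 := t2 * mu2.
set s := (X in _ = X).
have E (x : R) : cov_var x = (b1 ^+ 2 - t1 ^+ 2 + b1 * b2) * cosk 2 x +
   ((b2 ^+ 2 - t2 ^+ 2 - b1 ^+ 2 / 2 + 2 * b1 * b2) * cosk 4 x +
   (- (b1 * b2) * cosk 6 x + (- (b2 ^+ 2 / 2) * cosk 8 x + s))).
  have e1 : sink 1 x * sink 1 x = 2^-1 * (1 - cosk 2 x).
    have := sink_sink 1 0 x; rewrite !addn0 => ->.
    by rewrite {1}/cosk mulr0 !mul0r cos0.
  have e2 : sink 2 x * sink 2 x = 2^-1 * (1 - cosk 4 x).
    have := sink_sink 2 0 x; rewrite !addn0 => ->.
    by rewrite {1}/cosk mulr0 !mul0r cos0.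
  have e3 : cosk 2 x * cosk 2 x = 2^-1 * (1 + cosk 4 x).
    have := cosk_cosk 2 0 x; rewrite !addn0 => ->.
    by rewrite {1}/cosk mulr0 !mul0r cos0.
  have e4 : cosk 4 x * cosk 4 x = 2^-1 * (1 + cosk 8 x).
    have := cosk_cosk 4 0 x; rewrite !addn0 => ->.
    by rewrite {1}/cosk mulr0 !mul0r cos0.
  have e5 : cosk 2 x * cosk 4 x = 2^-1 * (cosk 2 x + cosk 6 x).
    by have := cosk_cosk 2 2 x.
  have -> : cov_var x = 2^-1 * (4 * t1 ^+ 2 * (sink 1 x * sink 1 x) +
      4 * t2 ^+ 2 * (sink 2 x * sink 2 x) + b1 ^+ 2 + b2 ^+ 2) +
      2 * b1 ^+ 2 * (sink 1 x * sink 1 x) + 2 * b2 ^+ 2 * (sink 2 x * sink 2 x) -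
      4 * (b1 * (sink 1 x * sink 1 x) + b2 * (sink 2 x * sink 2 x)) ^+ 2.
    by rewrite /cov_var /cov_drift /b1 /b2; ring.
  rewrite e1 e2.
  have -> : 4 * (b1 * (2^-1 * (1 - cosk 2 x)) + b2 * (2^-1 * (1 - cosk 4 x))) ^+ 2 =
     b1 ^+ 2 * (1 - 2 * cosk 2 x + cosk 2 x * cosk 2 x) +
     2 * b1 * b2 * (1 - cosk 2 x - cosk 4 x + cosk 2 x * cosk 4 x) +
     b2 ^+ 2 * (1 - 2 * cosk 4 x + cosk 4 x * cosk 4 x) by field.
  by rewrite e3 e4 e5 /s /b1 /b2; field.
under eq_Rintegral do rewrite E.
have ic k := integr_bmeas lam (bmeas_cosk R k).
have is0 : integr lam (fun _ => s) by exact: integr_cst.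
rewrite (expectD (integrZ _ (ic 2)) (integrD (integrZ _ (ic 4)) (integrD (integrZ _ (ic 6))
  (integrD (integrZ _ (ic 8)) is0)))).
rewrite (expectD (integrZ _ (ic 4)) (integrD (integrZ _ (ic 6)) (integrD (integrZ _ (ic 8)) is0))).
rewrite (expectD (integrZ _ (ic 6)) (integrD (integrZ _ (ic 8)) is0)).
rewrite (expectD (integrZ _ (ic 8)) is0) !(expectZ _ (ic _)) !expect_cosk// expect_cst.
by rewrite !mulr0 !add0r.
Qed.

Lemma bmeas_cov_diff : bmeas cov_diff.
Proof.
have b1 f : bmeas f -> bmeas (fun z : R * R => f z.1 : R).
  exact: (bmeas_comp measurable_fst).
have b2 f : bmeas f -> bmeas (fun z : R * R => f z.2 : R).
  exact: (bmeas_comp measurable_snd).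
have bs := bmeas_sink R; have bc := bmeas_cosk R; have bk c := bmeas_cst (R * R)%type (c : R).
apply: bmeasB; last exact: (b1 _ bmeas_cov_drift).
apply: bmeasB; last by apply: bmeasM; [exact: bk|exact: (b2 _ (bc 4))].
apply: bmeasB; last by apply: bmeasM; [exact: bk|exact: (b2 _ (bc 2))].
apply: bmeasD.
  by apply: bmeasM; [exact: (b1 _ ba1)|exact: (b2 _ (bs 1))].
by apply: bmeasM; [exact: (b1 _ ba2)|exact: (b2 _ (bs 2))].
Qed.

End sample_covariance.

Section col2_topology.
Context (R : realType).

Lemma continuous_col2 : continuous (fun z : R * R => col2 z.1 z.2).
Proof.
move=> z; apply/cvg_ballP => e e0; near=> z'.
have h1 : ball z.1 e z'.1 by near: z'; exists (ball z.1 e, ball z.2 e) => [|[? ?] []//];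
  split; exact: nbhsx_ballx.
have h2 : ball z.2 e z'.2 by near: z'; exists (ball z.1 e, ball z.2 e) => [|[? ?] []//];
  split; exact: nbhsx_ballx.
by split=> // i j; rewrite !mxE; case: i => [[|[|//]] i2].
Unshelve. all: by end_near. Qed.

Lemma scale_col2 (c x y x' y' : R) :
  c *: (col2 x y - col2 x' y') = col2 (c * (x - x')) (c * (y - y')).
Proof.
by apply/matrixP => i j; rewrite !mxE; case: i => [[|[|//]] i2].
Qed.

Lemma normal_vector2_corr (r : R) (z : R * R) :
  normal_vector2 (col2 0 0) (mx2 1 r r 1) z =
    col2 z.1 (r * z.1 + Num.sqrt (1 - r ^+ 2) * z.2).
Proof.
apply/matrixP => i j; rewrite /normal_vector2 /cholesky2 !mxE !big_ord_recl big_ord0 !mxE /=.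
by case: i => [[|[|//]] i2] /=;
  rewrite ?sqrtr1 ?divr1 ?mul1r ?mul0r ?addr0 ?add0r.
Qed.

End col2_topology.

(** * Joint limit theorem for the two sample covariances *)

Section joint_clt.
Context (R : realType) (mu1 mu2 : R) d (T : measurableType d)
  (P : probability T R) (U : nat -> {RV P >-> R}).
Hypothesis hU : stationary_copula_chain (sine_copula mu1 mu2) U.
Hypothesis hmu : 2 * `|mu1| + 2 * `|mu2| <= 1.
Local Notation lam := (unif R).

Lemma mu_bounds : [/\ 1 - mu1 != 0, 1 - mu2 != 0 & 0 <= 1 - (- (mu1 * mu2)) ^+ 2].
Proof.
have h0 := hmu; have h1 := ler_norm mu1; have h2 := ler_norm mu2.
have h3 := normr_ge0 mu1; have h4 := normr_ge0 mu2.
have n1 : `|mu1| <= 1 / 2 by lra.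
have n2 : `|mu2| <= 1 / 2 by lra.
split; [by rewrite gt_eqF//; lra|by rewrite gt_eqF//; lra|].
rewrite sqrrN subr_ge0 -[leRHS](expr1n R 2) -(real_normK (num_real (mu1 * mu2))).
rewrite lerXn2r ?nnegrE// normrM -[leRHS]mulr1 ler_pM//; lra.
Qed.

(** Linear combinations as in the Cramer-Wold device: the transform of the pair at (a, b) is that of
    [cov_sum a b]. *)
Definition cov_sum (t1 t2 : R) (n : nat) (w : T) : R :=
  \sum_(i < n) (t1 * (phi 1 (U i w) * phi 1 (U i.+1 w) - mu1) +
                t2 * (phi 2 (U i w) * phi 2 (U i.+1 w) - mu2)).

Lemma measurable_cov_sum t1 t2 n : measurable_fun [set: T] (cov_sum t1 t2 n).
Proof.
apply: measurable_sum => i.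
have bp k := bmeas_phi R k; have m1 := measurable_chain U.
apply: measurable_funD; apply: measurable_funM => //; apply: measurable_funB => //;
  by apply: measurable_funM; apply: measurableT_comp => //; have [] := bp 1%N; have [] := bp 2%N.
Qed.

(** As 1 - cos 2 a = 2 sin^2 a, each summand exceeds its martingale difference by the drift at [U i]
    minus the drift at [U i.+1], and the sum telescopes. *)
Lemma cov_sum_psum t1 t2 n w :
  cov_sum t1 t2 n w -
    psum (fun k w => cov_diff mu1 mu2 t1 t2 (U k w, U k.+1 w)) n w =
  cov_drift mu1 mu2 t1 t2 (U 0%N w) - cov_drift mu1 mu2 t1 t2 (U n w).
Proof.
elim: n => [|n ih]; first by rewrite /cov_sum /psum !big_ord0 !subrr.
rewrite psumS /cov_sum big_ord_recr /= -/(cov_sum t1 t2 n w).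
have -> (a b c e : R) : a + b - (c + e) = (a - c) + (b - e) by ring.
rewrite ih /cov_diff !phiE /=.
have h2 : Num.sqrt 2 ^+ 2 = 2 :> R by rewrite sqr_sqrtr.
set x := U n w; set y := U n.+1 w.
have e (u v : R) : Num.sqrt 2 * u * (Num.sqrt 2 * v) = 2 * u * v.
  have -> : Num.sqrt 2 * u * (Num.sqrt 2 * v) = Num.sqrt 2 ^+ 2 * u * v by ring.
  by rewrite h2.
rewrite !e.
have c2 : cosk 2 y = 1 - 2 * sink 1 y ^+ 2.
  by have := coskD 1 1 y; rewrite -!expr2 cosk_sink_sqr => ->; ring.
have c4 : cosk 4 y = 1 - 2 * sink 2 y ^+ 2.
  by have := coskD 2 2 y; rewrite -!expr2 cosk_sink_sqr => ->; ring.
by rewrite c2 c4 /cov_drift; ring.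
Qed.

Lemma cov_sum_clt t1 t2 : exists B : R,
  (forall n, integr P (fun w => Num.sqrt (1 + (cov_sum t1 t2 n w / Num.sqrt n%:R) ^+ 2)) /\
    \int[P]_w Num.sqrt (1 + (cov_sum t1 t2 n w / Num.sqrt n%:R) ^+ 2) <= B) /\
  (forall t theta : R,
    \int[P]_w cos (t / Num.sqrt n%:R * cov_sum t1 t2 n w + theta) @[n --> \oo] -->
    expR (- (t ^+ 2 * (t1 ^+ 2 + t2 ^+ 2 - 2 * (mu1 * mu2) * (t1 * t2)) / 2)) * cos theta).
Proof.
have [m1 m2 _] := mu_bounds.
have [mD [M DM]] := bmeas_cov_diff mu1 mu2 t1 t2.
have bdr := bmeas_cov_drift mu1 mu2 t1 t2; have [_ [M' drM]] := bdr.
have [gl gl2] := cov_factorsP mu1 mu2 t1 t2.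
have Dl := cov_diff_factors mu1 mu2 t1 t2; have Dl2 := cov_diff_factors2 mu1 mu2 t1 t2.
have tl := cov_diff_transition mu1 mu2 t1 t2; have tl2 := cov_diff_transition2 mu1 mu2 t1 t2.
have mxi : measurable_fun [set: R] (fun _ : R => M) by [].
have ixi : integr lam (fun _ => M ^+ 2) by exact: integr_cst.
have D_xi x y : `|cov_diff mu1 mu2 t1 t2 (x, y)| <= M by exact: DM.
have brem n : bmeas (fun w => cov_drift mu1 mu2 t1 t2 (U 0%N w) - cov_drift mu1 mu2 t1 t2 (U n w)).
  exact: (bmeasB (bmeas_chain U 0 bdr) (bmeas_chain U n bdr)).
have iX n : integr P (fun w => cov_sum t1 t2 n w -
    psum (fun k w => cov_diff mu1 mu2 t1 t2 (U k w, U k.+1 w)) n w).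
  by under eq_fun do rewrite cov_sum_psum; exact: integr_bmeas.
have XC n : \int[P]_w `|cov_sum t1 t2 n w -
    psum (fun k w => cov_diff mu1 mu2 t1 t2 (U k w, U k.+1 w)) n w| <= M' + M'.
  rewrite -(expect_cst P (M' + M')); apply: le_expect.
  - exact: integr_norm.
  - exact: integr_cst.
  - by move=> w; rewrite cov_sum_psum (le_trans (ler_normB _ _))// lerD.
have mX := measurable_cov_sum t1 t2.
exists (1 + (\int[lam]_x cov_var mu1 mu2 t1 t2 x) / 2 + (M' + M')); split=> [n|t theta].
  exact: (clt_tight hU mD mxi ixi D_xi gl Dl tl gl2 Dl2 tl2 mX iX XC).
rewrite -expect_cov_var.
exact: (clt_cos hU m1 m2 mD mxi ixi D_xi gl Dl tl gl2 Dl2 tl2 mX iX XC).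
Qed.

Lemma mu_hat_cov_sum n w :
  Num.sqrt n.-1%:R * (mu_hat U 1 n w - mu1) = cov_sum 1 0 n.-1 w / Num.sqrt n.-1%:R /\
  Num.sqrt n.-1%:R * (mu_hat U 2 n w - mu2) = cov_sum 0 1 n.-1 w / Num.sqrt n.-1%:R.
Proof.
set m := n.-1; rewrite /mu_hat -/m.
have E1 : cov_sum 1 0 m w = \sum_(i < m) phi 1 (U i w) * phi 1 (U i.+1 w) - m%:R * mu1.
  rewrite /cov_sum mulr_natl -[in X in _ - X](card_ord m) -sumr_const -sumrB.
  by apply: eq_bigr => i _; rewrite mul1r mul0r addr0.
have E2 : cov_sum 0 1 m w = \sum_(i < m) phi 2 (U i w) * phi 2 (U i.+1 w) - m%:R * mu2.
  rewrite /cov_sum mulr_natl -[in X in _ - X](card_ord m) -sumr_const -sumrB.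
  by apply: eq_bigr => i _; rewrite mul1r mul0r add0r.
(* With no summands both sides are 0, the inverse of 0 being 0. *)
rewrite E1 E2; case: (m) => [|k]; first by rewrite sqrtr0 invr0 !mul0r !mulr0.
have r0 : Num.sqrt k.+1%:R != 0 :> R by rewrite gt_eqF// sqrtr_gt0 ltr0n.
have rr : k.+1%:R = Num.sqrt k.+1%:R ^+ 2 :> R by rewrite sqr_sqrtr.
by split; rewrite {2 3}rr; field.
Qed.

Theorem joint_clt : cvg_in_distribution P
    (fun (n : nat) (w : T) =>
      Num.sqrt n.-1%:R *:
        (col2 (mu_hat U 1 n w) (mu_hat U 2 n w) - col2 mu1 mu2))
    (std_normal2 R)
    (normal_vector2 (col2 0 0) (mx2 1 (- (mu1 * mu2)) (- (mu1 * mu2)) 1)).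
Proof.
have [m1 m2 rho1] := mu_bounds; set r := - (mu1 * mu2) in rho1 *.
set c := Num.sqrt (1 - r ^+ 2).
have c2 : c ^+ 2 = 1 - r ^+ 2 by rewrite sqr_sqrtr.
move=> g cg [M gM].
pose G (z : R * R) := g (col2 z.1 z.2).
have cG : continuous G.
  by move=> z; apply: (@continuous_comp _ _ _ (fun z : R * R => col2 z.1 z.2) g);
    [exact: continuous_col2|exact: cg].
have GM z : `|G z| <= M by exact: gM.
pose X n w := cov_sum 1 0 n.-1 w / Num.sqrt n.-1%:R.
pose Y n w := cov_sum 0 1 n.-1 w / Num.sqrt n.-1%:R.
have mX n : measurable_fun [set: T] (X n).
  by apply: measurable_funM => //; exact: measurable_cov_sum.
have mY n : measurable_fun [set: T] (Y n).
  by apply: measurable_funM => //; exact: measurable_cov_sum.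
pose X' (z : measurableTypeR R * measurableTypeR R) : R := z.1.
pose Y' (z : measurableTypeR R * measurableTypeR R) : R := r * z.1 + c * z.2.
have mX' : measurable_fun [set: measurableTypeR R * measurableTypeR R] X' by exact: measurable_fst.
have mY' : measurable_fun [set: measurableTypeR R * measurableTypeR R] Y'.
  by apply: measurable_funD; apply: measurable_funM => //.
have -> : g \o normal_vector2 (col2 0 0) (mx2 1 r r 1) = fun z => G (X' z, Y' z).
  by apply/funext => z; rewrite /= normal_vector2_corr.
have iG : integr (std_normal2 R) (fun z => G (X' z, Y' z)).
  by apply: integr_bmeas; exact: (continuous_bmeas mX' mY' cG GM).
rewrite (expectation_Rintegral iG).
have -> : (fun n => 'E_P[g \o (fun w => Num.sqrt n.-1%:R *:
    (col2 (mu_hat U 1 n w) (mu_hat U 2 n w) - col2 mu1 mu2))]%E) =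
    fun n => (\int[P]_w G (X n w, Y n w))%:E.
  apply/funext => n; rewrite -expectation_Rintegral; last first.
    by apply: integr_bmeas; exact: (continuous_bmeas (mX n) (mY n) cG GM).
  congr ('E_P[ _ ]%E); apply/funext => w; rewrite /= scale_col2.
  by rewrite (mu_hat_cov_sum n w).1 (mu_hat_cov_sum n w).2.
apply: cvg_EFin; first exact: nearW.
have [B1 [t1 _]] := cov_sum_clt 1 0; have [B2 [t2 _]] := cov_sum_clt 0 1.
have [n1 n2] := integr_std_normal2_norm R.
have sle (x : R) : Num.sqrt (1 + x ^+ 2) <= 1 + `|x|.
  by have := sqrt1_lipschitz x 0; rewrite expr0n addr0 sqrtr1 subr0.
apply: (@cvg_expect_of_trig R _ T P X Y _ _ (std_normal2 R) X' Y' (Num.max B1 B2)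
  mX mY mX' mY' _ _ _ _ _ _ _ G M cG GM).
- by move=> n; have [] := t1 n.-1.
- by move=> n; have [] := t2 n.-1.
- by move=> n; have [_ h] := t1 n.-1; rewrite le_max h.
- by move=> n; have [_ h] := t2 n.-1; rewrite le_max h orbT.
- apply: (@le_integr _ _ R (std_normal2 R) _ (fun z => 1 + `|z.1|)).
  + exact: measurable_sqrt1.
  + by move=> z; rewrite ger0_norm ?sqrtr_ge0.
  + by apply: integrD => //; exact: integr_cst.
- apply: (@le_integr _ _ R (std_normal2 R) _ (fun z => 1 + (`|r| * `|z.1| + `|c| * `|z.2|))).
  + exact: measurable_sqrt1.
  + move=> z; rewrite ger0_norm ?sqrtr_ge0// (le_trans (sle _))// lerD2l.
    by rewrite (le_trans (ler_normD _ _))// !normrM.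
  + by apply: integrD; [exact: integr_cst|apply: integrD; exact: integrZ].
move=> a b theta.
have [_ [_ H]] := cov_sum_clt a b.
have -> : \int[std_normal2 R]_w cos (a * X' w + b * Y' w + theta) =
    expR (- (1 ^+ 2 * (a ^+ 2 + b ^+ 2 - 2 * (mu1 * mu2) * (a * b)) / 2)) * cos theta.
  (* The squares of the two coefficients add up to a^2 + b^2 + 2 r a b, because c^2 = 1 - r^2. *)
  have -> : (fun w => cos (a * X' w + b * Y' w + theta)) =
      fun z => cos ((a + b * r) * z.1 + (b * c) * z.2 + theta).
    by apply/funext => z; congr cos; rewrite /X' /Y'; ring.
  rewrite std_normal2_cos; congr (expR (- _) * _).
  have -> : (b * c) ^+ 2 = b ^+ 2 * c ^+ 2 by ring.
  by rewrite c2 /r; field.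
(* [X n] and [Y n] have n - 1 summands; the shift matches them with [cov_sum] at n. *)
rewrite -(cvg_shiftS (fun n => \int[P]_w cos (a * X n w + b * Y n w + theta))).
have -> : (fun n => \int[P]_w cos (a * X n.+1 w + b * Y n.+1 w + theta)) =
    fun n => \int[P]_w cos (1 / Num.sqrt n%:R * cov_sum a b n w + theta).
  apply/funext => n; apply: eq_Rintegral => w _; congr cos; congr (_ + _).
  have -> : cov_sum a b n w = a * cov_sum 1 0 n w + b * cov_sum 0 1 n w.
    rewrite /cov_sum !mulr_sumr -big_split /=; apply: eq_bigr => i _; ring.
  by rewrite /X /Y /=; ring.
exact: H.
Qed.

End joint_clt.

(** * Partial sums of a function of the chain *)

Section sum_clt.
Context (R : realType) (mu1 mu2 : R) d (T : measurableType d)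
  (P : probability T R) (U : nat -> {RV P >-> R}).
Hypothesis hU : stationary_copula_chain (sine_copula mu1 mu2) U.
Hypotheses (mu1_neq1 : 1 - mu1 != 0) (mu2_neq1 : 1 - mu2 != 0).
Local Notation lam := (unif R).
Local Notation tr := (transition mu1 mu2).

Lemma integr_sqrD (f b : R -> R) : bmeas b -> measurable_fun [set: R] f ->
  integr lam (fun x => f x ^+ 2) -> integr lam (fun x => (f x + b x) ^+ 2).
Proof.
move=> bb mf if2; have if1 := @integr_of_sqr _ _ R lam f mf if2.
have -> : (fun x => (f x + b x) ^+ 2) = fun x => f x ^+ 2 + (2 * (b x * f x) + b x ^+ 2).
  by apply/funext => x; ring.
apply: integrD => //; apply: integrD; first exact/integrZ/integrM.
exact/integr_bmeas/bmeasX.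
Qed.

(** Invariance of the uniform law, the [phi k] being centred. *)
Lemma expect_transition (b : R -> R) : \int[lam]_x tr b x = \int[lam]_x b x.
Proof.
have ip k := integr_bmeas lam (bmeas_phi R k).
rewrite /transition (expectD (integrD (integr_cst _ _) (integrZ _ (ip 1%N))) (integrZ _ (ip 2%N))).
rewrite (expectD (integr_cst _ _) (integrZ _ (ip 1%N))) !(expectZ _ (ip _)).
by rewrite !expect_phi expect_cst !mulr0 !addr0.
Qed.

Variable f : R -> R.
Hypothesis mf : measurable_fun [set: R] f.
Hypothesis if2 : integr lam (fun x => f x ^+ 2).
Local Notation m := (\int[lam]_x f x).
Local Notation g := (poisson mu1 mu2 f).

Let if1 : integr lam f. Proof. exact: integr_of_sqr. Qed.

Let trg x : tr g x = g x - f x + m.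
Proof. exact: transition_poisson. Qed.

Let bh : bmeas (tr g). Proof. exact: bmeas_transition. Qed.

(** Exhibits [g] as a bounded perturbation of [f], whence its measurability and square
    integrability. *)
Let gE x : g x = f x + (tr g x - m). Proof. by rewrite trg; ring. Qed.

Let ig2 : integr lam (fun x => g x ^+ 2).
Proof.
under eq_fun do rewrite gE; apply: integr_sqrD => //.
by apply: bmeasB => //; exact: bmeas_cst.
Qed.

Let mg : measurable_fun [set: R] g.
Proof.
have -> : g = fun x => f x + (tr g x - m) by apply/funext => x; exact: gE.
apply: measurable_funD => //.
by have [] : bmeas (fun x => tr g x - m) by apply: bmeasB => //; exact: bmeas_cst.
Qed.

Let ig : integr lam g. Proof. exact: integr_of_sqr. Qed.

Definition sum_var x : R := tr (fun y => g y ^+ 2) x - tr g x ^+ 2.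

(** By invariance the left side is the integral of g^2 - (tr g)^2, and g = (f - m) + tr g leaves (f
    - m)^2 + 2 (f - m) tr g. Since [tr g] is m plus multiples of the [phi k], the last product
    integrates to squared coefficients. *)
Lemma expect_sum_var : \int[lam]_x sum_var x = \int[lam]_x (f x - m) ^+ 2 +
  2 * (mu1 / (1 - mu1) * coef 1 f ^+ 2 + mu2 / (1 - mu2) * coef 2 f ^+ 2).
Proof.
have ih2 := integr_bmeas lam (bmeasX 2 bh).
have ifm : integr lam (fun x => f x - m) by apply: integrB => //; exact: integr_cst.
have ifm2 : integr lam (fun x => (f x - m) ^+ 2).
  by apply: (integr_sqrD (b := fun=> - m)) => //; exact: bmeas_cst.
rewrite /sum_var expectB; [|exact/integr_bmeas/bmeas_transition|exact: ih2].
rewrite expect_transition -expectB//.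
have -> : (fun x => g x ^+ 2 - tr g x ^+ 2) =
    fun x => (f x - m) ^+ 2 + 2 * (tr g x * (f x - m)).
  by apply/funext => x; rewrite [g x]gE; ring.
have ihf : integr lam (fun x => tr g x * (f x - m)) by exact: integrM.
rewrite (expectD ifm2 (integrZ 2 ihf)) (expectZ _ ihf); congr (_ + 2 * _).
set p1 := mu1 / (1 - mu1); set p2 := mu2 / (1 - mu2).
have ip k := integr_phiM k ifm.
have -> : (fun x => tr g x * (f x - m)) = fun x => m * (f x - m) +
    ((p1 * coef 1 f) * (phi 1 x * (f x - m)) + (p2 * coef 2 f) * (phi 2 x * (f x - m))).
  by apply/funext => x; rewrite trg /poisson -/p1 -/p2; ring.
rewrite (expectD (integrZ m ifm) (integrD (integrZ _ (ip 1%N)) (integrZ _ (ip 2%N)))).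
rewrite (expectD (integrZ _ (ip 1%N)) (integrZ _ (ip 2%N))) !(expectZ _ (ip _)) (expectZ _ ifm).
rewrite (expectB if1 (integr_cst _ _)) expect_cst subrr mulr0 add0r.
have ic k : \int[lam]_x (phi k x * (f x - m)) = coef k f.
  under eq_Rintegral do rewrite mulrBr.
  have ipk := integr_bmeas lam (bmeas_phi R k).
  have -> : (fun x => phi k x * f x - phi k x * m) =
      fun x => phi k x * f x - m * phi k x by apply/funext => x; ring.
  by rewrite (expectB (integr_phiM k if1) (integrZ m ipk)) (expectZ _ ipk) expect_phi mulr0 subr0.
by rewrite !ic; ring.
Qed.

Lemma sum_clt : exists B : R,
  [/\ 0 <= \int[lam]_x sum_var x,
  forall n, integr P (fun w => Num.sqrt (1 + ((fsum U f n w - n%:R * m) / Num.sqrt n%:R) ^+ 2)) /\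
    \int[P]_w Num.sqrt (1 + ((fsum U f n w - n%:R * m) / Num.sqrt n%:R) ^+ 2) <= B &
  forall t theta : R,
    \int[P]_w cos (t / Num.sqrt n%:R * (fsum U f n w - n%:R * m) + theta) @[n --> \oo] -->
    expR (- (t ^+ 2 * (\int[lam]_x sum_var x) / 2)) * cos theta].
Proof.
(* By the Poisson equation f(x) - m = g(x) - tr g(x), so the centred sum differs from the martingale
   by g(U_0) - g(U_n) only. *)
pose D (z : R * R) := g z.2 - tr g z.1.
have [mh [M hM]] := bh.
have mD : measurable_fun [set: R * R] D.
  apply: measurable_funB; first exact: (measurableT_comp mg measurable_snd).
  exact: (measurableT_comp mh measurable_fst).
(* The envelope may involve the second variable only; the term in the first one is replaced by its
   bound. *)
pose xi x := `|g x| + M.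
have mxi : measurable_fun [set: R] xi.
  by apply: measurable_funD => //; exact: measurableT_comp.
have ixi : integr lam (fun x => xi x ^+ 2).
  apply: (integr_sqrD (b := fun=> M) (f := fun x => `|g x|)).
  - exact: bmeas_cst.
  - exact: measurableT_comp.
  - by under eq_fun do rewrite real_normK ?num_real//.
have D_xi x y : `|D (x, y)| <= xi y by rewrite (le_trans (ler_normB _ _))// lerD2l.
pose l : seq ((R -> R) * (R -> R)) := [:: (fun=> 1, g); (fun x => - tr g x, fun=> 1)].
pose l2 : seq ((R -> R) * (R -> R)) := [:: (fun=> 1, fun y => g y ^+ 2);
  (fun x => - 2 * tr g x, g); (fun x => tr g x ^+ 2, fun=> 1)].
have b1 c : bmeas (fun _ : R => c : R) by exact: bmeas_cst.
have i1 := integr_cst lam 1.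
have gl : separable_factors l by split=> //; split=> //; exact: bmeasN.
have gl2 : separable_factors l2.
  by split=> //; split=> //; [exact: bmeasM|split=> //; exact: bmeasX].
have Dl x y : D (x, y) = \sum_(p <- l) p.1 x * p.2 y.
  by rewrite !big_cons big_nil /D/=; ring.
have tl x : 0 = \sum_(p <- l) p.1 x * tr p.2 x.
  by rewrite !big_cons big_nil /= transition_cst; ring.
have Dl2 x y : D (x, y) ^+ 2 = \sum_(p <- l2) p.1 x * p.2 y.
  by rewrite !big_cons big_nil /D/=; ring.
have tl2 x : sum_var x = \sum_(p <- l2) p.1 x * tr p.2 x.
  by rewrite !big_cons big_nil /= transition_cst /sum_var; ring.
pose X n w := fsum U f n w - n%:R * m.
have mX n : measurable_fun [set: T] (X n).
  apply: measurable_funB => //; apply: measurable_sum => i.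
  exact: (measurableT_comp mf (measurable_chain U i)).
have XE n w : X n w - psum (fun k w => D (U k w, U k.+1 w)) n w = g (U 0%N w) - g (U n w).
  elim: n => [|n ih]; first by rewrite /X /fsum /psum !big_ord0 mul0r !subrr.
  rewrite psumS /X /fsum big_ord_recr /= -/(fsum U f n w) -natr1.
  have -> (a b c e q : R) : a + b - (q + 1) * m - (c + e) = (a - q * m - c) + (b - m - e) by ring.
  by rewrite -/(X n w) ih /D /= trg; ring.
have igU k : integr P (fun w => g (U k w)) by exact: (chain_integr hU k ig).
have iX n : integr P (fun w => X n w - psum (fun k w => D (U k w, U k.+1 w)) n w).
  by under eq_fun do rewrite XE; exact: integrB.
pose C := \int[lam]_x `|g x| + \int[lam]_x `|g x|.
have XC n : \int[P]_w `|X n w - psum (fun k w => D (U k w, U k.+1 w)) n w| <= C.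
  have mng : measurable_fun [set: R] (fun x => `|g x|) by exact: measurableT_comp.
  rewrite /C -{1}(chain_expect hU 0 mng) -(chain_expect hU n mng).
  rewrite -(expectD (integr_norm (igU 0%N)) (integr_norm (igU n))).
  apply: le_expect; [exact: integr_norm|by apply: integrD; exact: integr_norm|].
  by move=> w; rewrite XE ler_normB.
exists (1 + (\int[lam]_x sum_var x) / 2 + C); split.
- exact: (clt_var_ge0 hU gl2 Dl2 tl2).
- by move=> n; exact: (clt_tight hU mD mxi ixi D_xi gl Dl tl gl2 Dl2 tl2 mX iX XC).
- move=> t theta.
  exact: (clt_cos hU mu1_neq1 mu2_neq1 mD mxi ixi D_xi gl Dl tl gl2 Dl2 tl2 mX iX XC).
Qed.

Lemma variance_chain : fine 'V_P[f \o U 0%N]%E = \int[lam]_x (f x - m) ^+ 2.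
Proof.
have ifm2 : integr lam (fun x => (f x - m) ^+ 2).
  by apply: (integr_sqrD (b := fun=> - m)) => //; exact: bmeas_cst.
rewrite -(chain_expect hU 0 (integr_measurable ifm2)).
have E : 'E_P[f \o U 0%N]%E = m%:E.
  by rewrite (expectation_Rintegral (chain_integr hU 0 if1)) (chain_expect hU 0 mf).
rewrite /variance unlock E /=.
rewrite [X in 'E_P[X]%E](_ : _ = fun w => (f (U 0%N w) - m) ^+ 2); last by apply/funext.
by rewrite (expectation_Rintegral (chain_integr hU 0 ifm2)).
Qed.

Theorem fsum_clt : cvg_in_distribution P
  (fun (n : nat) (w : T) => Num.sqrt n%:R * (fsum U f n w / n%:R - m))
  (normal_law 0 (\int[lam]_x sum_var x)) idfun.
Proof.
have [B [s0 tight ct]] := sum_clt; set s := \int[lam]_x sum_var x in s0 ct *.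
move=> h ch [M hM].
(* The two-dimensional continuity theorem is used with second coordinate 0. *)
pose G (z : R * R) := h z.1.
have cG : continuous G.
  by move=> z; apply: (@continuous_comp _ _ _ (@fst R R) h); [exact: cvg_fst|exact: ch].
have GM z : `|G z| <= M by exact: hM.
pose X n w := (fsum U f n w - n%:R * m) / Num.sqrt n%:R.
have mX n : measurable_fun [set: T] (X n).
  apply: measurable_funM => //; apply: measurable_funB => //; apply: measurable_sum => i.
  exact: (measurableT_comp mf (measurable_chain U i)).
pose X' (x : measurableTypeR R) : R := x.
have mX' : measurable_fun [set: measurableTypeR R] X' by exact: measurable_id.
have m0 d' (T' : measurableType d') : measurable_fun [set: T'] (fun _ : T' => 0 : R).
  exact: measurable_cst.
have ih : integr (normal_law 0 s) (fun x => G (X' x, 0)).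
  by apply: integr_bmeas; exact: (continuous_bmeas mX' (m0 _ _) cG GM).
have -> : 'E_(normal_law 0 s)[h \o idfun]%E = (\int[normal_law 0 s]_x G (X' x, 0))%:E.
  exact: (expectation_Rintegral ih).
suff H : \int[P]_w G (X n w, 0) @[n --> \oo] --> \int[normal_law 0 s]_x G (X' x, 0).
  have HE : (\int[P]_w G (X n w, 0))%:E @[n --> \oo] -->
      (\int[normal_law 0 s]_x G (X' x, 0))%:E by apply: cvg_EFin => //; exact: nearW.
  apply: cvg_trans HE.
  apply: near_eq_cvg; apply: nearW => n; rewrite -expectation_Rintegral; last first.
    by apply: integr_bmeas; exact: (continuous_bmeas (mX n) (m0 _ _) cG GM).
  congr ('E_P[ _ ]%E); apply/funext => w; rewrite /= /G /X /=; congr h.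
  (* At n = 0 both arguments are 0, by the convention on inverses. *)
  case: n => [|n]; first by rewrite !(sqrtr0, invr0, mulr0, mul0r).
  have r0 : Num.sqrt n.+1%:R != 0 :> R by rewrite gt_eqF// sqrtr_gt0 ltr0n.
  have rr : n.+1%:R = Num.sqrt n.+1%:R ^+ 2 :> R by rewrite sqr_sqrtr.
  by rewrite {1 4}rr; field.
have i0 d' (T' : measurableType d') (Q : probability T' R) :
    integr Q (fun _ => Num.sqrt (1 + 0 ^+ 2)) by exact: integr_cst.
apply: (@cvg_expect_of_trig R _ T P X (fun _ _ => 0) _ _ (normal_law 0 s) X' (fun=> 0) (Num.max B 1)
  mX (fun=> m0 _ _) mX' (m0 _ _) _ (fun=> i0 _ _ _) _ _ _ (i0 _ _ _) _ G M cG GM).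
- by move=> n; have [] := tight n.
- by move=> n; have [_ h1] := tight n; rewrite le_max h1.
- by move=> n; rewrite expr0n addr0 sqrtr1 expect_cst le_max lexx orbT.
- exact: integr_normal_law.
move=> a b theta.
have -> : \int[normal_law 0 s]_w cos (a * X' w + b * 0 + theta) =
    expR (- (a ^+ 2 * s / 2)) * cos theta.
  by rewrite -normal_law_cos//; apply: eq_Rintegral => x _; rewrite mulr0 addr0.
have -> : (fun n => \int[P]_w cos (a * X n w + b * 0 + theta)) =
    fun n => \int[P]_w cos (a / Num.sqrt n%:R * (fsum U f n w - n%:R * m) + theta).
  apply/funext => n; apply: eq_Rintegral => w _; congr cos.
  by rewrite /X; ring.
exact: ct.
Qed.

End sum_clt.

Lemma coef_sqr (R : realType) (f : R -> R) k : measurable_fun [set: R] f ->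
  integr (unif R) f -> coef k f ^+ 2 = sin_coef_sqr f k.
Proof.
move=> mf if1; have ms := bmeas_sink R k.
have isf : integr (unif R) (fun x => sink k x * f x) by exact: integrM.
rewrite /coef; under eq_Rintegral do rewrite phiE -mulrA.
rewrite (expectZ _ isf) exprMn sqr_sqrtr// /sin_coef_sqr; congr (_ * _ ^+ 2).
by rewrite unif_lebesgue//; apply: measurable_funM => //; have [] := ms.
Qed.

Theorem theorem4p1 (R : realType) (mu1 mu2 : R)
    (hmu : 2 * `|mu1| + 2 * `|mu2| <= 1)
    (d : measure_display) (T : measurableType d) (P : probability T R)
    (U : nat -> {RV P >-> R})
    (hU : stationary_copula_chain (sine_copula mu1 mu2) U) :
  cvg_in_distribution P
    (fun (n : nat) (w : T) =>
      Num.sqrt n.-1%:R *: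
        (col2 (mu_hat U 1 n w) (mu_hat U 2 n w) - col2 mu1 mu2))
    (std_normal2 R)
    (normal_vector2 (col2 0 0) (mx2 1 (- (mu1 * mu2)) (- (mu1 * mu2)) 1))
  /\
  (forall f : R -> R, measurable_fun [set: R] f ->
    (\int[lebesgue_measure]_(x in `[0%R, 1%R]) ((f x) ^+ 2)%:E < +oo)%E ->
    let mu := \int[lebesgue_measure]_(x in `[0, 1]) f x in
    let sigma2 := fine 'V_P[f \o U 0%N]%E in
    let sigmaf2 := sigma2 +
      2 * (mu1 * sin_coef_sqr f 1 / (1 - mu1)
           + mu2 * sin_coef_sqr f 2 / (1 - mu2)) in
    cvg_in_distribution P
      (fun (n : nat) (w : T) => Num.sqrt n%:R * (fsum U f n w / n%:R - mu))
      (normal_law 0 sigmaf2) idfun).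
Proof.
have [m1 m2 _] := mu_bounds hmu; split=> [|f mf f2].
  exact: (joint_clt hU hmu).
have if2 := integr_unif_sqr mf f2; have if1 := @integr_of_sqr _ _ R (unif R) f mf if2.
move=> mu sigma2 sigmaf2.
have muE : \int[unif R]_x f x = mu by exact: unif_lebesgue.
have sE : \int[unif R]_x sum_var mu1 mu2 f x = sigmaf2.
  rewrite (expect_sum_var m1 m2 mf if2) -(variance_chain hU mf if2).
  rewrite (coef_sqr 1 mf if1) (coef_sqr 2 mf if1) -/sigma2 /sigmaf2.
  by rewrite ![_ / _ * _]mulrAC.
have := fsum_clt hU m1 m2 mf if2.
by rewrite sE muE.
Qed.
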